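(* Let $G$ be a finitely generated group with a fixed finite symmetric generating set $S$, let $\mathcal H$ be a separable complex Hilbert space, let $\pi\colon G\to U(\mathcal H)$ be a unitary representation, and let $n\ge1$. Let $c_{e_1},\dots,c_{e_n}\in Z^1(G,\mathrm{HS}(\mathcal H)_{\mathrm{Ad}\,\pi})$ be skew-adjoint, put $a_i=\max_{s\in S}\|c_{e_i}(s)\|_2$, and assume that $H^2(G,\mathrm{HS}(\mathcal H)_{\mathrm{Ad}\,\pi})=0$. Then there exist a constant $\eta\ge1$ and an $n$-parameter formal unitary deformation $$\pi_t(g)=\Bigl(1_{\mathcal H}+\sum_{|\alpha|\ge1}c_\alpha(g)t^\alpha\Bigr)\pi(g)\qquad(g\in G)$$ of $\pi$, whose coefficients in degrees $e_1,\dots,e_n$ are the given cocycles, such that $$\max_{s\in S}\|c_\alpha(s)\|_2\le\eta^{|\alpha|-1}\frac1{|\alpha|}\binom{|\alpha|}{\alpha}C_{|\alpha|-1}\,a_1^{\alpha_1}\cdots a_n^{\alpha_n}\qquad\text{for all }\alpha\in\mathbb N^n\setminus\{0\}.$$ Consequently, the series converges absolutely (in the Hilbert–Schmidt norm, for every $g\in G$) on the open set $$\Bigl\{t\in\mathbb R^n:\ a_1|t_1|+\cdots+a_n|t_n|<\tfrac1{4\eta}\Bigr\},$$ and the resulting limit defines an analytic unitary deformation of $\pi$; that is, for each $t$ in this set, $\pi_t$ is a unitary representation of $G$ on $\mathcal H$.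
   Context: $\mathrm{HS}(\mathcal H)$ is the ideal of Hilbert–Schmidt operators with $\|T\|_2^2=\operatorname{Tr}(T^*T)$; $\mathrm{HS}(\mathcal H)_{\mathrm{Ad}\,\pi}$ carries the $G$-action $g\cdot T=\pi(g)T\pi(g)^{-1}$. For a $G$-module $V$, $C^k(G,V)=V^{G^k}$ with the usual inhomogeneous differential $d_k$ (so $(d_1c)(g,h)=g\cdot c(h)-c(gh)+c(g)$), $Z^k(G,V)=\ker d_k$, and $H^k(G,V)=Z^k(G,V)/d_{k-1}C^{k-1}(G,V)$ (unreduced). A cochain $c\in C^1$ is skew-adjoint if $c(g)^*=-c(g)$ for all $g$. Multi-indices: $\alpha=(\alpha_1,\dots,\alpha_n)\in\mathbb N^n$ ($0\in\mathbb N$), $|\alpha|=\sum\alpha_i$, $t^\alpha=\prod t_i^{\alpha_i}$, $\binom{|\alpha|}{\alpha}=|\alpha|!/\prod\alpha_i!$, $e_i$ the standard basis multi-indices. $C_m=\frac1{m+1}\binom{2m}{m}$ is the $m$-th Catalan number. An $n$-parameter formal unitary deformation of $\pi$ is a formal series $\pi_t(g)=u_t(g)\pi(g)$, $u_t(g)=1_{\mathcal H}+\sum_{|\alpha|\ge1}c_\alpha(g)t^\alpha\in B(\mathcal H)[[t_1,\dots,t_n]]$ with $c_\alpha(g)\in\mathrm{HS}(\mathcal H)$, such that, as identities of formal power series, $\pi_t(gh)=\pi_t(g)\pi_t(h)$ and $\pi_t(g)^*\pi_t(g)=1_{\mathcal H}$ for all $g,h\in G$ (the $t_i$ being treated as self-adjoint,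 i.e. real, parameters). *)

(* Defs.v *)
From HB Require Import structures.
From mathcomp Require Import all_boot all_order all_algebra.
From mathcomp Require Import finmap.
From mathcomp Require Import all_classical all_reals all_analysis.
From mathcomp Require Import complex.

Set Implicit Arguments.
Unset Strict Implicit.
Unset Printing Implicit Defensive.

Import Order.TTheory GRing.Theory Num.Theory.
Import numFieldNormedType.Exports.

Local Open Scope classical_set_scope.
Local Open Scope ring_scope.

(* Spaces of functions carry their pointwise module structure throughout; for  *)
(* A, B : V -> V, the product of operators is A \o B and the unit is id.       *)

Section GroupCohomology.
Variables (G : groupType) (V : zmodType) (act : G -> V -> V) (A : set V).

(* A k-tuple of elements of G is a function 'I_k -> G. *)
Definition merge k (i : 'I_k) (g : 'I_k.+1 -> G) (j : 'I_k) : G :=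
  if (j < i)%N then g (lift ord_max j)
  else if j == i then (g (lift ord_max j) * g (lift ord0 j))%g
  else g (lift ord0 j).

(* Note that merge i, for i = 0, .., k - 1, multiplies the arguments number    *)
(* i + 1 and i + 2 in the usual 1-based numbering, whence the sign.            *)
Definition differential k (c : ('I_k -> G) -> V) (g : 'I_k.+1 -> G) : V :=
  act (g ord0) (c (fun j => g (lift ord0 j)))
  + \sum_(i < k) c (merge i g) *~ (-1) ^+ i.+1
  + c (fun j => g (lift ord_max j)) *~ (-1) ^+ k.+1.

(* The G-module is given as a submodule A of V, so that cochains are functions *)
(* to V with values in A.                                                      *)
Definition cochain k : set (('I_k -> G) -> V) := [set c | forall g, A (c g)].

Definition cocycle k : set (('I_k -> G) -> V) :=
  [set c | cochain c /\ differential c = (fun=> 0)].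

Definition coboundary k : set (('I_k -> G) -> V) :=
  match k with
  | 0 => [set (fun=> 0)]
  | k.+1 => @differential k @` @cochain k
  end.

Definition cohomology_vanishes k := @cocycle k `<=` @coboundary k.

Definition cochain1_of (c : G -> V) : ('I_1 -> G) -> V := fun g => c (g ord0).

Lemma differential1E (c : G -> V) (g h : G) :
  differential (cochain1_of c) (fun i : 'I_2 => if i == ord0 then g else h)
  = act g (c h) - c (g * h)%g + c g.
Proof.
rewrite /differential /cochain1_of big_ord_recl big_ord0 addr0 /merge /=.
by rewrite expr1 sqrrN expr1n mulr1z mulrN1z.
Qed.

Lemma differential2E (c : G -> G -> V) (g h k : G) :
  differential (fun x : 'I_2 -> G => c (x ord0) (x ord_max))
    (fun i : 'I_3 => nth 1%g [:: g; h; k] i)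
  = act g (c h k) - c (g * h)%g k + c g (h * k)%g - c g h.
Proof.
rewrite /differential 2!big_ord_recl big_ord0 addr0 /merge /=.
by rewrite /bump /= expr1 sqrrN expr1n mulr1z exprS sqrrN expr1n mulr1 !mulrN1z !addrA.
Qed.

End GroupCohomology.

Definition generates (G : groupType) (S : {fset G}) :=
  forall K : set G, K 1%g -> (forall x y, K x -> K y -> K (x * y)%g) ->
    (forall x, K x -> K x^-1%g) -> (forall s, s \in S -> K s) -> K = setT.

Definition separable (T : topologicalType) :=
  exists D : set T, countable D /\ dense D.

Section HilbertSchmidt.
Variables (R : realType) (H : completeNormedModType R[i]).
Variable (dot : {dot H for Num.conj}).

Definition bounded_operator : set (H -> H) :=
  [set T | linear T /\ exists M : R[i], forall x, `|T x| <= M * `|x|].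

Definition is_adjoint (T T' : H -> H) :=
  forall x y, dot (T x) y = dot x (T' y).

(* The adjoint of a bounded operator of a Hilbert space, and a junk value on   *)
(* functions without adjoint.                                                  *)
Definition adj (T : H -> H) : H -> H := xget 0 [set T' | is_adjoint T T'].

Definition skew_adjoint (T : H -> H) := adj T = - T.

Definition unitary_operator : set (H -> H) :=
  [set U | [/\ linear U, forall x y, dot (U x) (U y) = dot x y
             & forall y, exists x, U x = y]].

Definition unitary_rep (G : groupType) (pi : G -> H -> H) :=
  (forall g, unitary_operator (pi g)) /\
  (forall g h, pi (g * h)%g = pi g \o pi h).

Definition orthonormal_set (B : set H) :=
  forall e f, B e -> B f -> dot e f = (e == f)%:R.

Definition orthonormal_basis (B : set H) :=
  orthonormal_set B /\ forall x, (forall e, B e -> dot x e = 0) -> x = 0.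

Lemma ex_orthonormal_basis : exists B, orthonormal_basis B.
Proof.
have [F FP Ftot|B [Bon Bmax]] := @Zorn_bigcup H orthonormal_set.
  move=> e f [X FX Xe] [Y FY Yf]; have [XY|YX] := Ftot _ _ FX FY.
    by apply: (FP _ FY) => //; exact: XY.
  by apply: (FP _ FX) => //; exact: YX.
exists B; split=> // x xB; apply/eqP/negPn/negP => x0.
pose a := sqrtC (dot x x); pose u := a^-1 *: x.
have a_gt0 : 0 < a by rewrite sqrt_dnorm_gt0.
have uu : dot u u = 1.
  rewrite dnormZ -(sqrtCK (dot x x)) -/a ger0_norm ?invr_ge0 ?ltW//.
  by rewrite -exprMn mulVf ?expr1n// gt_eqF.
have uB e : B e -> dot u e = 0 by move=> Be; rewrite linearZl_LR/= xB ?mulr0.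
have Bu e : B e -> dot e u = 0.
  by move=> Be; rewrite hermC/= uB// expr0 mul1r conjC0.
have NBu : ~ B u by move=> /uB; rewrite uu => /eqP; rewrite oner_eq0.
apply: (Bmax (B `|` [set u])).
  by split=> [y By|BuB]; [left|apply: NBu; apply: BuB; right].
move=> e f [Be|->] [Bf|->]; first exact: Bon.
- by rewrite Bu//; case: eqP => // eu; case: NBu; rewrite -eu.
- by rewrite uB//; case: eqP => // uf; case: NBu; rewrite uf.
- by rewrite uu eqxx.
Qed.

Definition onb : set H := projT1 (cid ex_orthonormal_basis).

(* The trace of a positive operator; it does not depend on the basis.          *)
Definition op_trace (T : H -> H) : \bar R :=
  (\esum_(e in onb) (complex.Re (dot (T e) e))%:E)%R.

Definition hs_sqnorm (T : H -> H) : \bar R := op_trace (adj T \o T).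

Definition HS : set (H -> H) :=
  [set T | bounded_operator T /\ (hs_sqnorm T < +oo)%E].

(* Meaningful on HS only: fine maps +oo to 0. *)
Definition hs_norm (T : H -> H) : R := Num.sqrt (fine (hs_sqnorm T)).

Definition hs_absolutely_summable (T : choiceType) (I : set T)
    (f : T -> H -> H) :=
  (forall i, I i -> HS (f i)) /\ (\esum_(i in I) (hs_norm (f i))%:E < +oo)%E.

(* L is the unconditional sum of the f i, for i in I, in the Hilbert-Schmidt   *)
(* norm.                                                                       *)
Definition hs_sum (T : choiceType) (I : set T) (f : T -> H -> H) (L : H -> H) :=
  HS L /\
  forall e : R, 0 < e -> exists2 F : {fset T}, [set` F] `<=` I &
    forall F' : {fset T}, [set` F] `<=` [set` F'] -> [set` F'] `<=` I ->
      hs_norm (L - \sum_(i <- F') f i) < e.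

End HilbertSchmidt.

Section MultiIndices.
Variables (R : realType) (n : nat).

Definition mindex := {ffun 'I_n -> nat}.

Definition mdeg (a : mindex) : nat := (\sum_i a i)%N.

Definition mdelta (i : 'I_n) : mindex := [ffun j => (j == i : nat)].

Definition mpow (t : 'I_n -> R) (a : mindex) : R := \prod_i t i ^+ a i.

Definition multinomial (a : mindex) : R :=
  (mdeg a)`!%:R / \prod_i (a i)`!%:R.

Definition catalan (m : nat) : R := 'C(2 * m, m)%:R / m.+1%:R.

End MultiIndices.

Section FormalDeformations.
Variables (R : realType) (H : completeNormedModType R[i]).
Variable (dot : {dot H for Num.conj}).
Variables (G : groupType) (pi : G -> H -> H) (n : nat).

(* Formal power series in n self-adjoint variables with operator coefficients. *)
Definition fseries := mindex n -> H -> H.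

Definition fone : fseries := fun a => if a == 0 then id else 0.

Definition fmul (A B : fseries) : fseries := fun c =>
  \sum_(p \in [set p : mindex n * mindex n | p.1 + p.2 = c]) (A p.1 \o B p.2).

Definition fadj (A : fseries) : fseries := fun a => adj dot (A a).

(* (1 + \sum_(a != 0) c a g t^a) pi g; the value of c at 0 is irrelevant.      *)
Definition fdeform (c : mindex n -> G -> H -> H) (g : G) : fseries :=
  fun a => (if a == 0 then id else c a g) \o pi g.

Definition formal_unitary_deformation (c : mindex n -> G -> H -> H) :=
  [/\ forall a g, a != 0 -> HS dot (c a g),
      forall g h, fdeform c (g * h)%g = fmul (fdeform c g) (fdeform c h)
    & forall g, fmul (fadj (fdeform c g)) (fdeform c g) = fone].

Definition Ad (g : G) (T : H -> H) : H -> H := pi g \o T \o pi g^-1%g.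

End FormalDeformations.

(* Main.v *)
(** Write [pi_t g = U_t g] with constant term [pi g]. Degree by degree, the failure of a partially
constructed [U_t] to be multiplicative is, in the first degree where it occurs, a 2-cocycle; a
primitive repairs it, and averaging with the adjoint inverse restores unitarity.

For the estimates, 2-cocycles [E] with [|E g h| <= r * w g h], for a fixed weight [w], form a
Banach space. Baire's theorem and successive approximations, as in the open mapping theorem,
provide primitives bounded by [K * r] on [S]. The weight is [w g h = M g * M h], where [M g]
comes from writing [g] as a word in [S]: if the coefficients are majorized on [S] by the numbers
[Phi_al = eta^(|al|-1) / |al| * multinomial al * C_(|al|-1) * a^al] then they are majorized by
[M g * Phi_al] at [g], whatever [eta >= 1]. Indeed the Catalan recurrence, 1/(kl) <= 2/(k+l) and
Vandermonde's identity give [eta * (Phi * Phi) <= 2 * Phi] for the convolution. The same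
inequality closes the induction as soon as [eta >= 2 (K + 1)].

The sums of the [Phi_al * |t|^al] over the degrees [k] are dominated by the geometric series of
ratio [4 * eta * \sum_i a_i * |t_i|], and the polynomial identities pass to the limit. *)

Require Import Defs.
From HB Require Import structures.
From mathcomp Require Import all_boot all_order all_algebra.
From mathcomp Require Import finmap.
From mathcomp Require Import all_classical all_reals all_analysis.
From mathcomp Require Import complex.
From mathcomp Require Import ring lra zify.

Import Order.TTheory GRing.Theory Num.Theory.
Import numFieldNormedType.Exports.

Local Open Scope classical_set_scope.
Local Open Scope ring_scope.

Set Implicit Arguments.
Unset Strict Implicit.
Unset Printing Implicit Defensive.

(** * Orthonormal expansions *)

(** The vanishing of H^2 is purely algebraic: it yields primitives without any estimate, and the
    space of all cochains is in general not a Banach space. Weighted cocycles form one, but there a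
    circle threatens: the constant [K] depends on the weight, [eta] depends on [K], and the weight
    has to control coefficients whose majorant involves [eta]. It is broken because the factors
    [M g] are found for all [eta >= 1] at once, before [eta] is chosen.

    Working with [U g], which is [c g] multiplied on the right by [rho g], turns multiplicativity
    into a plain convolution identity, and the conjugation action into left and right multiplication
    by the isometries [rho g]. *)

Lemma big_fset_subD (I : choiceType) (V : nmodType) (A B : {fset I}) (f : I -> V) :
  (A `<=` B)%fset ->
  \sum_(i <- B) f i = \sum_(i <- A) f i + \sum_(i <- (B `\` A)%fset) f i.
Proof.
move=> AB; rewrite (big_fsetID _ (mem A) B)/=; congr (_ + _).
  apply: eq_fbigl => e; rewrite !inE/= andbC.
  by case: (boolP (e \in A)) => //= eA; exact: (fsubsetP AB).
by apply: eq_fbigl => e; rewrite !inE/= andbC.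
Qed.

Lemma ler_sum_fset (I : choiceType) (R : numDomainType) (A B : {fset I}) (f : I -> R) :
  (forall i, 0 <= f i) -> (A `<=` B)%fset ->
  \sum_(i <- A) f i <= \sum_(i <- B) f i.
Proof. by move=> f0 AB; rewrite (big_fset_subD _ AB) lerDl sumr_ge0. Qed.

Lemma expr_small (R : realType) (r e : R) : 0 <= r -> r < 1 -> 0 < e ->
  exists k, forall j, (k <= j)%N -> r ^+ j <= e.
Proof.
move=> r0 r1 e0; have r1' : `|r| < 1 by rewrite ger0_norm.
have /cvgrPdist_lt h := cvg_expr r1'.
have [N _ Nh] := h _ e0; exists N => j /Nh; rewrite /= sub0r normrN => /ltW.
exact/le_trans/ler_norm.
Qed.

Lemma half_expr_small (R : realType) (e : R) : 0 < e -> exists k, 2^-1 ^+ k <= e.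
Proof.
move=> e0; have [||k /(_ k (leqnn k)) h] := @expr_small R 2^-1 e _ _ e0.
- by rewrite invr_ge0.
- by rewrite invf_lt1// ltr1n.
by exists k.
Qed.

(** [F k] comes within [d k] of the supremum of all finite sums, so at most [d k] is left for the
    finite sets disjoint from it. This makes summation over an index set without enumeration
    sequential; it serves both orthonormal expansions and unconditional sums of operators. *)
Lemma exhaustion (R : realType) (T : choiceType) (I : set T) (s : T -> R) (B : R)
    (d : nat -> R) :
  (forall i, 0 <= s i) -> (forall k, 0 < d k) ->
  (forall F : {fset T}, [set` F] `<=` I -> \sum_(i <- F) s i <= B) ->
  exists F : nat -> {fset T}, [/\ forall k, [set` F k] `<=` I,
    forall k j, (k <= j)%N -> (F k `<=` F j)%fset
    & forall k (A : {fset T}), [set` A] `<=` I -> [disjoint A & F k]%fset ->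
      \sum_(i <- A) s i <= d k].
Proof.
move=> s0 d0 sB.
pose sums := [set x : R | exists2 F : {fset T}, [set` F] `<=` I &
  x = \sum_(e <- F) s e].
have sums_sup : has_sup sums.
  split; first by exists 0, fset0 => //; rewrite big_seq_fset0.
  by exists B => x [F FI ->]; exact: sB.
have ex (k : nat) : exists F : {fset T}, [set` F] `<=` I /\
    sup sums - d k < \sum_(e <- F) s e.
  by have [_ [F FI ->] lt] := sup_adherent (d0 k) sums_sup; exists F.
have [f fP] := choice ex.
pose F k := (\bigcup_(i <- iota 0 k.+1) f i)%fset.
have inF k e : (e \in F k) = [exists i : 'I_k.+1, e \in f i].
  apply/bigfcupP/existsP => [[j]|[j ef]].
    by rewrite mem_iota/= add0n andbT => jk ef; exists (Ordinal jk).
  by exists (val j); rewrite // mem_iota/= add0n andbT.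
have FI k : [set` F k] `<=` I.
  by move=> e /=; rewrite inF => /existsP[i ef]; have [fI _] := fP i; exact: fI.
exists F; split=> // [k j kj|k A AI dis].
  apply/fsubsetP => e; rewrite !inF => /existsP[i ef].
  by apply/existsP; exists (widen_ord (kj : k.+1 <= j.+1)%N i).
have FS : sup sums - d k < \sum_(e <- F k) s e.
  have [_ /lt_le_trans] := fP k; apply; apply: ler_sum_fset => //.
  by apply/fsubsetP => e ef; rewrite inF; apply/existsP; exists ord_max.
have U : [set` (A `|` F k)%fset] `<=` I.
  by move=> e /=; rewrite inE => /orP[/AI//|/FI].
have : \sum_(e <- (A `|` F k)%fset) s e <= sup sums.
  by apply: sup_ubound; [have [] := sums_sup|exists (A `|` F k)%fset].
rewrite (big_fset_subD _ (fsubsetUr _ _)) => h.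
rewrite (_ : A = (A `|` F k) `\` F k)%fset; last first.
  apply/fsetP => e; rewrite !inE; case: (boolP (e \in F k)) => //= eF; last by rewrite orbF.
  by apply: contraTF eF => /(fdisjointP dis).
by lra.
Qed.

Section RealNorm.
Variables (R : realType) (V : normedZmodType R[i]).

(** The norm of a normed module over [R[i]] has values in [R[i]]; its real part lives in an ordered
    field, where [lra] and [nra] apply. *)
Definition nrm (x : V) : R := complex.Re `|x|.

Lemma nrmE x : `|x| = (nrm x)%:C%C.
Proof. by rewrite /nrm RRe_real// normr_real. Qed.

Lemma nrm_ge0 x : 0 <= nrm x.
Proof. by rewrite -ler0c -nrmE. Qed.

Lemma nrm0 : nrm 0 = 0.
Proof. by rewrite /nrm normr0. Qed.

Lemma nrm_eq0 x : nrm x = 0 -> x = 0.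
Proof. by move=> x0; apply/eqP; rewrite -normr_eq0 nrmE x0. Qed.

Lemma nrmN x : nrm (- x) = nrm x.
Proof. by rewrite /nrm normrN. Qed.

Lemma nrmC x y : nrm (x - y) = nrm (y - x).
Proof. by rewrite -nrmN opprB. Qed.

Lemma ler_nrmD x y : nrm (x + y) <= nrm x + nrm y.
Proof. by have := ler_normD x y; rewrite !nrmE -rmorphD lecR. Qed.

Lemma ler_nrmB x y : nrm (x - y) <= nrm x + nrm y.
Proof. by rewrite -[leRHS]/(_ + _) -(nrmN y) ler_nrmD. Qed.

Lemma ler_nrm_trans z x y : nrm (x - y) <= nrm (x - z) + nrm (z - y).
Proof. by have := ler_nrmD (x - z) (z - y); rewrite addrA subrK. Qed.

Lemma nrm_le_eps x c : (forall e, 0 < e -> nrm x <= c * e) -> x = 0.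
Proof.
move=> h; apply: nrm_eq0; apply/eqP; rewrite eq_le nrm_ge0 andbT.
apply/ler_addgt0Pr => e e0; rewrite add0r.
have c0 : 0 < `|c| + 1 by rewrite ltr_wpDl.
apply: le_trans (h (e / (`|c| + 1)) _) _; first exact: divr_gt0.
rewrite mulrCA ger_pMr// ler_pdivrMr// mul1r (le_trans (ler_norm c))//.
by rewrite lerDl.
Qed.

End RealNorm.

Lemma nrmM (R : realType) (a b : R[i]) : nrm (a * b) = nrm a * nrm b.
Proof. by apply: complexI; rewrite rmorphM -!nrmE normrM. Qed.

Lemma nrm_conj (R : realType) (a : R[i]) : nrm a^* = nrm a.
Proof. by apply: complexI; rewrite -!nrmE norm_conjC. Qed.

Lemma nrmR (R : realType) (a : R) : nrm a%:C%C = `|a|.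
Proof.
rewrite /nrm normc_def /=.
have -> : (0 : R) ^+ 2 = 0 by rewrite expr0n.
by rewrite addr0 sqrtr_sqr.
Qed.

Lemma nrmZ (R : realType) (V : normedModType R[i]) (a : R[i]) (x : V) :
  nrm (a *: x) = nrm a * nrm x.
Proof. by apply: complexI; rewrite rmorphM/= -!nrmE normrZ. Qed.

Lemma nrm_sqr (R : realType) (a : R[i]) : (nrm a ^+ 2)%:C%C = a * a^*.
Proof. by rewrite rmorphXn/= -nrmE normCK. Qed.

(** The Cauchy rate [b] passes to the limit as an explicit error bound; completeness for
    Hilbert-Schmidt bounds is later put in the same form. *)
Lemma nrm_complete (R : realType) (V : completeNormedModType R[i])
    (x : nat -> V) (b : nat -> R) :
  (forall k j, (k <= j)%N -> nrm (x j - x k) <= b k) ->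
  (forall e, 0 < e -> exists k, b k <= e) ->
  exists l, forall k, nrm (l - x k) <= b k.
Proof.
move=> xb b0.
have cx : cauchy (x @ \oo).
  apply/cauchy_exP => e e0.
  have eE : e = (complex.Re e)%:C%C by rewrite RRe_real// gtr0_real.
  have e'0 : 0 < complex.Re e by rewrite -ltcR -eE.
  have [k bk] := b0 (complex.Re e / 2) (divr_gt0 e'0 (ltr0Sn _ _)).
  exists (x k); exists k => //= j kj; rewrite -ball_normE/= distrC nrmE eE ltcR.
  by apply: le_lt_trans (le_trans (xb _ _ kj) bk) _; rewrite gtr_pMr// invf_lt1// ltr1n.
have /cvg_ex[l xl] : cvg (x @ \oo) by apply/cauchy_cvgP.
exists l => k; apply/ler_addgt0Pr => e e0.
have e0' : 0 < e%:C%C by rewrite ltcR.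
have /cvgrPdist_lt/(_ _ e0')[N _ xN] := xl.
have := xN (maxn N k) (leq_maxl _ _).
rewrite /= nrmE ltcR => /ltW h.
rewrite (le_trans (ler_nrm_trans (x (maxn N k)) _ _))// addrC lerD//.
by rewrite xb// leq_maxr.
Qed.

Section Dot.
Variables (R : realType) (H : completeNormedModType R[i]).
Variable (dot : {dot H for Num.conj}).
Hypothesis dot_norm : forall x : H, dot x x = `|x| ^+ 2.

Local Notation onb := (onb dot).

Lemma dotC x y : dot x y = (dot y x)^*.
Proof. by rewrite hermC/= expr0 mul1r. Qed.

Lemma dotZl a x y : dot (a *: x) y = a * dot x y.
Proof. by rewrite linearZl_LR. Qed.

Lemma dotZr a x y : dot x (a *: y) = a^* * dot x y.
Proof. by rewrite linearZr_LR. Qed.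

Lemma dot_nrm x : dot x x = (nrm x ^+ 2)%:C%C.
Proof. by rewrite dot_norm nrmE rmorphXn. Qed.

Lemma dot_ext x y : (forall z, dot x z = dot y z) -> x = y.
Proof.
move=> h; apply/subr0_eq/nrm_eq0/eqP; rewrite -sqrf_eq0; apply/eqP.
by apply: complexI; rewrite -dot_nrm linearBl/= h subrr.
Qed.

Lemma dot_extr x y : (forall z, dot z x = dot z y) -> x = y.
Proof. by move=> h; apply: dot_ext => z; rewrite dotC h -dotC. Qed.

Lemma pythagoras x y : dot x y = 0 -> nrm (x + y) ^+ 2 = nrm x ^+ 2 + nrm y ^+ 2.
Proof.
move=> xy; apply: complexI; by rewrite rmorphD/= -!dot_nrm hnormDd.
Qed.


Lemma onbP e f : onb e -> onb f -> dot e f = (e == f)%:R.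
Proof. by have [h _] := projT2 (cid (ex_orthonormal_basis dot)); apply: h. Qed.

Lemma nrm_onb e : onb e -> nrm e = 1.
Proof.
move=> eo; apply/eqP; rewrite -sqrp_eq1 ?nrm_ge0//; apply/eqP/complexI.
by rewrite -dot_nrm onbP// eqxx.
Qed.

Lemma onb_max x : (forall e, onb e -> dot x e = 0) -> x = 0.
Proof. by have [_ h] := projT2 (cid (ex_orthonormal_basis dot)); apply: h. Qed.

Definition lincomb (F : {fset H}) (a : H -> R[i]) := \sum_(e <- F) a e *: e.

Lemma dot_lincomb (F : {fset H}) a f : [set` F] `<=` onb -> onb f ->
  dot (lincomb F a) f = if f \in F then a f else 0.
Proof.
move=> Fo fo; rewrite linear_sumlz/=.
case: ifPn => fF; last first.
  rewrite big_seq big1// => e eF; rewrite dotZl onbP//; last exact: Fo.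
  by rewrite (negbTE (memPn fF _ eF)) mulr0.
rewrite (big_fsetD1 f)//= dotZl onbP// eqxx mulr1 big_seq big1 ?addr0// => e.
rewrite !inE => /andP[ef eF]; rewrite dotZl onbP//; last exact: Fo.
by rewrite (negbTE ef) mulr0.
Qed.

Lemma nrm_lincomb (F : {fset H}) a : [set` F] `<=` onb ->
  nrm (lincomb F a) ^+ 2 = \sum_(e <- F) nrm (a e) ^+ 2.
Proof.
move=> Fo; apply: complexI; rewrite -dot_nrm rmorph_sum/=.
rewrite {2}/lincomb linear_sumr/= !big_seq; apply: eq_bigr => e eF.
by rewrite dotZr dot_lincomb ?eF//; [rewrite nrm_sqr mulrC|exact: Fo].
Qed.

Lemma bessel_eq (F : {fset H}) x : [set` F] `<=` onb ->
  nrm x ^+ 2 = nrm (x - lincomb F (dot x)) ^+ 2 + \sum_(e <- F) nrm (dot x e) ^+ 2.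
Proof.
move=> Fo; rewrite -nrm_lincomb// -pythagoras ?subrK//.
rewrite {2}/lincomb linear_sumr big_seq big1// => e eF.
rewrite linearZr_LR/= linearBl/= dot_lincomb ?eF ?subrr ?mulr0//.
exact: Fo.
Qed.

Lemma bessel (F : {fset H}) x : [set` F] `<=` onb ->
  \sum_(e <- F) nrm (dot x e) ^+ 2 <= nrm x ^+ 2.
Proof. by move=> Fo; rewrite (bessel_eq x Fo) lerDr sqr_ge0. Qed.

Lemma cauchy_schwarz x y : nrm (dot x y) <= nrm x * nrm y.
Proof.
have [y0|y0] := eqVneq (nrm y) 0.
  by rewrite y0 mulr0 (nrm_eq0 y0) linear0r nrm0.
pose z := x - (dot x y / dot y y) *: y.
have yy0 : dot y y != 0 by rewrite dot_nrm (inj_eq (@complexI _) _ 0) sqrf_eq0.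
have zy : dot z y = 0 by rewrite linearBl/= dotZl divfK// subrr.
have := @pythagoras z ((dot x y / dot y y) *: y).
rewrite dotZr zy mulr0 => /(_ erefl); rewrite subrK => xE.
have : nrm ((dot x y / dot y y) *: y) ^+ 2 <= nrm x ^+ 2 by rewrite xE lerDr sqr_ge0.
rewrite ler_sqr ?nnegrE ?nrm_ge0// nrmZ nrmM.
have -> : nrm (dot y y)^-1 = (nrm y ^+ 2)^-1.
  by rewrite dot_nrm -fmorphV nrmR ger0_norm// invr_ge0 sqr_ge0.
rewrite -mulrA expr2 invfM -mulrA mulVf// mulr1 ler_pdivrMr//.
by rewrite lt_neqAle eq_sym y0 nrm_ge0.
Qed.

(** The sets given by [exhaustion] make the finite combinations a Cauchy sequence of rate
    [2^-1 ^+ k]. Their approximation of [z] is kept in the conclusion because it yields orthonormal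
    expansions. *)
Lemma riesz_fischer (a : H -> R[i]) (B : R) :
  (forall F : {fset H}, [set` F] `<=` onb -> \sum_(e <- F) nrm (a e) ^+ 2 <= B) ->
  exists z, (forall e, onb e -> dot z e = a e) /\
    forall eps, 0 < eps -> exists2 F : {fset H}, [set` F] `<=` onb &
      nrm (z - lincomb F a) <= eps.
Proof.
move=> aB.
pose b k : R := 2^-1 ^+ k.
have bp k : 0 < b k ^+ 2 by rewrite !exprn_gt0// invr_gt0.
have n2 e : 0 <= nrm (a e) ^+ 2 by exact: sqr_ge0.
have [F [Fo Fmono far]] := exhaustion n2 bp aB.
have lincomb_diff k j : (k <= j)%N ->
    lincomb (F j) a - lincomb (F k) a = lincomb (F j `\` F k)%fset a.
  by move=> kj; rewrite /lincomb (big_fset_subD _ (Fmono _ _ kj)) addrAC subrr add0r.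
have [z zP] : exists z, forall k, nrm (z - lincomb (F k) a) <= b k.
  apply: nrm_complete => [k j kj|]; last exact: half_expr_small.
  rewrite lincomb_diff//.
  rewrite -(ler_sqr)  ?nnegrE ?nrm_ge0 ?exprn_ge0 ?invr_ge0//.
  rewrite nrm_lincomb; last by move=> e /=; rewrite inE => /andP[_ /Fo].
  apply: far; first by move=> e /=; rewrite inE => /andP[_ /Fo].
  by apply/fdisjointP => e; rewrite inE => /andP[].
exists z; split; last first.
  by move=> e /half_expr_small[k bk]; exists (F k) => //; exact: le_trans (zP k) bk.
move=> e eo; apply: subr0_eq; apply: (@nrm_le_eps _ _ _ 2) => eps /half_expr_small[k].
rewrite -/(b k) => bk.
have ne := nrm_onb eo.
have -> : dot z e - a e = dot (z - lincomb (F k) a) e +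
    (dot (lincomb (F k) a) e - a e) by rewrite linearBl addrA subrK.
rewrite (le_trans (ler_nrmD _ _))//.
have h1 : nrm (dot (z - lincomb (F k) a) e) <= b k.
  by rewrite (le_trans (cauchy_schwarz _ _))// ne mulr1.
have h2 : nrm (dot (lincomb (F k) a) e - a e) <= b k.
  rewrite dot_lincomb//; case: ifPn => ef; first by rewrite subrr nrm0 exprn_ge0// invr_ge0.
  rewrite sub0r nrmN -(ler_sqr)  ?nnegrE ?nrm_ge0 ?exprn_ge0 ?invr_ge0//.
  have := far k [fset e]%fset; rewrite big_seq_fset1; apply.
    by move=> e' /=; rewrite inE => /eqP ->.
  by rewrite fdisjoint1X.
lra.
Qed.

(** The vector rebuilt from the coefficients of [x] differs from [x] by a vector orthogonal to the
    whole basis, hence by zero. *)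
Lemma onb_expansion x eps : 0 < eps -> exists2 F : {fset H}, [set` F] `<=` onb &
  nrm (x - lincomb F (dot x)) <= eps.
Proof.
move=> e0; have [z [zP zF]] := @riesz_fischer (dot x) (nrm x ^+ 2) (fun F Fo => bessel x Fo).
have xz : x = z; last by have [F Fo h] := zF _ e0; exists F => //; rewrite {1}xz.
by apply/esym/subr0_eq/onb_max => e eo; rewrite linearBl/= zP// subrr.
Qed.

(** The coordinates of the representing vector must be the conjugates of the [f e]. They are
    square-summable because evaluating [f] on their own finite combination gives
    [s <= M * Num.sqrt s], where [s] is the sum of their squared moduli. *)
Lemma riesz (f : H -> R[i]) (M : R) : (forall a x y, f (a *: x + y) = a * f x + f y) ->
  0 <= M -> (forall x, nrm (f x) <= M * nrm x) -> exists z, forall x, f x = dot x z.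
Proof.
move=> fl M0 fM.
have f0 : f 0 = 0 by have := fl (-1) 0 0; rewrite scaler0 addr0 mulN1r addNr.
have fD x y : f (x + y) = f x + f y by have := fl 1 x y; rewrite scale1r mul1r.
have fZ a x : f (a *: x) = a * f x by have := fl a x 0; rewrite !addr0 f0 addr0.
have fN x : f (- x) = - f x by rewrite -scaleN1r fZ mulN1r.
have fL (F : {fset H}) a : f (lincomb F a) = \sum_(e <- F) a e * f e.
  by rewrite /lincomb (big_morph f fD f0); apply: eq_bigr => e _; rewrite fZ.
have [|z [zP _]] := @riesz_fischer (fun e => (f e)^*) (M ^+ 2).
  move=> F Fo; set s := \sum_(e <- F) _.
  have s0 : 0 <= s by apply: sumr_ge0 => e _; exact: sqr_ge0.
  have sE : f (lincomb F (fun e => (f e)^*)) = s%:C%C.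
    rewrite fL rmorph_sum/=; apply: eq_bigr => e _.
    by rewrite nrm_sqr conjCK.
  have := fM (lincomb F (fun e => (f e)^*)); rewrite sE nrmR ger0_norm// => sM.
  have sn := nrm_lincomb (fun e => (f e)^*) Fo; rewrite -/s in sn.
  set t := nrm _ in sM sn.
  have t0 : 0 <= t by exact: nrm_ge0.
  nra.
exists z => x; apply: subr0_eq.
apply: (@nrm_le_eps _ _ _ (M + nrm z)) => eps e0.
have [F Fo xF] := onb_expansion x e0.
have fz : f (lincomb F (dot x)) = dot (lincomb F (dot x)) z.
  rewrite fL linear_sumlz/= !big_seq; apply: eq_bigr => e eF.
  by rewrite dotZl [dot e z]dotC zP ?conjCK//; exact: Fo.
have -> : f x - dot x z = f (x - lincomb F (dot x)) - dot (x - lincomb F (dot x)) z.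
  by rewrite fD fN linearBl/= fz opprB addrA subrK.
rewrite (le_trans (ler_nrmB _ _))// mulrDl lerD//.
  by rewrite (le_trans (fM _))// ler_wpM2l.
by rewrite (le_trans (cauchy_schwarz _ _))// mulrC ler_wpM2l// nrm_ge0.
Qed.

End Dot.

(** * Bounded and Hilbert-Schmidt operators *)

Lemma esum_leP (R : realType) (T : choiceType) (I : set T) (f : T -> R) (B : R) :
  (forall i, 0 <= f i) ->
  (\esum_(i in I) (f i)%:E <= B%:E)%E <->
  forall F : {fset T}, [set` F] `<=` I -> \sum_(i <- F) f i <= B.
Proof.
move=> f0; split=> [h F FI|h].
  rewrite -lee_fin -sumEFin; apply: le_trans h; apply: esum_ge.
  by exists [set` F]; [split|rewrite fsbig_finite//= set_fsetK].
apply: ub_ereal_sup => _ [X [fX XI] <-].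
rewrite fsbig_finite//= sumEFin lee_fin; apply: h => x /=.
by rewrite in_fset_set// inE => /XI.
Qed.

Section BoundedOperators.
Variables (R : realType) (H : completeNormedModType R[i]).

(** Any upper bound, not the least one: bounds are only combined, so that no operator norm has to be
    computed. *)
Definition opb (T : H -> H) (M : R) := 0 <= M /\ forall x, nrm (T x) <= M * nrm x.

Lemma bounded_opP (T : H -> H) : bounded_operator T <-> linear T /\ exists M, opb T M.
Proof.
split=> -[lT [M TM]]; split=> //.
  exists (nrm M); split=> [|x]; first exact: nrm_ge0.
  have h : 0 <= M * `|x| by exact: le_trans (TM x).
  by have := TM x; rewrite -(ger0_norm h) normrM !nrmE -rmorphM lecR nrmR ger0_norm ?nrm_ge0.
by exists M%:C%C => x; rewrite !nrmE -rmorphM lecR; case: TM.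
Qed.

Definition bop_pred : {pred H -> H} := fun T => `[< bounded_operator T >].

Lemma bop_predP (T : H -> H) : T \in bop_pred <-> linear T /\ exists M, opb T M.
Proof. by rewrite -bounded_opP; split=> [/asboolP|/asboolP]. Qed.

Lemma bop_submod_closed : GRing.submod_closed bop_pred.
Proof.
split=> [|a S T /bop_predP[lS [M [M0 SM]]] /bop_predP[lT [N [N0 TN]]]].
  apply/bop_predP; split; first by move=> a x y /=; rewrite scaler0 addr0.
  by exists 0; split=> // x; rewrite mul0r nrm0.
apply/bop_predP; split.
  move=> b x y /=; rewrite !fctE lS lT !scalerDr !scalerA (mulrC a b).
  by rewrite -!addrA; congr (_ + _); rewrite addrCA.
exists (nrm a * M + N); split; first by rewrite addr_ge0// mulr_ge0// nrm_ge0.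
move=> x; rewrite (le_trans (ler_nrmD _ _))// mulrDl lerD//.
by rewrite nrmZ -mulrA ler_wpM2l// nrm_ge0.
Qed.

HB.instance Definition _ := GRing.isSubmodClosed.Build _ _ bop_pred bop_submod_closed.
(** Bundling bounded linear operators makes composition a ring product: for arbitrary maps [H -> H],
    composition is not additive in its right factor. *)
Record bop := Bop { bop_fun :> H -> H; _ : bop_fun \in bop_pred }.

HB.instance Definition _ := [isSub for bop_fun].
HB.instance Definition _ := [Choice of bop by <:].
HB.instance Definition _ := [SubChoice_isSubLmodule of bop by <:].

Lemma bop_ext (S T : bop) : (forall x, S x = T x) -> S = T.
Proof. by move=> ST; apply/val_inj/funext. Qed.

Lemma bopD (S T : bop) x : (S + T) x = S x + T x. Proof. by []. Qed.
Lemma bopN (S : bop) x : (- S) x = - S x. Proof. by []. Qed.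
Lemma bopB (S T : bop) x : (S - T) x = S x - T x. Proof. by []. Qed.
Lemma bopZ a (S : bop) x : (a *: S) x = a *: S x. Proof. by []. Qed.
Lemma bop0 x : (0 : bop) x = 0. Proof. by []. Qed.
Lemma bop_sum (I : Type) (r : seq I) (P : pred I) (F : I -> bop) x :
  (\sum_(i <- r | P i) F i) x = \sum_(i <- r | P i) F i x.
Proof. by elim/big_rec2: _ => // i y z _ <-. Qed.

Lemma bop_linear (T : bop) a x y : T (a *: x + y) = a *: T x + T y.
Proof. by have /bop_predP[+ _] := valP T; apply. Qed.
Lemma bop_0 (T : bop) : T 0 = 0.
Proof. by have := bop_linear T (-1) 0 0; rewrite !scaleN1r !oppr0 !addr0 => ->; rewrite addNr. Qed.
Lemma bop_D (T : bop) x y : T (x + y) = T x + T y.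
Proof. by have := bop_linear T 1 x y; rewrite !scale1r. Qed.
Lemma bop_Z (T : bop) a x : T (a *: x) = a *: T x.
Proof. by have := bop_linear T a x 0; rewrite !addr0 bop_0 addr0. Qed.
Lemma bop_opb (T : bop) : exists M, opb T M.
Proof. by have /bop_predP[] := valP T. Qed.

Lemma bounded_id : @id H \in bop_pred.
Proof.
by apply/bop_predP; split=> //; exists 1; split=> // x; rewrite mul1r.
Qed.

Lemma bounded_comp (S T : bop) : (S \o T) \in bop_pred.
Proof.
apply/bop_predP; split; first by move=> a x y /=; rewrite !bop_linear.
have [[M [M0 SM]] [N [N0 TN]]] := (bop_opb S, bop_opb T).
exists (M * N); split=> [|x /=]; first exact: mulr_ge0.
by rewrite (le_trans (SM _))// -mulrA ler_wpM2l.
Qed.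

Definition bop_one := Bop bounded_id.
Definition bop_mul (S T : bop) := Bop (bounded_comp S T).

Lemma bop_mulA : associative bop_mul.
Proof. by move=> S T U; exact: bop_ext. Qed.
Lemma bop_mul1 : left_id bop_one bop_mul.
Proof. by move=> S; exact: bop_ext. Qed.
Lemma bop_mulr1 : right_id bop_one bop_mul.
Proof. by move=> S; exact: bop_ext. Qed.
Lemma bop_mulDl : left_distributive bop_mul +%R.
Proof. by move=> S T U; exact: bop_ext. Qed.
Lemma bop_mulDr : right_distributive bop_mul +%R.
Proof. by move=> S T U; apply: bop_ext => x; exact: bop_D. Qed.

HB.instance Definition _ :=
  GRing.Zmodule_isPzRing.Build bop bop_mulA bop_mul1 bop_mulr1 bop_mulDl bop_mulDr.

Lemma bopM (S T : bop) x : (S * T) x = S (T x). Proof. by []. Qed.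
Lemma bop1 x : (1 : bop) x = x. Proof. by []. Qed.
Lemma bop_scalerAl a (S T : bop) : a *: (S * T) = (a *: S) * T.
Proof. exact: bop_ext. Qed.
Lemma bop_scalerAr a (S T : bop) : a *: (S * T) = S * (a *: T).
Proof. by apply: bop_ext => x; rewrite bopM bopZ bop_Z. Qed.

End BoundedOperators.

Arguments bop {R} H.

(** * Adjoints and the ideal of Hilbert-Schmidt operators *)

Section Adjoint.
Variables (R : realType) (H : completeNormedModType R[i]).
Variable (dot : {dot H for Num.conj}).
Hypothesis dot_norm : forall x : H, dot x x = `|x| ^+ 2.
Implicit Types S T : bop H.

Lemma adjoint_bounded (T : bop H) (T' : H -> H) M : opb T M ->
  is_adjoint dot T T' -> linear T' /\ opb T' M.
Proof.
move=> [M0 TM] TT'; split=> [a x y|].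
  by apply: (dot_extr dot_norm) => z; rewrite linearDr/= dotZr -!TT' linearDr/= dotZr.
split=> // x; have := cauchy_schwarz dot_norm (T (T' x)) x.
rewrite TT' dot_nrm// nrmR ger0_norm ?sqr_ge0// => h.
have [-> |t0] := eqVneq (nrm (T' x)) 0; first by rewrite mulr_ge0// nrm_ge0.
have tp : 0 < nrm (T' x) by rewrite lt_neqAle eq_sym t0 nrm_ge0.
rewrite -(ler_pM2l tp) -expr2 (le_trans h)// mulrA.
by rewrite ler_wpM2r ?nrm_ge0// mulrC.
Qed.

(** [adj] is a choice, meaningful once some adjoint exists; the Riesz vectors of the functionals
    [x |-> dot (T x) y], chosen for each [y], provide one. *)
Lemma adj_adjoint T : is_adjoint dot T (adj dot T).
Proof.
have [M [M0 TM]] := bop_opb T.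
have ex y : exists z, forall x, dot (T x) y = dot x z.
  apply: (riesz dot_norm (M := M * nrm y)) => [a u v||x].
  - by rewrite bop_linear linearDl/= dotZl.
  - by rewrite mulr_ge0// nrm_ge0.
  - rewrite (le_trans (cauchy_schwarz dot_norm _ _))// mulrAC.
    by rewrite ler_wpM2r// nrm_ge0.
have [T' TT'] := choice ex.
by rewrite /adj; apply: (@xgetPex _ 0 [set T' | is_adjoint dot T T']); exists T'.
Qed.

Definition star T : bop H := insubd 0 (adj dot T).

Lemma starE T : star T = adj dot T :> (H -> H).
Proof.
rewrite val_insubd ifT//; apply/bop_predP.
have [M TM] := bop_opb T.
by have [? ?] := adjoint_bounded TM (@adj_adjoint T); split=> //; exists M.
Qed.

Lemma starP T x y : dot (T x) y = dot x (star T y).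
Proof. by rewrite starE adj_adjoint. Qed.

Lemma opb_star T M : opb T M -> opb (star T) M.
Proof. by move=> TM; have [] := adjoint_bounded TM (starP T). Qed.

Lemma star_unique S T : (forall x y, dot (T x) y = dot x (S y)) -> star T = S.
Proof.
by move=> h; apply: bop_ext => y; apply: (dot_extr dot_norm) => x; rewrite -starP h.
Qed.

Lemma starPr T x y : dot x (T y) = dot (star T x) y.
Proof. by rewrite dotC starP -dotC. Qed.

Lemma starK : involutive star.
Proof. by move=> T; apply: star_unique => x y; rewrite starPr. Qed.

Lemma starM S T : star (S * T) = star T * star S.
Proof. by apply: star_unique => x y; rewrite !bopM !starP. Qed.

Lemma starD S T : star (S + T) = star S + star T.
Proof. by apply: star_unique => x y; rewrite !bopD linearDl linearDr/= !starP. Qed.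

Lemma starN T : star (- T) = - star T.
Proof. by apply: star_unique => x y; rewrite !bopN linearNl linearNr/= !starP. Qed.

Lemma star0 : star 0 = 0.
Proof. by apply: star_unique => x y; rewrite !bop0 linear0l linear0r. Qed.

Lemma starZ (a : R) T : star (a%:C%C *: T) = a%:C%C *: star T.
Proof.
apply: star_unique => x y; rewrite !bopZ dotZl dotZr starP; congr (_ * _).
exact/esym/conjc_real.
Qed.

Lemma star_sum (I : Type) (r : seq I) (P : pred I) (F : I -> bop H) :
  star (\sum_(i <- r | P i) F i) = \sum_(i <- r | P i) star (F i).
Proof. by rewrite (big_morph star starD star0). Qed.

Lemma star1 : star 1 = 1.
Proof. exact: star_unique. Qed.

Local Notation onb := (onb dot).

(** A bound by [r] on the Hilbert-Schmidt norm, phrased with finite sums of reals so that no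
    extended real enters the estimates; [hsbE] relates it to [HS] and [hs_norm]. *)
Definition hsb (T : H -> H) (r : R) := 0 <= r /\
  forall F : {fset H}, [set` F] `<=` onb -> \sum_(e <- F) nrm (T e) ^+ 2 <= r ^+ 2.

Lemma hsb_ge0 (T : H -> H) r : hsb T r -> 0 <= r. Proof. by case. Qed.

Lemma hsb_le (T : H -> H) r s : r <= s -> hsb T r -> hsb T s.
Proof.
move=> rs [r0 Tr]; split=> [|F Fo]; first exact: le_trans rs.
by rewrite (le_trans (Tr F Fo))// ler_sqr ?nnegrE// (le_trans r0).
Qed.

Lemma hsb0 r : 0 <= r -> hsb 0 r.
Proof.
move=> r0; split=> // F _; rewrite big1 ?sqr_ge0// => e _.
by rewrite nrm0 expr0n.
Qed.

Lemma hsbP T : hs_sqnorm dot T = (\esum_(e in onb) (nrm (T e) ^+ 2)%:E)%E.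
Proof.
apply: eq_esum => e _ /=; congr EFin.
by rewrite -starE -starPr dot_nrm.
Qed.

Lemma hsbE T r : hsb T r <-> [/\ 0 <= r, HS dot T & hs_norm dot T <= r].
Proof.
have f0 e : 0 <= nrm (T e) ^+ 2 by exact: sqr_ge0.
have key s : (\esum_(e in onb) (nrm (T e) ^+ 2)%:E <= s%:E)%E <->
   forall F : {fset H}, [set` F] `<=` onb -> \sum_(e <- F) nrm (T e) ^+ 2 <= s.
  exact: esum_leP.
have ge0 : (0 <= \esum_(e in onb) (nrm (T e) ^+ 2)%:E)%E.
  by apply: esum_ge0 => e _; rewrite lee_fin.
split.
  move=> [r0 /key h]; split => //.
    split; first exact/bounded_opP/bop_predP/valP.
    by rewrite hsbP (le_lt_trans h)// ltry.
  rewrite /hs_norm hsbP -(ger0_norm r0) -sqrtr_sqr ler_wsqrtr//.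
  have := le_lt_trans h (ltry _).
  by move: h ge0; case: (\esum_(_ in _) _)%E.
move=> [r0 [_]]; rewrite /hs_norm hsbP => h le; split=> //; apply/key.
move: h ge0 le {key}; case: (\esum_(_ in _) _)%E => //= s _; rewrite lee_fin => s0.
by rewrite lee_fin -{2}(sqr_sqrtr s0) ler_sqr ?nnegrE ?sqrtr_ge0.
Qed.

Lemma hsb_hs_norm T : HS dot T -> hsb T (hs_norm dot T).
Proof. by move=> hT; apply/hsbE; split=> //; exact: sqrtr_ge0. Qed.

Lemma hsb_comp S T M r : opb S M -> hsb T r -> hsb (S * T) (M * r).
Proof.
move=> [M0 SM] [r0 Tr]; split=> [|F Fo]; first exact: mulr_ge0.
rewrite exprMn; apply: (@le_trans _ _ (\sum_(e <- F) M ^+ 2 * nrm (T e) ^+ 2)).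
  apply: ler_sum => e _; rewrite -exprMn ler_sqr ?nnegrE ?mulr_ge0 ?nrm_ge0//.
  by rewrite bopM.
by rewrite -mulr_sumr ler_wpM2l ?sqr_ge0// Tr.
Qed.

(** Minkowski's inequality, by summing [(x + y) ^+ 2 <= (1 + s / r) * x ^+ 2 + (1 + r / s) * y ^+ 2]
    over [F]. A zero bound forces the corresponding operator to vanish on [F] and is treated
    apart. *)
Lemma hsbD S T r s : hsb S r -> hsb T s -> hsb (S + T) (r + s).
Proof.
move=> [r0 Sr] [s0 Ts]; split=> [|F Fo]; first exact: addr_ge0.
have {Sr Ts}[Sr Ts] := (Sr F Fo, Ts F Fo).
have vanish (U : bop H) : \sum_(e <- F) nrm (U e) ^+ 2 <= 0 ->
    forall e, e \in F -> nrm (U e) = 0.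
  move=> h e eF; apply/eqP; rewrite -sqrf_eq0 eq_le sqr_ge0 andbT (le_trans _ h)//.
  by rewrite (big_fsetD1 e)//= lerDl sumr_ge0// => ? _; exact: sqr_ge0.
have [re|rn] := eqVneq r 0.
  rewrite re add0r (le_trans _ Ts)// !big_seq ler_sum// => e eF.
  rewrite ler_sqr ?nnegrE ?nrm_ge0// bopD (le_trans (ler_nrmD _ _))//.
  by rewrite vanish ?add0r// (le_trans Sr)// re expr0n.
have [se|sn] := eqVneq s 0.
  rewrite se addr0 (le_trans _ Sr)// !big_seq ler_sum// => e eF.
  rewrite ler_sqr ?nnegrE ?nrm_ge0// bopD (le_trans (ler_nrmD _ _))//.
  by rewrite [X in _ + X]vanish ?addr0// (le_trans Ts)// se expr0n.
have rp : 0 < r by rewrite lt_neqAle eq_sym rn.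
have sp : 0 < s by rewrite lt_neqAle eq_sym sn.
apply: (@le_trans _ _ (\sum_(e <- F)
    ((1 + s / r) * nrm (S e) ^+ 2 + (1 + r / s) * nrm (T e) ^+ 2))).
  apply: ler_sum => e _; rewrite bopD.
  have := ler_nrmD (S e) (T e).
  set x := nrm (S e); set y := nrm (T e); set z := nrm (_ + _) => zxy.
  have z0 : 0 <= z by exact: nrm_ge0.
  apply: (@le_trans _ _ ((x + y) ^+ 2)); first by rewrite ler_sqr ?nnegrE// (le_trans z0).
  rewrite -subr_ge0.
  have -> : (1 + s / r) * x ^+ 2 + (1 + r / s) * y ^+ 2 - (x + y) ^+ 2
     = (s * x - r * y) ^+ 2 / (r * s) by field; rewrite rn sn.
  by rewrite divr_ge0 ?sqr_ge0// mulr_ge0.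
rewrite big_split/= -!mulr_sumr.
apply: (@le_trans _ _ ((1 + s / r) * r ^+ 2 + (1 + r / s) * s ^+ 2)).
  by apply: lerD; rewrite ler_wpM2l// addr_ge0// divr_ge0.
by rewrite le_eqVlt; apply/orP; left; apply/eqP; field; rewrite rn sn.
Qed.

Lemma hsbZ a T r : hsb T r -> hsb (a *: T) (nrm a * r).
Proof.
move=> Tr; suff : opb (a *: (1 : bop H)) (nrm a).
  by move=> /hsb_comp/(_ Tr); rewrite -bop_scalerAl mul1r.
by split=> [|x]; rewrite ?nrm_ge0// bopZ nrmZ.
Qed.

Lemma hsbN T r : hsb T r -> hsb (- T) r.
Proof.
by move=> [r0 h]; split=> // F /h; under [in X in _ -> X]eq_bigr do rewrite bopN nrmN.
Qed.

Lemma hsbB S T r s : hsb S r -> hsb T s -> hsb (S - T) (r + s).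
Proof. by move=> Sr Ts; apply: hsbD => //; exact: hsbN. Qed.

Lemma hsb_sum (I : Type) (u : seq I) (P : pred I) (F : I -> bop H) (f : I -> R) :
  (forall i, P i -> hsb (F i) (f i)) ->
  hsb (\sum_(i <- u | P i) F i) (\sum_(i <- u | P i) f i).
Proof.
move=> h; elim/big_rec2: _ => [|i x y Pi xy]; first exact: hsb0.
by apply: hsbD => //; exact: h.
Qed.

(* Parseval applied to the finitely many vectors [star T f], [f \in F]. *)
Lemma hsb_star T r : hsb T r -> hsb (star T) r.
Proof.
move=> [r0 Tr]; split=> // F Fo; apply/ler_addgt0Pr => e e0.
have fin (s : seq H) d : 0 < d -> exists2 E : {fset H}, [set` E] `<=` onb &
    forall x, x \in s -> nrm x ^+ 2 <= d + \sum_(e <- E) nrm (dot x e) ^+ 2.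
  move=> d0; elim: s => [|x s [E Eo Es]]; first by exists fset0.
  have sd0 : 0 < Num.sqrt d by rewrite sqrtr_gt0.
  have [E' E'o xE'] := onb_expansion dot_norm x sd0.
  exists (E `|` E')%fset; first by move=> y /=; rewrite inE => /orP[/Eo|/E'o].
  move=> y; rewrite inE => /predU1P[->|/Es ys].
    rewrite (bessel_eq dot_norm x E'o) lerD//.
      by rewrite -(sqr_sqrtr (ltW d0)) ler_sqr ?nnegrE ?nrm_ge0// ltW.
    by apply: ler_sum_fset; [move=> ?; exact: sqr_ge0|exact: fsubsetUr].
  rewrite (le_trans ys)// lerD2l.
  by apply: ler_sum_fset; [move=> ?; exact: sqr_ge0|exact: fsubsetUl].
pose d := e / (#|` F|%:R + 1).
have d0 : 0 < d by rewrite divr_gt0// ltr_wpDl.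
have [E Eo EF] := fin (map (star T) F) d d0.
apply: (@le_trans _ _ (\sum_(f <- F) (d + \sum_(e <- E) nrm (dot (star T f) e) ^+ 2))).
  by rewrite !big_seq ler_sum// => f fF; apply: EF; exact: map_f.
rewrite big_split/= addrC lerD//; last first.
  rewrite big_const_seq count_predT iter_addr_0 -mulr_natr /d -mulrA ger_pMr//.
  by rewrite mulrC ler_pdivrMr ?mul1r ?lerDl// ltr_wpDl.
rewrite exchange_big/=; apply: le_trans (Tr E Eo).
apply: ler_sum => x _; rewrite (le_trans _ (bessel dot_norm (T x) Fo))//.
apply: ler_sum => f _; rewrite -starPr.
by rewrite -(nrm_conj (dot (T x) f)) -dotC.
Qed.

Lemma hsb_compr S T M r : opb T M -> hsb S r -> hsb (S * T) (r * M).
Proof.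
move=> TM Sr; rewrite -(starK (S * T)) starM mulrC.
by apply/hsb_star/hsb_comp; [exact: opb_star|exact: hsb_star].
Qed.

(** Expand [T x] in the basis: its coordinates are [dot x (star T f)], to which the Cauchy-Schwarz
    inequality and the Hilbert-Schmidt bound of [star T] apply. *)
Lemma hsb_opb T r : hsb T r -> opb T r.
Proof.
move=> Tr; split=> [|x]; first exact: hsb_ge0 Tr.
have [r0 Sr] := hsb_star Tr.
rewrite -ler_sqr ?nnegrE ?nrm_ge0 ?mulr_ge0 ?nrm_ge0//.
apply/ler_addgt0Pr => e e0; have sd0 : 0 < Num.sqrt e by rewrite sqrtr_gt0.
have [E Eo xE] := onb_expansion dot_norm (T x) sd0.
rewrite (bessel_eq dot_norm (T x) Eo) addrC lerD//; last first.
  by rewrite -(sqr_sqrtr (ltW e0)) ler_sqr ?nnegrE ?nrm_ge0// ltW.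
apply: (@le_trans _ _ (\sum_(f <- E) nrm x ^+ 2 * nrm (star T f) ^+ 2)).
  apply: ler_sum => f _; rewrite -exprMn ler_sqr ?nnegrE ?mulr_ge0 ?nrm_ge0//.
  by rewrite starP cauchy_schwarz.
by rewrite -mulr_sumr mulrC exprMn ler_wpM2r ?sqr_ge0// Sr.
Qed.

Lemma hsbM S T r s : hsb S r -> hsb T s -> hsb (S * T) (r * s).
Proof. by move=> /hsb_opb; exact: hsb_comp. Qed.

(** Hilbert-Schmidt bounds dominate operator bounds, so the limit exists pointwise. Its distance to
    [T k] is then tested on a finite set [F], where the limit may be replaced by a late [T j]. *)
Lemma hsb_complete (T : nat -> bop H) (b : nat -> R) :
  (forall k j, (k <= j)%N -> hsb (T j - T k) (b k)) ->
  (forall e, 0 < e -> exists k, b k <= e) ->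
  exists L : bop H, forall k, hsb (L - T k) (b k).
Proof.
move=> Tb b0.
have ex x : exists l, forall k, nrm (l - T k x) <= b k * nrm x.
  apply: nrm_complete => [k j kj|e e0].
    by have [_] := hsb_opb (Tb _ _ kj); apply.
  have n0 : 0 < nrm x + 1 by rewrite ltr_wpDl// nrm_ge0.
  have [k bk] := b0 _ (divr_gt0 e0 n0); exists k.
  have bk0 : 0 <= b k by exact: hsb_ge0 (Tb k k (leqnn k)).
  apply: (@le_trans _ _ (b k * (nrm x + 1))); first by rewrite ler_wpM2l// lerDl.
  by rewrite -ler_pdivlMr.
have [l lT] := choice ex.
have bk0 k : 0 <= b k by exact: hsb_ge0 (Tb k k (leqnn k)).
have ll : linear l.
  move=> a x y; apply: subr0_eq.
  apply: (@nrm_le_eps _ _ _ (nrm (a *: x + y) + nrm a * nrm x + nrm y)) => e e0.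
  have [k bk] := b0 _ e0.
  have -> : l (a *: x + y) - (a *: l x + l y) = (l (a *: x + y) - T k (a *: x + y))
      - (a *: (l x - T k x) + (l y - T k y)).
    rewrite bop_linear scalerBr opprD addrA.
    rewrite [a *: l x - _ + _]addrACA -opprD (opprB (a *: l x + l y)).
    by rewrite addrA subrK opprD addrA.
  rewrite (le_trans (ler_nrmB _ _))// mulrDl mulrDl -addrA lerD//.
    by rewrite (le_trans (lT _ k))// mulrC ler_wpM2l// nrm_ge0.
  rewrite (le_trans (ler_nrmD _ _))// lerD//.
    rewrite nrmZ -mulrA ler_wpM2l ?nrm_ge0//.
    by rewrite (le_trans (lT _ k))// mulrC ler_wpM2l// nrm_ge0.
  by rewrite (le_trans (lT _ k))// mulrC ler_wpM2l// nrm_ge0.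
have lb : l \in @bop_pred R H.
  apply/bop_predP; split=> //.
  have [M [M0 TM]] := bop_opb (T 0%N); exists (b 0%N + M); split=> [|x]; first exact: addr_ge0.
  by rewrite -(subrK (T 0%N x) (l x)) (le_trans (ler_nrmD _ _))// mulrDl lerD.
exists (Bop lb) => k; split=> // F Fo; apply/ler_addgt0Pr => e e0.
(* Replacing the limit by [T j] costs at most [2 * b m * (2 * b k + 1)] for each element of [F],
   provided [2 * b m <= 1]; the condition [b m <= e / K] keeps the total below [e]. *)
pose K := #|` F|%:R * (2 * b k + 1) * 2 + 1 : R.
have K0 : 0 < K by rewrite ltr_wpDl// !mulr_ge0// addr_ge0// mulr_ge0.
have d0 : 0 < Num.min (2^-1) (e / K) by rewrite lt_min invr_gt0 ltr0n/= divr_gt0.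
have [m] := b0 _ d0; rewrite le_min => /andP[bm1 bm2].
pose j := maxn m k.
have near f : onb f -> nrm (l f - T j f) <= 2 * b m.
  move=> fo; rewrite (le_trans (ler_nrm_trans (T m f) _ _))// mulrDl mul1r.
  have nf := nrm_onb dot_norm fo.
  rewrite lerD//; first by have := lT f m; rewrite nf mulr1.
  rewrite nrmC; have [_] := hsb_opb (Tb m j (leq_maxl _ _)).
  by move=> /(_ f); rewrite nf mulr1.
have [_ /(_ F Fo) Tjk] := Tb k j (leq_maxr _ _).
apply: (@le_trans _ _ (\sum_(f <- F) (nrm ((T j - T k) f) ^+ 2
   + 2 * b m * (2 * b k + 1)))).
  rewrite !big_seq ler_sum// => f fF.
  have {}fF : onb f := Fo f fF.
  have nf := nrm_onb dot_norm fF.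
  have h1 : nrm ((Bop lb - T k) f) <= nrm (l f - T j f) + nrm ((T j - T k) f).
    exact: ler_nrm_trans.
  have h2 := near f fF.
  have h3 : nrm ((T j - T k) f) <= b k.
    by have [_ /(_ f)] := hsb_opb (Tb k j (leq_maxr _ _)); rewrite nf mulr1.
  have h4 : 0 <= nrm ((Bop lb - T k) f) by exact: nrm_ge0.
  have h5 : 0 <= nrm ((T j - T k) f) by exact: nrm_ge0.
  have h6 := bk0 m.
  move: h1 h2 h3 h4 h5 h6 bm1.
  move: (nrm ((Bop lb - T k) f)) (nrm (l f - T j f)) (nrm ((T j - T k) f)) (b m) (b k).
  move=> x y z u v h1 h2 h3 h4 h5 h6 h7.
  have h8 : x <= 2 * u + z by lra.
  apply: (@le_trans _ _ ((2 * u + z) ^+ 2)); first by rewrite ler_sqr ?nnegrE//; lra.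
  rewrite -subr_ge0 (_ : _ - _ = 2 * u * (2 * (v - z) + (1 - 2 * u))); last by ring.
  by rewrite !mulr_ge0//; lra.
rewrite big_split/= lerD// big_const_seq count_predT iter_addr_0 -[leLHS]mulr_natr.
apply: le_trans (_ : b m * K <= _); last by rewrite -ler_pdivlMr.
have -> : b m * K = 2 * b m * (2 * b k + 1) * #|` F|%:R + b m by rewrite /K; ring.
by rewrite lerDl.
Qed.

Lemma bop_sep (T U : bop H) : (forall x y, dot (T x) y = dot (U x) y) -> T = U.
Proof. by move=> h; apply: bop_ext => x; exact: dot_ext. Qed.

Lemma dot_bopD (T U : bop H) x y : dot ((T + U) x) y = dot (T x) y + dot (U x) y.
Proof. by rewrite bopD linearDl. Qed.

Lemma dot_bopN (T : bop H) x y : dot ((- T) x) y = - dot (T x) y.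
Proof. by rewrite bopN linearNl. Qed.

Lemma dot_bopZ a (T : bop H) x y : dot ((a *: T) x) y = a * dot (T x) y.
Proof. by rewrite bopZ dotZl. Qed.

End Adjoint.

(* Reduces an identity in the additive group of operators to one between scalars. *)
Ltac bop_abel dot_norm :=
  apply: (bop_sep dot_norm) => ? ?; rewrite ?(dot_bopD, dot_bopN, dot_bopZ); ring.

(** * Convolution of series *)

Section MultiIndex.
Variable n : nat.
Implicit Types (al be ga : mindex n).

Lemma mdegD al be : mdeg (al + be) = (mdeg al + mdeg be)%N.
Proof. by rewrite /mdeg -big_split/=; apply: eq_bigr => i _; rewrite ffunE. Qed.

Lemma mdeg0 : mdeg (0 : mindex n) = 0%N.
Proof. by rewrite /mdeg big1// => i _; rewrite ffunE. Qed.

Lemma mdeg_eq0 al : (mdeg al == 0%N) = (al == 0).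
Proof.
apply/idP/eqP => [|->]; last by rewrite mdeg0.
rewrite /mdeg sum_nat_eq0 => /forallP h.
by apply/ffunP => i; rewrite ffunE; apply/eqP/h.
Qed.

Lemma leq_mdeg al i : (al i <= mdeg al)%N.
Proof. by rewrite /mdeg (bigD1 i)//= leq_addr. Qed.

Lemma mdeg_delta (i : 'I_n) : mdeg (mdelta i) = 1%N.
Proof.
rewrite /mdeg (bigD1 i)//= big1 => [|j ji]; first by rewrite ffunE eqxx.
by rewrite ffunE (negbTE ji).
Qed.

Lemma mdeg_eq1 al : mdeg al = 1%N -> exists i, al = mdelta i.
Proof.
move=> al1; have : al != 0 by rewrite -mdeg_eq0 al1.
move=> /eqP al0; have [i ali] : exists i, al i != 0%N.
  apply/existsP; rewrite -negb_forall; apply/negP => /forallP h; apply: al0.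
  by apply/ffunP => i; rewrite ffunE; apply/eqP/h.
exists i; move: al1; rewrite /mdeg (bigD1 i)//=.
case E : (al i) ali => [//|k] _; rewrite addSn => -[] /eqP.
rewrite addn_eq0 => /andP[/eqP k0]; rewrite sum_nat_eq0 => /forallP h.
apply/ffunP => j; rewrite ffunE; have [->|ji] := eqVneq j i; first by rewrite E k0.
by have := h j; rewrite ji => /eqP.
Qed.

(* A finite window over which sums of multi-indices are taken; they do not depend on [N]. *)
Definition box N := {ffun 'I_n -> 'I_N.+1}.

Definition mval N (b : box N) : mindex n := [ffun i => val (b i)].

Lemma mval_inj N : injective (@mval N).
Proof.
move=> b c /ffunP bc; apply/ffunP => i; apply: val_inj.
by have := bc i; rewrite !ffunE.
Qed.

Lemma mvalP N al : (forall i, al i <= N)%N -> exists b : box N, mval b = al.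
Proof.
move=> h; exists [ffun i => inord (al i)]; apply/ffunP => i.
by rewrite !ffunE /= inordK// ltnS h.
Qed.

Lemma mval_deg N al : (mdeg al <= N)%N -> exists b : box N, mval b = al.
Proof. by move=> h; apply: mvalP => i; rewrite (leq_trans (leq_mdeg _ _)). Qed.

Section Sums.
Variable V : nmodType.

(** The pairs with sum [al] form a finite subset of an infinite type; a window of size
    [N >= mdeg al] contains them and turns the sum into an ordinary iterated one. *)
Lemma fsum_mindex N (F : mindex n * mindex n -> V) al : (mdeg al <= N)%N ->
  \sum_(p \in [set p : mindex n * mindex n | p.1 + p.2 = al]) F p =
  \sum_(b : box N) \sum_(g : box N | mval b + mval g == al) F (mval b, mval g).
Proof.
move=> alN; pose P (p : mindex n * mindex n) := p.1 + p.2 == al.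
rewrite (_ : [set p | _] = [set` P]); last first.
  by apply/seteqP; split=> p /eqP.
pose h (q : box N * box N) := (mval q.1, mval q.2).
have hI : injective h by move=> [b c] [b' c'] [/mval_inj-> /mval_inj->].
rewrite -(@bigfs _ _ _ _ (map h (enum {: box N * box N}))).
- by rewrite big_map big_enum_cond/= pair_big_dep/=.
- by rewrite map_inj_uniq// enum_uniq.
- move=> [b g] /eqP/= bg /negP[]; move: alN; rewrite -bg mdegD => bgN.
  have [b' bE] := mval_deg (leq_trans (leq_addr _ _) bgN).
  have [g' gE] := mval_deg (leq_trans (leq_addl _ _) bgN).
  by apply/mapP; exists (b', g'); rewrite ?mem_enum// /h bE gE.
Qed.

Lemma sum_mval1 N (x : mindex n) (F : mindex n -> V) : (forall i, x i <= N)%N ->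
  \sum_(b : box N | mval b == x) F (mval b) = F x.
Proof.
move=> /mvalP[b bx]; rewrite (big_pred1 b) ?bx// => c /=.
by rewrite -bx (inj_eq (@mval_inj N)).
Qed.

End Sums.

Section Convolution.
Variable V : pzRingType.
Implicit Types (A B C : mindex n -> V).

(** Defined over an arbitrary ring because operator series and their real majorants are convolved
    alike. *)
Definition conv A B al : V :=
  \sum_(p \in [set p : mindex n * mindex n | p.1 + p.2 = al]) A p.1 * B p.2.

Definition mono (a : V) : mindex n -> V := fun al => if al == 0 then a else 0.

Definition low A : mindex n -> V := fun al => if al == 0 then 0 else A al.

Lemma convE N A B al : (mdeg al <= N)%N ->
  conv A B al = \sum_(b : box N) \sum_(g : box N | mval b + mval g == al)
    A (mval b) * B (mval g).
Proof. exact: fsum_mindex. Qed.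

Lemma convDl A B C al : conv (fun x => A x + B x) C al = conv A C al + conv B C al.
Proof.
rewrite !(convE _ _ (leqnn _)) -big_split; apply: eq_bigr => b _ /=.
by rewrite -big_split; apply: eq_bigr => g _ /=; rewrite mulrDl.
Qed.

Lemma convDr A B C al : conv C (fun x => A x + B x) al = conv C A al + conv C B al.
Proof.
rewrite !(convE _ _ (leqnn _)) -big_split; apply: eq_bigr => b _ /=.
by rewrite -big_split; apply: eq_bigr => g _ /=; rewrite mulrDr.
Qed.

Lemma eq_conv A B A' B' al :
  (forall be ga, be + ga = al -> A be * B ga = A' be * B' ga) ->
  conv A B al = conv A' B' al.
Proof.
move=> h; rewrite !(convE _ _ (leqnn _)); apply: eq_bigr => b _.
by apply: eq_bigr => g /eqP; exact: h.
Qed.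

Lemma eq_conv_deg A B A' B' al :
  (forall be, (mdeg be <= mdeg al)%N -> A be = A' be) ->
  (forall be, (mdeg be <= mdeg al)%N -> B be = B' be) ->
  conv A B al = conv A' B' al.
Proof.
move=> AA BB; apply: eq_conv => be ga bg; rewrite AA ?BB// -bg mdegD.
  exact: leq_addl.
exact: leq_addr.
Qed.

Lemma conv_monol a B al : conv (mono a) B al = a * B al.
Proof.
have d0 : (mdeg (0%R : mindex n) <= mdeg al)%N by rewrite mdeg0.
have [b0 b0E] := mval_deg d0.
have mono0 (g : box (mdeg al)) : g != b0 -> mono a (mval g) = 0.
  by rewrite /mono -b0E (inj_eq (@mval_inj _)) => /negbTE ->.
rewrite (convE _ _ (leqnn _)) (bigD1 b0)//= [X in _ + X]big1 ?addr0 => [|b bb0].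
  under eq_bigl do rewrite b0E add0r.
  by rewrite b0E /mono eqxx -big_distrr/= sum_mval1// => i; exact: leq_mdeg.
by rewrite big1// => g _; rewrite mono0// mul0r.
Qed.

Lemma conv_monor a B al : conv B (mono a) al = B al * a.
Proof.
rewrite (convE _ _ (leqnn _)).
transitivity (\sum_(b : box (mdeg al) | mval b == al) B (mval b) * a); last first.
  by rewrite -big_distrl/= sum_mval1// => i; exact: leq_mdeg.
rewrite [RHS]big_mkcond/=; apply: eq_bigr => b _.
have d0 : (mdeg (0%R : mindex n) <= mdeg al)%N by rewrite mdeg0.
have [b0 b0E] := mval_deg d0.
rewrite big_mkcond/= (bigD1 b0)//= big1 ?addr0 => [|g gb0].
  by rewrite b0E addr0 /mono eqxx.
have -> : mono a (mval g) = 0 by rewrite /mono -b0E (inj_eq (@mval_inj _)) (negbTE gb0).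
by rewrite mulr0 if_same.
Qed.

Lemma mono_low A al : A al = mono (A 0) al + low A al.
Proof. by rewrite /mono /low; case: eqP => [->|_]; rewrite ?addr0 ?add0r. Qed.

(** Isolates the terms with a top coefficient. The remainder involves only degrees strictly between
    [0] and [mdeg al], which permits induction on the degree; [al != 0] avoids counting [A 0 * B 0]
    twice. *)
Lemma conv_split A B al : al != 0 ->
  conv A B al = A 0 * B al + A al * B 0 + conv (low A) (low B) al.
Proof.
move=> al0.
have -> : conv A B al = conv (fun x => mono (A 0) x + low A x) B al.
  by apply: eq_conv => be ga _; rewrite -mono_low.
rewrite convDl conv_monol -addrA; congr (_ + _).
have -> : conv (low A) B al = conv (low A) (fun x => mono (B 0) x + low B x) al.
  by apply: eq_conv => be ga _; rewrite -mono_low.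
by rewrite convDr conv_monor {1}/low (negbTE al0).
Qed.

Lemma conv0 A B : conv A B 0 = A 0 * B 0.
Proof.
have -> : conv A B 0 = conv (mono (A 0)) B 0; last by rewrite conv_monol.
apply: eq_conv => be ga bg; have := mdegD be ga; rewrite bg mdeg0 => /esym/eqP.
rewrite addn_eq0 => /andP[]; rewrite !mdeg_eq0 => /eqP -> /eqP ->.
by rewrite /mono eqxx.
Qed.

Lemma eq_conv_low A B A' B' al :
  (forall be, be != 0 -> (mdeg be < mdeg al)%N -> A be = A' be) ->
  (forall be, be != 0 -> (mdeg be < mdeg al)%N -> B be = B' be) ->
  conv (low A) (low B) al = conv (low A') (low B') al.
Proof.
move=> AA BB; apply: eq_conv => be ga bg; rewrite /low.
case: eqP => [_|/eqP be0]; first by rewrite !mul0r.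
case: eqP => [_|/eqP ga0]; first by rewrite !mulr0.
rewrite AA// ?BB// -bg mdegD.
  by rewrite -{1}(add0n (mdeg ga)) ltn_add2r lt0n mdeg_eq0.
by rewrite -{1}(addn0 (mdeg be)) ltn_add2l lt0n mdeg_eq0.
Qed.

(** As [A] vanishes below the degree of [al], the only surviving pair of indices is [(al, 0)]. *)
Lemma conv_leadl A B al : (forall be, (mdeg be < mdeg al)%N -> A be = 0) ->
  conv A B al = A al * B 0.
Proof.
move=> A0; rewrite -conv_monor; apply: eq_conv => be ga bg; rewrite /mono.
case: eqP => [->//|/eqP ga0]; rewrite A0 ?mul0r// -bg mdegD.
by rewrite -{1}(addn0 (mdeg be)) ltn_add2l lt0n mdeg_eq0.
Qed.

Lemma conv_leadr A B al : (forall be, (mdeg be < mdeg al)%N -> B be = 0) ->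
  conv A B al = A 0 * B al.
Proof.
move=> B0; rewrite -conv_monol; apply: eq_conv => be ga bg; rewrite /mono.
case: eqP => [->//|/eqP be0]; rewrite B0 ?mulr0// -bg mdegD.
by rewrite -{1}(add0n (mdeg ga)) ltn_add2r lt0n mdeg_eq0.
Qed.

(** Both sides are brought to the sum of [T b g d] over the triples of one window whose indices add
    up to [al]; the intermediate index [x] is determined by two of them and summed out. *)
Lemma convA A B C al : conv (conv A B) C al = conv A (conv B C) al.
Proof.
pose N := mdeg al; pose m := @mval N.
have le_box x y : x + y = al -> (mdeg x <= N)%N /\ (mdeg y <= N)%N.
  by rewrite /N => <-; rewrite mdegD leq_addr leq_addl.
have deg_le (x : mindex n) i : (mdeg x <= N)%N -> (x i <= N)%N.
  exact/leq_trans/leq_mdeg.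
pose T (b g d : box N) := A (m b) * B (m g) * C (m d).
transitivity (\sum_(d : box N) \sum_(b : box N) \sum_(g : box N)
   if m b + m g + m d == al then T b g d else 0).
  rewrite (convE _ _ (leqnn _)) -/N.
  transitivity (\sum_(x : box N) \sum_(d : box N) \sum_(b : box N) \sum_(g : box N)
    if (m x == m b + m g) && (m x + m d == al) then T b g d else 0).
    apply: eq_bigr => x _; rewrite big_mkcond; apply: eq_bigr => d _.
    case: eqP => [xd|_]; last first.
      by rewrite big1// => b _; rewrite big1// => g _; rewrite andbF.
    rewrite (@convE N)//; last by have [] := le_box _ _ xd.
    rewrite big_distrl; apply: eq_bigr => b _; rewrite big_distrl big_mkcond/=.
    by apply: eq_bigr => g _; rewrite andbT eq_sym.
  rewrite exchange_big/=; apply: eq_bigr => d _.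
  rewrite exchange_big/=; apply: eq_bigr => b _.
  rewrite exchange_big/=; apply: eq_bigr => g _.
  rewrite -big_mkcond/= big_mkcondr/=.
  under eq_bigr => x /eqP -> do [].
  case: eqP => [bgd|_]; last by rewrite big1.
  by rewrite (sum_mval1 (fun=> T b g d))// => i; apply: deg_le; have [] := le_box _ _ bgd.
rewrite [RHS](convE _ _ (leqnn _)) -/N exchange_big/=; apply: eq_bigr => b _.
transitivity (\sum_(x : box N) \sum_(g : box N) \sum_(d : box N)
    if (m x == m g + m d) && (m b + m x == al) then T b g d else 0); last first.
  rewrite [RHS]big_mkcond; apply: eq_bigr => x _.
  case: eqP => [bx|_]; last first.
    by rewrite big1// => g _; rewrite big1// => d _; rewrite andbF.
  rewrite (@convE N)//; last by have [] := le_box _ _ bx.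
  rewrite big_distrr; apply: eq_bigr => g _; rewrite big_distrr/= [RHS]big_mkcond/=.
  by apply: eq_bigr => d _; rewrite andbT eq_sym /T mulrA.
rewrite exchange_big/= [RHS]exchange_big/=; apply: eq_bigr => g _.
rewrite [RHS]exchange_big/=; apply: eq_bigr => d _.
rewrite -[RHS]big_mkcond/= [RHS]big_mkcondr/=.
under [RHS]eq_bigr => x /eqP -> do [].
rewrite addrA; case: eqP => [bgd|_]; last by rewrite big1.
rewrite (sum_mval1 (fun=> T b g d))// => i; apply: deg_le.
by rewrite -addrA in bgd; have [] := le_box _ _ bgd.
Qed.

End Convolution.
End MultiIndex.

(** * The Catalan majorant *)

Section Catalan.
Variable R : realType.
Local Notation cat := (catalan R).

Lemma catalan_ge0 m : 0 <= cat m.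
Proof. by rewrite /catalan divr_ge0. Qed.

(** The ratio of consecutive Catalan numbers is rational in [m]. This recurrence yields both the
    growth bound and the convolution identity. *)
Lemma catalanS m : (m.+2)%:R * cat m.+1 = (4 * m%:R + 2) * cat m.
Proof.
have h1 : (m.+1 * 'C(2 * m.+1, m.+1) = 2 * (2 * m).+1 * 'C(2 * m, m))%N.
  have -> : (2 * m.+1 = (2 * m).+2)%N by rewrite mulnS.
  have e1 := mul_bin_diag (2 * m).+1 m.
  have e2 := mul_bin_diag (2 * m).+2 m.
  have e3 : 'C((2 * m).+1, m.+1) = 'C((2 * m).+1, m).
    rewrite -[RHS]bin_sub; last by lia.
    by congr 'C(_, _); lia.
  rewrite /= -e3 in e1 e2; rewrite -e2 -mulnA e1; lia.
have h2 : m.+1%:R * 'C(2 * m.+1, m.+1)%:R = (4 * m%:R + 2) * 'C(2 * m, m)%:R :> R.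
  rewrite -natrM h1 !natrM -(natr1 (2 * m)) natrM; ring.
rewrite /catalan mulrCA divff ?mulr1 ?pnatr_eq0//.
apply: (@mulfI _ m.+1%:R); first by rewrite pnatr_eq0.
rewrite h2 mulrCA; congr (_ * _).
by rewrite mulrCA divff ?mulr1// pnatr_eq0.
Qed.

Lemma catalan0 : cat 0 = 1.
Proof. by rewrite /catalan bin0 divr1. Qed.

Lemma catalan_le m : cat m <= 4 ^+ m.
Proof.
elim: m => [|m IH]; first by rewrite catalan0.
have h : 0 < m.+2%:R :> R by rewrite ltr0n.
rewrite -(ler_pM2l h) catalanS exprS.
have := catalan_ge0 m; have m0 : 0 <= m%:R :> R by [].
move: (cat m) (4 ^+ m) IH => x y xy x0.
rewrite -(natr1 m.+1) -(natr1 m).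
apply: (@le_trans _ _ ((4 * m%:R + 2) * y)); first by rewrite ler_wpM2l//; lra.
nra.
Qed.

(** Evaluate the sum of the [k.+1%:R * (cat k * cat (m.+1 - k))] twice: by the symmetry exchanging
    [k] and [m.+1 - k], and by [catalanS], which lowers the index so that the induction hypothesis
    applies. *)
Lemma catalan_conv m : \sum_(k < m.+1) cat k * cat (m - k) = cat m.+1.
Proof.
have sym n : 2 * (\sum_(k < n.+1) k%:R * (cat k * cat (n - k))) =
    n%:R * \sum_(k < n.+1) cat k * cat (n - k).
  rewrite mulr_natl mulr2n {2}(reindex_inj rev_ord_inj)/= -big_split mulr_sumr.
  apply: eq_bigr => k _; rewrite /= subSS.
  have kn : (k <= n)%N by rewrite -ltnS.
  by rewrite subKn// natrB//; ring.
elim: m => [|m IH].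
  by have := catalanS 0; rewrite big_ord1 subn0 !catalan0; lra.
pose S := \sum_(k < m.+2) cat k * cat (m.+1 - k).
have e1 : \sum_(k < m.+2) (k.+1)%:R * (cat k * cat (m.+1 - k)) =
    cat m.+1 + \sum_(k < m.+1) (4 * k%:R + 2) * (cat k * cat (m - k)).
  rewrite big_ord_recl/= subn0 catalan0 !mul1r; congr (_ + _).
  by apply: eq_bigr => k _; rewrite /bump /= add1n subSS mulrA catalanS mulrA.
have e2 : \sum_(k < m.+2) (k.+1)%:R * (cat k * cat (m.+1 - k)) =
    \sum_(k < m.+2) k%:R * (cat k * cat (m.+1 - k)) + S.
  by rewrite -big_split; apply: eq_bigr => k _; rewrite -natr1 /=; ring.
have e3 : \sum_(k < m.+1) (4 * k%:R + 2) * (cat k * cat (m - k)) =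
    4 * (\sum_(k < m.+1) k%:R * (cat k * cat (m - k))) + 2 * cat m.+1.
  rewrite -IH !mulr_sumr -big_split; apply: eq_bigr => k _ /=; ring.
have s1 := sym m.+1; have s2 := sym m; rewrite IH in s2; rewrite -/S in s1.
have h : 0 < m.+3%:R :> R by rewrite ltr0n.
apply: (mulfI (lt0r_neq0 h)); rewrite catalanS -/S.
move: e1; rewrite e2 e3 -(natr1 m.+2) -(natr1 m.+1) -(natr1 m).
rewrite -(natr1 m) in s1.
move: (\sum_(k < m.+2) _) (\sum_(k < m.+1) _) s1 s2 => t u s1 s2 e1.
lra.
Qed.

End Catalan.

(** * Multinomial identities and the majorant *)

Section Multinomial.
Variables (R : realType) (n : nat).
Implicit Types (al be ga : mindex n) (x : 'I_n -> R).
Local Notation mul := (multinomial R).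

Lemma multinomial_ge0 al : 0 <= mul al.
Proof. by rewrite divr_ge0// prodr_ge0. Qed.

Lemma mpowD x al be : mpow x (al + be) = mpow x al * mpow x be.
Proof. by rewrite /mpow -big_split; apply: eq_bigr => i _; rewrite ffunE exprD. Qed.

Lemma mpow_ge0 x al : (forall i, 0 <= x i) -> 0 <= mpow x al.
Proof. by move=> x0; apply: prodr_ge0 => i _; exact: exprn_ge0. Qed.

Lemma mpow_delta x (i : 'I_n) : mpow x (mdelta i) = x i.
Proof.
rewrite /mpow (bigD1 i)//= big1 => [|j ji]; first by rewrite ffunE eqxx expr1 mulr1.
by rewrite ffunE (negbTE ji).
Qed.

Lemma multinomial_delta (i : 'I_n) : mul (mdelta i) = 1.
Proof.
rewrite /multinomial mdeg_delta big1 ?divr1// => j _; rewrite ffunE.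
by case: eqP.
Qed.

Lemma multinomial0 : mul (0 : mindex n) = 1.
Proof. by rewrite /multinomial mdeg0 big1 ?divr1// => j _; rewrite ffunE. Qed.

Lemma mpow0 x : mpow x (0 : mindex n) = 1.
Proof. by rewrite /mpow big1// => j _; rewrite ffunE. Qed.

(** Compare the coefficients of ['X^k] in the product of the [('X + 1) ^+ al i], which equals
    [('X + 1) ^+ mdeg al]. *)
Lemma sum_prod_bin N al k : (forall i, al i <= N)%N ->
  (\sum_(b : box n N | mdeg (mval b) == k) \prod_i 'C(al i, b i))%N = 'C(mdeg al, k).
Proof.
move=> alN.
have expand (a M : nat) : (a <= M)%N ->
    ('X + 1) ^+ a = \sum_(j < M.+1) 'X^j *+ 'C(a, j) :> {poly int}.
  move=> aM; rewrite exprD1n (big_ord_widen M.+1 (fun j => 'X^j *+ 'C(a, j))) ?ltnS//.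
  rewrite big_mkcond; apply: eq_bigr => j _; case: ifPn => //.
  by rewrite -leqNgt => aj; rewrite bin_small ?mulr0n.
have e : \prod_i (('X + 1) ^+ al i) = ('X + 1) ^+ mdeg al :> {poly int}.
  exact: prodrXr.
have c (m : nat) : ((('X + 1) ^+ m : {poly int})`_k) = 'C(m, k)%:Z.
  rewrite (expand m (maxn m k)) ?leq_maxl// coef_sum.
  have km : (k < (maxn m k).+1)%N by rewrite ltnS leq_maxr.
  rewrite (bigD1 (Ordinal km))//= big1 ?addr0 => [|j jk].
    by rewrite coefMn coefXn eqxx natz.
  by rewrite coefMn coefXn -(inj_eq val_inj) eq_sym/= in jk *; rewrite (negbTE jk) mul0rn.
apply/eqP; rewrite -eqz_nat -c -e.
under eq_bigr => i _ do rewrite (expand _ _ (alN i)).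
rewrite bigA_distr_bigA/= coef_sum (big_morph _ PoszD (erefl 0%Z)) big_mkcond/=.
apply/eqP/eq_bigr => b _; rewrite prodrMn prodrXr coefMn coefXn eq_sym.
have -> : (\sum_i b i)%N = mdeg (mval b).
  by apply: eq_bigr => i _; rewrite ffunE.
by case: eqP => _; rewrite ?mul0rn// natz.
Qed.

Lemma sum_mindex_le (V : numDomainType) N (F : mindex n -> V) (x : mindex n) :
  (forall y, 0 <= F y) -> \sum_(b : box n N | mval b == x) F (mval b) <= F x.
Proof.
move=> F0; have [/existsP[b /eqP bx]|/existsPn h] := boolP [exists b : box n N, mval b == x].
  rewrite (big_pred1 b) ?bx// => c /=.
  by rewrite -bx (inj_eq (@mval_inj _ N)).
by rewrite big1 => // b bx; have := h b; rewrite bx.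
Qed.

(** Up to the factor [K], the product of the two multinomial coefficients is the product of the
    binomial coefficients of [al i] over [b i], so [sum_prod_bin] applies. That the value does not
    depend on [k] allows factoring it out of sums over degrees. *)
Lemma vandermonde N al k : (mdeg al <= N)%N -> (k <= mdeg al)%N ->
  \sum_(b : box n N) \sum_(g : box n N | mval b + mval g == al)
    (if mdeg (mval b) == k then mul (mval b) * mul (mval g) else 0) = mul al.
Proof.
move=> alN kal; pose m := mdeg al.
have fact_neq0 (j : nat) : j`!%:R != 0 :> R by rewrite pnatr_eq0 -lt0n fact_gt0.
have pfact_neq0 (be : mindex n) : \prod_i (be i)`!%:R != 0 :> R.
  by apply/prodf_neq0 => i _.
pose K : R := k`!%:R * (m - k)`!%:R / \prod_i (al i)`!%:R.
have alN' i : (al i <= N)%N by exact: leq_trans (leq_mdeg _ _) alN.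
transitivity (K * (\sum_(b : box n N | mdeg (mval b) == k) \prod_i 'C(al i, b i))%:R); last first.
  rewrite sum_prod_bin// /K /multinomial -(bin_fact kal) !natrM -/m.
  by field.
rewrite natr_sum mulr_sumr [RHS]big_mkcond/=; apply: eq_bigr => b _.
case: eqP => bk; last by rewrite big1.
(* If [b] is not below [al], no [g] completes it and some binomial coefficient is zero. *)
have [h|/forallPn[j]] := boolP [forall i, b i <= al i]%N; last first.
  rewrite -ltnNge => lt; rewrite (bigD1 j)//= bin_small// mul0n mulr0.
  rewrite big1// => g /eqP/ffunP/(_ j); rewrite !ffunE => e.
  by move: lt; rewrite -e ltnNge leq_addr.
have [g gE] : exists g : box n N, mval g = [ffun i => al i - b i]%N.
  by apply: mvalP => i; rewrite ffunE (leq_trans (leq_subr _ _)).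
have bg : mval b + mval g = al.
  by apply/ffunP => i; rewrite ffunE gE !ffunE; exact/subnKC/(forallP h).
rewrite (big_pred1 g) => [|g' /=]; last first.
  apply/eqP/eqP => [e|->//]; apply/mval_inj/ffunP => i; apply: (@addnI (mval b i)).
  by have := congr1 (fun f : mindex n => f i) (etrans e (esym bg)); rewrite !ffunE.
rewrite natr_prod /multinomial /K.
have mg : mdeg (mval g) = (m - k)%N by rewrite /m -bg mdegD bk addKn.
rewrite bk mg.
have -> : \prod_i (al i)`!%:R = (\prod_i 'C(al i, b i)%:R) *
    ((\prod_i (mval b i)`!%:R) * \prod_i (mval g i)`!%:R) :> R.
  rewrite -!big_split; apply: eq_bigr => i _ /=.
  by rewrite gE !ffunE -!natrM bin_fact//; exact: (forallP h).
have C0 : \prod_i 'C(al i, b i)%:R != 0 :> R.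
  by apply/prodf_neq0 => i _; rewrite pnatr_eq0 -lt0n bin_gt0; exact: (forallP h).
by field; rewrite C0 !pfact_neq0.
Qed.

(** One half of the multinomial theorem, by peeling off one degree with [vandermonde] at [k = 1].
    Enlarging the sum to all pairs in the window is harmless since the terms are nonnegative. *)
Lemma sum_multinomial_le N m x : (forall i, 0 <= x i) -> (m <= N)%N ->
  \sum_(b : box n N | mdeg (mval b) == m) mul (mval b) * mpow x (mval b)
    <= (\sum_i x i) ^+ m.
Proof.
move=> x0; have t0 be : 0 <= mul be * mpow x be.
  by rewrite mulr_ge0 ?multinomial_ge0 ?mpow_ge0.
elim: m => [|m IH] mN.
  under eq_bigl do rewrite mdeg_eq0.
  apply: le_trans (sum_mindex_le _ (F := fun be => mul be * mpow x be) 0 t0) _.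
  by rewrite multinomial0 mpow0 mulr1 expr0.
apply: (@le_trans _ _ (\sum_(al : box n N | mdeg (mval al) == m.+1)
  \sum_(b : box n N | mdeg (mval b) == 1%N) \sum_(g : box n N | mdeg (mval g) == m)
   if mval al == mval b + mval g then
     (mul (mval b) * mpow x (mval b)) * (mul (mval g) * mpow x (mval g)) else 0)).
  apply: ler_sum => al /eqP alm.
  have alN : (mdeg (mval al) <= N)%N by rewrite alm.
  have al1 : (1 <= mdeg (mval al))%N by rewrite alm.
  rewrite -(vandermonde alN al1) mulr_suml [leRHS]big_mkcond/=.
  apply: ler_sum => b _; rewrite mulr_suml.
  case: eqP => b1; last by rewrite big1// => g _; rewrite mul0r.
  rewrite -big_mkcondr/= big_mkcond [leRHS]big_mkcond/=; apply: ler_sum => g _.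
  rewrite [mval al == _]eq_sym andbC; case: eqP => [bg|//] /=.
  have -> : mdeg (mval g) == m.
    by rewrite -eqSS -alm -bg mdegD b1.
  by rewrite -bg mpowD mulrACA.
rewrite exchange_big/= exprS.
apply: (@le_trans _ _ (\sum_(b : box n N | mdeg (mval b) == 1%N)
   (mul (mval b) * mpow x (mval b)) * (\sum_i x i) ^+ m)).
  apply: ler_sum => b _; rewrite exchange_big/=.
  apply: le_trans (ler_wpM2l (t0 _) (IH (ltnW mN))).
  rewrite mulr_sumr; apply: ler_sum => g _.
  set T := _ * (mul _ * _); rewrite -big_mkcondr/= big_mkcondl/=.
  have T0 : 0 <= T by exact: mulr_ge0.
  apply: le_trans (sum_mindex_le _ (F := fun y => if mdeg y == m.+1 then T else 0) _ _) _.
    by move=> y; case: ifP.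
  by case: ifP.
rewrite -mulr_suml ler_wpM2r ?exprn_ge0 ?sumr_ge0//.
apply: (@le_trans _ _ (\sum_(b : box n N) \sum_(i < n) if mval b == mdelta i then x i else 0)).
  rewrite [leLHS]big_mkcond; apply: ler_sum => b _.
  have ge0 i : 0 <= (if mval b == mdelta i then x i else 0) by case: ifP.
  case: eqP => [/mdeg_eq1[k bk]|_]; last exact: sumr_ge0.
  rewrite (bigD1 k)//= {1 2 3}bk eqxx multinomial_delta mpow_delta mul1r lerDl.
  by apply: sumr_ge0.
rewrite exchange_big/=; apply: ler_sum => i _; rewrite -big_mkcond/=.
exact: (sum_mindex_le _ (F := fun=> x i)).
Qed.

Section Majorant.
Variables (eta : R) (a : 'I_n -> R).
Hypotheses (eta_ge0 : 0 <= eta) (a_ge0 : forall i, 0 <= a i).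

Definition radial (m : nat) : R := eta ^+ m.-1 * m%:R^-1 * catalan R m.-1.

(* Vanishes at [0], since [0^-1 = 0]. *)
Definition majorant al : R :=
  eta ^+ (mdeg al).-1 * (mdeg al)%:R^-1 * mul al * catalan R (mdeg al).-1 * mpow a al.

Lemma majorantE al : majorant al = radial (mdeg al) * (mul al * mpow a al).
Proof. by rewrite /majorant /radial; ring. Qed.

Lemma radial_ge0 m : 0 <= radial m.
Proof. by rewrite /radial !mulr_ge0 ?exprn_ge0 ?catalan_ge0 ?invr_ge0. Qed.

Lemma majorant_ge0 al : 0 <= majorant al.
Proof.
by rewrite majorantE mulr_ge0 ?radial_ge0// mulr_ge0 ?multinomial_ge0 ?mpow_ge0.
Qed.

Lemma majorant0 : majorant (0 : mindex n) = 0.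
Proof. by rewrite /majorant mdeg0 invr0 mulr0 !mul0r. Qed.

Lemma majorant_delta (i : 'I_n) : majorant (mdelta i) = a i.
Proof.
by rewrite /majorant mdeg_delta expr0 invr1 multinomial_delta catalan0 mpow_delta !mul1r.
Qed.

(* 1 / (k l) <= 2 / m when k + l = m and k, l >= 1 *)
Lemma radial_conv m : eta * \sum_(k < m.+1) radial k * radial (m - k) <= 2 * radial m.
Proof.
have r0 : radial 0 = 0 by rewrite /radial invr0 mulr0 mul0r.
case: m => [|[|m]].
- by rewrite big_ord1 subn0 r0 !mulr0.
- by rewrite !big_ord_recl big_ord0/= r0 mul0r add0r mulr0 addr0 mulr0 mulr_ge0// radial_ge0.
(* The extreme terms vanish since [radial 0 = 0]; the others are compared one by one with the terms
   of the Catalan sum for [catalan R m.+1]. *)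
rewrite big_ord_recl big_ord_recr/= subn0 r0 mul0r add0r /bump/= add1n subnn r0 mulr0 addr0.
rewrite {3}/radial/= -catalan_conv !mulr_sumr; apply: ler_sum => k _.
have km : (k <= m)%N by rewrite -ltnS.
rewrite /radial add1n subSS/= subSn//=.
have k0 : 0 < k.+1%:R :> R by rewrite ltr0n.
have l0 : 0 < (m - k).+1%:R :> R by rewrite ltr0n.
have mE : m.+2%:R = k.+1%:R + (m - k).+1%:R :> R.
  by rewrite -natrD; congr _%:R; lia.
have eE : eta ^+ m.+1 = eta * eta ^+ k * eta ^+ (m - k).
  by rewrite -mulrA -exprD subnKC// exprS.
rewrite mE eE.
have k1 : 1 <= k.+1%:R :> R by rewrite ler1n.
have l1 : 1 <= (m - k).+1%:R :> R by rewrite ler1n.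
move: k0 l0 k1 l1; set u := k.+1%:R; set v := (m - k).+1%:R => k0 l0 k1 l1.
set P := eta ^+ k; set Q := eta ^+ (m - k); set c := catalan R k; set d := catalan R (m - k).
have -> : eta * (P / u * c * (Q / v * d)) = (eta * P * Q * (c * d)) * (u * v)^-1.
  by field; rewrite !gt_eqF.
have -> : 2 * (eta * P * Q / (u + v) * (c * d)) = (eta * P * Q * (c * d)) * (2 / (u + v)).
  by field; rewrite gt_eqF// addr_gt0.
apply: ler_wpM2l; first by rewrite !mulr_ge0 ?exprn_ge0 ?catalan_ge0.
rewrite ler_pdivlMr ?addr_gt0// mulrC ler_pdivrMr ?mulr_gt0//.
nra.
Qed.

(** For each degree [k] of the first index, [vandermonde] produces the same factor [mul al], so that
    only the one-variable estimate [radial_conv] remains. *)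
Lemma conv_majorant al : eta * conv majorant majorant al <= 2 * majorant al.
Proof.
have [N NE] : exists N, N = mdeg al by exists (mdeg al).
have alN : (mdeg al <= N)%N by rewrite NE.
have -> : conv majorant majorant al =
    (\sum_(k < N.+1) radial k * radial (N - k)) * (mul al * mpow a al).
  rewrite (convE _ _ alN).
  transitivity (\sum_(k < N.+1) \sum_(b : box n N) \sum_(g : box n N | mval b + mval g == al)
    radial k * radial (N - k) * mpow a al *
    (if mdeg (mval b) == k then mul (mval b) * mul (mval g) else 0)).
    rewrite exchange_big/=; apply: eq_bigr => b _; rewrite exchange_big/=.
    apply: eq_bigr => g /eqP bg.
    have bgN : (mdeg (mval b) + mdeg (mval g) = N)%N by rewrite -mdegD bg.
    have bN : (mdeg (mval b) < N.+1)%N by rewrite ltnS -[leqRHS]bgN leq_addr.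
    have gN : (N - mdeg (mval b) = mdeg (mval g))%N by rewrite -[X in (X - _)%N]bgN addKn.
    rewrite (bigD1 (Ordinal bN))//= eqxx big1 ?addr0 => [|k kb]; last first.
      rewrite ifF ?mulr0//; apply: contraNF kb => /eqP kb; apply/eqP/val_inj.
      by rewrite /= kb.
    by rewrite !majorantE -bg mpowD gN; ring.
  rewrite mulr_suml; apply: eq_bigr => k _.
  under eq_bigr do rewrite -mulr_sumr.
  have kN : (k <= mdeg al)%N by rewrite -NE -ltnS.
  by rewrite -mulr_sumr vandermonde//; ring.
rewrite majorantE -NE mulrA [leRHS]mulrA; apply: ler_wpM2r; last exact: radial_conv.
by rewrite mulr_ge0 ?multinomial_ge0 ?mpow_ge0.
Qed.

End Majorant.
End Multinomial.

(** * A quantitative primitive for 2-cocycles *)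

(** Dependent choice with an invariant [P] and a relation [Q] between consecutive stages; it drives
    the nested balls, the successive approximations and the construction degree by degree. *)
Lemma stepwise_choice (X : Type) (P : nat -> X -> Prop) (Q : nat -> X -> X -> Prop) (x0 : X) :
  P 0%N x0 -> (forall k x, P k x -> exists y, P k.+1 y /\ Q k x y) ->
  exists f, f 0%N = x0 /\ forall k, P k (f k) /\ Q k (f k) (f k.+1).
Proof.
move=> P0 ex.
have /choice[F FP] (p : nat * X) : exists y, P p.1 p.2 -> P p.1.+1 y /\ Q p.1 p.2 y.
  by have [/ex[y ?]|?] := pselect (P p.1 p.2); [exists y|exists x0].
pose f := fix f k := if k is k'.+1 then F (k', f k') else x0.
have Pf k : P k (f k) by elim: k => //= k /(FP (k, _))[].
by exists f; split=> // k; split=> //; have [] := FP (k, f k) (Pf k).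
Qed.

Section OpenMapping.
Variables (R : realType) (H : completeNormedModType R[i]).
Variable (dot : {dot H for Num.conj}).
Hypothesis dot_norm : forall x : H, dot x x = `|x| ^+ 2.
Variables (G : groupType) (S : {fset G}).
Hypothesis S_gen : generates S.
Variable rho : G -> bop H.
Hypotheses (rho1 : rho 1%g = 1) (rhoM : forall g h, rho (g * h)%g = rho g * rho h).
Hypothesis rho_opb : forall g, opb (rho g) 1.

Local Notation hsb := (hsb dot).

Lemma hsb_rhol g (T : bop H) r : hsb T r -> hsb (rho g * T) r.
Proof. by move=> Tr; rewrite -[r]mul1r; exact: hsb_comp. Qed.

Lemma hsb_rhor g (T : bop H) r : hsb T r -> hsb (T * rho g) r.
Proof. by move=> Tr; rewrite -[r]mulr1; exact: hsb_compr. Qed.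

Lemma rhoV g : rho g * rho g^-1%g = 1.
Proof. by rewrite -rhoM mulgV. Qed.

Lemma rhoVl g : rho g^-1%g * rho g = 1.
Proof. by rewrite -rhoM mulVg. Qed.

Lemma hsb_eq0 (T : bop H) (c : R) : (forall e, 0 < e -> hsb T (c * e)) -> T = 0.
Proof.
move=> h; apply: bop_ext => x; rewrite bop0; apply: (@nrm_le_eps _ _ _ (c * nrm x)) => e e0.
by have [_ /(_ x)] := hsb_opb dot_norm (h e e0); rewrite mulrAC.
Qed.

(* The coboundary operators of the adjoint module, for cochains multiplied by [rho] on the right. *)
Definition delta (c : G -> bop H) (g h : G) : bop H := c g * rho h + rho g * c h - c (g * h)%g.

Definition cocycle2 (E : G -> G -> bop H) := forall g h k,
  E g h * rho k + E (g * h)%g k = rho g * E h k + E g (h * k)%g.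

Lemma deltaB c d g h : delta (c - d) g h = delta c g h - delta d g h.
Proof.
rewrite /delta -![(c - d) _]/(c _ - d _) mulrBl mulrBr.
bop_abel dot_norm.
Qed.

Lemma deltaZ a c g h : delta (a *: c) g h = a *: delta c g h.
Proof.
by rewrite /delta -![(a *: c) _]/(a *: c _) scalerBr scalerDr bop_scalerAl bop_scalerAr.
Qed.

Lemma delta0 g h : delta 0 g h = 0.
Proof. by rewrite /delta mul0r mulr0 addr0 subrr. Qed.

Lemma cocycle2_delta c : cocycle2 (delta c).
Proof.
move=> g h k; rewrite /delta !mulrBl !mulrDl !mulrBr !mulrDr !rhoM !mulrA mulgA.
bop_abel dot_norm.
Qed.

Lemma cocycle2B E F : cocycle2 E -> cocycle2 F -> cocycle2 (E - F).
Proof.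
move=> hE hF g h k; rewrite -![(E - F) _ _]/(E _ _ - F _ _).
by rewrite mulrBl mulrBr addrACA -opprD hE hF opprD addrACA.
Qed.

Lemma cocycle2Z a E : cocycle2 E -> cocycle2 (a *: E).
Proof.
move=> hE g h k; rewrite -![(a *: E) _ _]/(a *: E _ _).
by rewrite -bop_scalerAl -bop_scalerAr -!scalerDr hE.
Qed.

Variable w : G -> G -> R.
Hypothesis w_ge0 : forall g h, 0 <= w g h.

Definition hsop (T : bop H) := exists r, hsb T r.

Hypothesis solvable : forall E, cocycle2 E -> (forall g h, hsop (E g h)) ->
  exists2 c, forall g, hsop (c g) & forall g h, delta c g h = E g h.

Definition wball (r : R) (E : G -> G -> bop H) :=
  cocycle2 E /\ forall g h, hsb (E g h) (r * w g h).

Lemma wballB r s E F : wball r E -> wball s F -> wball (r + s) (E - F).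
Proof.
move=> [cE hE] [cF hF]; split=> [|g h]; first exact: cocycle2B.
by rewrite mulrDl; exact: hsbB.
Qed.

Lemma wballZ a r E : wball r E -> wball (nrm a * r) (a *: E).
Proof.
move=> [cE hE]; split=> [|g h]; first exact: cocycle2Z.
by rewrite -mulrA; exact: hsbZ.
Qed.

Lemma wballN r E : wball r E -> wball r (- E).
Proof.
move=> [cE hE]; split=> [|g h]; last exact: hsbN.
by rewrite -scaleN1r; exact: cocycle2Z.
Qed.

Lemma wballD r s E F : wball r E -> wball s F -> wball (r + s) (E + F).
Proof. by move=> hE /wballN hF; rewrite -[F]opprK; exact: wballB. Qed.

Lemma wball_le r s E : r <= s -> wball r E -> wball s E.
Proof.
by move=> rs [cE hE]; split=> // g h; apply: hsb_le (hE g h); rewrite ler_wpM2r.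
Qed.

Lemma wball0 r : 0 <= r -> wball r 0.
Proof.
move=> r0; split=> [g h k|g h]; last by apply: hsb0; rewrite mulr_ge0.
by rewrite mul0r mulr0.
Qed.

(** The elements admitting such an [N] contain [S] and form a subgroup, because [delta c] expresses
    [c (x * y)%g] and [c x^-1%g] through values already bounded. As one [N] serves all [c], bounds
    on [S] control convergence at every [g]. *)
Lemma growth g : exists N, 0 <= N /\ forall (c : G -> bop H) r A, 0 <= r -> 0 <= A ->
  (forall s, s \in S -> hsb (c s) A) -> (forall g h, hsb (delta c g h) (r * w g h)) ->
  hsb (c g) (N * (A + r)).
Proof.
pose K := [set g | exists N, 0 <= N /\ forall (c : G -> bop H) r A, 0 <= r -> 0 <= A ->
  (forall s, s \in S -> hsb (c s) A) -> (forall g h, hsb (delta c g h) (r * w g h)) ->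
  hsb (c g) (N * (A + r))].
have K1 : K 1%g.
  exists (w 1%g 1%g); split=> // c r A r0 A0 cA cw; have := cw 1%g 1%g.
  rewrite /delta rho1 mul1r mulr1 mulg1 addrK; apply: hsb_le.
  by rewrite mulrC ler_wpM2l// lerDr.
suff KT : K = setT by have : K g by rewrite KT.
apply: S_gen => //.
- move=> x y [N [N0 xN]] [M [M0 yM]]; exists (N + M + w x y); split; first by rewrite !addr_ge0.
  move=> c r A r0 A0 cA cw.
  have -> : c (x * y)%g = c x * rho y + rho x * c y - delta c x y.
    by rewrite /delta opprB addrC subrK.
  rewrite 2!mulrDl; apply: (@hsb_le _ _ _ _ (N * (A + r) + M * (A + r) + r * w x y)).
    by rewrite lerD2l mulrC ler_wpM2l// lerDr.
  apply: hsbB => //; apply: hsbD; first exact/hsb_rhor/xN.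
  exact/hsb_rhol/yM.
- move=> x [N [N0 xN]]; have [M [M0 M1]] := K1; exists (w x x^-1%g + N + M); split.
    by rewrite !addr_ge0.
  move=> c r A r0 A0 cA cw.
  have -> : c x^-1%g = rho x^-1%g * (delta c x x^-1%g - c x * rho x^-1%g + c 1%g).
    have -> : delta c x x^-1%g - c x * rho x^-1%g + c 1%g = rho x * c x^-1%g.
      by rewrite /delta mulgV; bop_abel dot_norm.
    by rewrite mulrA rhoVl mul1r.
  apply: hsb_rhol; rewrite 2!mulrDl.
  apply: (@hsb_le _ _ _ _ (r * w x x^-1%g + N * (A + r) + M * (A + r))).
    by rewrite !lerD2r mulrC ler_wpM2l// lerDr.
  apply: hsbD; last exact: M1.
  by apply: hsbB => //; exact/hsb_rhor/xN.
- move=> s sS; exists 1; split=> // c r A r0 A0 cA _.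
  by rewrite mul1r; apply: hsb_le (cA s sS); rewrite lerDl.
Qed.

(* Baire's argument: otherwise nested balls avoid, one after the other, the sets of
   the coboundaries of cochains bounded by [k] on [S]; these exhaust the cocycles. *)
Lemma almost_open : exists n : nat, forall E e, wball 1 E -> 0 < e ->
  exists c : G -> bop H, [/\ forall s, s \in S -> hsb (c s) n%:R, forall g, hsop (c g)
             & wball e (E - delta c)].
Proof.
apply: contrapT => /forallNP neg.
have /choice[bad badP] n : exists p : (G -> G -> bop H) * R, [/\ wball 1 p.1, 0 < p.2
    & forall c : G -> bop H, (forall s, s \in S -> hsb (c s) n%:R) -> (forall g, hsop (c g)) ->
      ~ wball p.2 (p.1 - delta c)].
  have /existsNP[E /existsNP[e /not_implyP[E1 /not_implyP[e0 nc]]]] := neg n.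
  by exists (E, e); split=> // c cS cG ce; apply: nc; exists c.
pose avoid k (x : G -> G -> bop H) r := forall c : G -> bop H, (forall s, s \in S -> hsb (c s) k%:R) ->
  (forall g, hsop (c g)) -> ~ wball r (x - delta c).
pose X : Type := (G -> G -> bop H) * R.
have [||f [f0 fP]] := @stepwise_choice X
    (fun k p => (exists r, wball r p.1) /\ 0 < p.2)
    (fun k p q => [/\ wball (p.2 / 2) (q.1 - p.1), q.2 <= p.2 / 2 & avoid k q.1 q.2])
    (0, 1).
- by split=> //; exists 0; exact: wball0.
- move=> k [x r] /= [[rx xr] r0].
  (* Bounds [(c1 - c2) / r] on [S] when [c1] and [c2] are bounded there by [k]. *)
  pose m := Num.bound (2 * k%:R / r).
  have km : 2 * k%:R / r <= m%:R.
    by apply/ltW/archi_boundP; rewrite divr_ge0 ?mulr_ge0// ltW.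
  have [/=] := badP m; case: (bad m) => E e /= E1 e0 nc.
  pose r' := Num.min (r / 2) (e * r / 2).
  have r'0 : 0 < r' by rewrite lt_min !divr_gt0// mulr_gt0.
  (* Not both [x + xi] and [x - xi] are within [r'] of admissible coboundaries: they differ by [r]
     times [E], so [E] would be within [2 * r' / r <= e] of the coboundary of [(c1 - c2) / r]. *)
  pose xi := (r / 2)%:C%C *: E.
  have xi_ball : wball (r / 2) xi.
    have := wballZ (r / 2)%:C%C E1.
    by rewrite mulr1 nrmR ger0_norm// divr_ge0// ltW.
  have [av|/existsNP[c1 /not_implyP[c1S /not_implyP[c1G /contrapT c1x]]]] := pselect (avoid k (x + xi) r').
    exists (x + xi, r'); split=> /=.
      by split=> //; exists (rx + r / 2); exact: wballD.
    by split; rewrite ?ge_min ?lexx//= addrAC subrr add0r.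
  exists (x - xi, r'); split=> /=.
    by split=> //; exists (rx + r / 2); exact: wballB.
  split; rewrite ?ge_min ?lexx//=; first by rewrite addrAC subrr add0r; exact: wballN.
  move=> c2 c2S c2G c2x.
  apply: (nc ((r^-1)%:C%C *: (c1 - c2))) => [s sS|g|].
  + have := hsbZ (r^-1)%:C%C (hsbB (c1S s sS) (c2S s sS)).
    apply: hsb_le; rewrite nrmR ger0_norm ?invr_ge0 ?(ltW r0)//.
    by have -> : r^-1 * (k%:R + k%:R) = 2 * k%:R / r by ring.
  + have [[u hu] [v hv]] := (c1G g, c2G g).
    by eexists; apply: hsbZ; apply: hsbB hu hv.
  + have -> : E - delta ((r^-1)%:C%C *: (c1 - c2)) =
        (r^-1)%:C%C *: ((x + xi - delta c1) - (x - xi - delta c2)).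
      apply/funext => g; apply/funext => h.
      rewrite -[LHS]/(E g h - delta _ g h) deltaZ deltaB.
      rewrite -[RHS]/(_ *: (x g h + (r / 2)%:C%C *: E g h - delta c1 g h - (x g h - (r / 2)%:C%C *: E g h - delta c2 g h))).
      have {1}-> : E g h = (r^-1)%:C%C *: (r%:C%C *: E g h).
        by rewrite scalerA -rmorphM mulVf ?gt_eqF//= rmorph1 scale1r.
      have -> : r%:C%C = 2 * (r / 2)%:C%C by rewrite -[2]/(1 + 1) mulrDl !mul1r -rmorphD -splitr.
      bop_abel dot_norm.
    apply: wball_le (wballZ _ (wballB c1x c2x)).
    rewrite nrmR ger0_norm ?invr_ge0 ?(ltW r0)// -mulr2n -mulr_natl mulrC ler_pdivrMr//.
    have : r' <= e * r / 2 by rewrite ge_min lexx orbT.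
    by rewrite ler_pdivlMr// mulrC.
have {}fP k := fP k.
pose x k := (f k).1; pose r k := (f k).2.
have r0 k : 0 < r k by have [[_]] := fP k.
have xS k : wball (r k / 2) (x k.+1 - x k) by have [_ []] := fP k.
have rS k : r k.+1 <= r k / 2 by have [_ []] := fP k.
have av k : avoid k (x k.+1) (r k.+1) by have [_ []] := fP k.
have rle k : r k <= 2^-1 ^+ k.
  elim: k => [|k IH]; first by rewrite /r f0 expr0.
  by rewrite (le_trans (rS k))// exprSr ler_wpM2r ?invr_ge0.
(* Since [r k / 2 <= r k - r k.+1], the steps telescope to the radius [r k - r j], and the limit
   stays within [r k] of [x k]. *)
have xC k j : (k <= j)%N -> wball (r k - r j) (x j - x k).
  move=> /subnKC <-; elim: (j - k)%N => [|d IH]; first by rewrite addn0 !subrr; exact: wball0.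
  rewrite addnS; apply: wball_le (_ : r (k + d)%N / 2 + (r k - r (k + d)%N) <= _) _.
    have := rS (k + d)%N; have := r0 (k + d)%N; lra.
  have -> : x (k + d).+1 - x k = (x (k + d).+1 - x (k + d)%N) + (x (k + d)%N - x k).
    by rewrite addrA subrK.
  exact: wballD.
have small c e : 0 <= c -> 0 < e -> exists k, r k * c <= e.
  move=> c0 e0; have c1 : 0 < c + 1 by rewrite ltr_wpDl.
  have [k hk] := half_expr_small (divr_gt0 e0 c1).
  exists k; apply: (@le_trans _ _ (r k * (c + 1))); first by rewrite ler_wpM2l ?(ltW (r0 k))// lerDl.
  by rewrite -ler_pdivlMr// (le_trans (rle k)).
have /choice[y0 y0P] (p : G * G) :
    exists L : bop H, forall k, hsb (L - x k p.1 p.2) (r k * w p.1 p.2).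
  apply: hsb_complete => // [k j kj|e e0]; last exact: small.
  have [_ /(_ p.1 p.2)] := xC k j kj; apply: hsb_le.
  by rewrite ler_wpM2r// lerBlDr lerDl ltW.
pose y g h := y0 (g, h).
have yx k g h : hsb (y g h - x k g h) (r k * w g h) by exact: (y0P (g, h)).
have x_cocycle k : cocycle2 (x k) by have [[[? []]]] := fP k.
have y_cocycle : cocycle2 y.
  move=> g h k; apply: subr0_eq.
  apply: (@hsb_eq0 _ (w g h + w (g * h)%g k + (w h k + w g (h * k)%g))) => e e0.
  have [j rj] := small 1 e ler01 e0; rewrite mulr1 in rj.
  have -> : y g h * rho k + y (g * h)%g k - (rho g * y h k + y g (h * k)%g) =
     ((y g h - x j g h) * rho k + (y (g * h)%g k - x j (g * h)%g k))
     - (rho g * (y h k - x j h k) + (y g (h * k)%g - x j g (h * k)%g)).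
    have := x_cocycle j g h k => /(congr1 (fun z => z - (rho g * x j h k + x j g (h * k)%g))).
    rewrite subrr => xc; rewrite mulrBl mulrBr -[LHS]subr0 -xc.
    bop_abel dot_norm.
  apply: (@hsb_le _ _ _ _ (r j * w g h + r j * w (g * h)%g k + (r j * w h k + r j * w g (h * k)%g))).
    by rewrite -!mulrDr mulrC ler_wpM2l// !addr_ge0.
  apply: hsbB => //; apply: hsbD => //; first exact: hsb_rhor.
  exact: hsb_rhol.
have y_hs g h : hsop (y g h).
  by exists (r 0%N * w g h); have := yx 0%N g h; rewrite /x f0 subr0.
have [c c_hs cy] := solvable y_cocycle y_hs.
have [b bP] := choice c_hs.
(* The primitive [c] of the limit is bounded by this [k] on [S], and [x k.+1] is within [r k.+1] of
   the limit: exactly what [av k] excludes. *)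
pose k := Num.bound (\sum_(s <- S) b s).
have b0 g : 0 <= b g by exact: hsb_ge0 (bP g).
apply: (av k c) => // [s sS|].
  apply: hsb_le (bP s).
  apply: (@le_trans _ _ (\sum_(s <- S) b s)).
    by rewrite (big_fsetD1 s)//= lerDl sumr_ge0.
  by apply/ltW/archi_boundP/sumr_ge0.
split; first by apply: cocycle2B => //; exact: cocycle2_delta.
move=> g h; rewrite -[(_ - _) g h]/(x k.+1 g h - delta c g h) cy -opprB.
exact/hsbN.
Qed.

(** Each rescaled residue is corrected by [almost_open] up to half its size, so the corrections are
    summable on [S]; [growth] turns this into convergence at every element of [G]. *)
Lemma bounded_solution : exists2 K, 0 <= K & forall E r, 0 <= r -> wball r E ->
  exists c : G -> bop H, [/\ forall g h, delta c g h = E g h, forall g, hsop (c g)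
    & forall s, s \in S -> hsb (c s) (K * r)].
Proof.
have [n nP] := almost_open.
pose q (j : nat) : R := 2^-1 ^+ j.
have q0 j : 0 < q j by rewrite exprn_gt0// invr_gt0.
have small c e : 0 <= c -> 0 < e -> exists k, c * q k <= e.
  move=> c0 e0; have c1 : 0 < c + 1 by rewrite ltr_wpDl.
  have [k hk] := half_expr_small (divr_gt0 e0 c1).
  exists k; apply: (@le_trans _ _ ((c + 1) * q k)); first by rewrite ler_wpM2r ?(ltW (q0 k))// lerDl.
  by rewrite mulrC -ler_pdivlMr.
have [N0 NP] := choice growth.
have N_ge0 g : 0 <= N0 g by have [] := NP g.
(* What [growth] gives for a cochain bounded by [2 * n] on [S] whose coboundary has radius [2]; the
   sum over [S] dominates each single bound. *)
pose K := \sum_(s <- S) N0 s * (2 * n%:R + 2).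
have unit_ball E : wball 1 E -> exists c : G -> bop H, [/\ forall g h, delta c g h = E g h,
    forall g, hsop (c g) & forall s, s \in S -> hsb (c s) K].
  move=> E1.
  have [||D [D0 DP]] := @stepwise_choice (G -> bop H)
    (fun j c => wball (q j) (E - delta c))
    (fun j c d => forall s, s \in S -> hsb (d s - c s) (n%:R * q j)) 0.
  - have -> : E - delta 0 = E; last by rewrite /q expr0.
    by apply/funext => g; apply/funext => h; rewrite -[LHS]/(E g h - delta 0 g h) delta0 subr0.
  - move=> j c Ec.
    have Ec' : wball 1 ((q j)^-1%:C%C *: (E - delta c)).
      have := wballZ (q j)^-1%:C%C Ec.
      by rewrite nrmR ger0_norm ?invr_ge0 ?(ltW (q0 j))// mulVf ?gt_eqF.
    have h2 : 0 < 2^-1 :> R by rewrite invr_gt0.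
    have [d [dS dG dE]] := nP _ _ Ec' h2.
    exists (c + (q j)%:C%C *: d); split; last first.
      move=> s sS; rewrite -[(c + _) s]/(c s + (q j)%:C%C *: d s) addrAC subrr add0r.
      have := hsbZ (q j)%:C%C (dS s sS); apply: hsb_le.
      by rewrite nrmR ger0_norm ?(ltW (q0 j))// mulrC.
    have := wballZ (q j)%:C%C dE; rewrite nrmR ger0_norm ?(ltW (q0 j))//.
    have -> : q j * 2^-1 = q j.+1 by rewrite /q exprSr.
    congr wball; apply/funext => g; apply/funext => h.
    rewrite -[RHS]/(E g h - delta (c + (q j)%:C%C *: d) g h).
    have -> : c + (q j)%:C%C *: d = c - (- (q j)%:C%C) *: d by rewrite scaleNr opprK.
    rewrite deltaB deltaZ.
    rewrite -[LHS]/((q j)%:C%C *: ((q j)^-1%:C%C *: (E g h - delta c g h) - delta d g h)).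
    rewrite scalerBr scalerA -rmorphM divff ?gt_eqF//= rmorph1 scale1r.
    bop_abel dot_norm.
  have DS i j s : s \in S -> (i <= j)%N -> hsb (D j s - D i s) (n%:R * (2 * q i - 2 * q j)).
    move=> sS /subnKC <-; elim: (j - i)%N => [|d IH].
      by rewrite addn0 !subrr mulr0; exact: hsb0.
    rewrite addnS; have [_ /(_ s sS) h] := DP (i + d)%N.
    have -> : D (i + d).+1 s - D i s = (D (i + d).+1 s - D (i + d)%N s) + (D (i + d)%N s - D i s).
      by rewrite addrA subrK.
    apply: hsb_le (hsbD h IH); rewrite -mulrDr ler_wpM2l//.
    have -> : q (i + d).+1 = q (i + d)%N * 2^-1 by rewrite /q exprSr.
    lra.
  have Dg i j g : (i <= j)%N -> hsb (D j g - D i g) (N0 g * (2 * n%:R + 2) * q i).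
    move=> ij; have qj := q0 j; have qi := q0 i.
    have qji : q j <= q i.
      by rewrite /q ler_wiXn2l// ?invr_ge0// invf_le1// ler1n.
    have -> : N0 g * (2 * n%:R + 2) * q i = N0 g * (n%:R * (2 * q i) + 2 * q i) by ring.
    have [_ /(_ (D j - D i)) h] := NP g; apply: h.
    - by rewrite mulr_ge0// ltW.
    - by rewrite !mulr_ge0// ltW.
    - move=> s sS; apply: hsb_le (DS i j s sS ij).
      by rewrite ler_wpM2l// lerBlDr lerDl mulr_ge0// ltW.
    - move=> g' h; rewrite deltaB.
      have -> : delta (D j) g' h - delta (D i) g' h = (E g' h - delta (D i) g' h) - (E g' h - delta (D j) g' h).
        bop_abel dot_norm.
      have [[[_ /(_ g' h) Ei] _] [[_ /(_ g' h) Ej] _]] := (DP i, DP j).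
      apply: hsb_le (hsbB Ei Ej).
      by rewrite -mulrDl ler_wpM2r//; lra.
  have /choice[c cP] g : exists L : bop H, forall k, hsb (L - D k g) (N0 g * (2 * n%:R + 2) * q k).
    apply: hsb_complete => // [k j kj|e e0]; first exact: Dg.
    by apply: small => //; rewrite mulr_ge0// addr_ge0// mulr_ge0.
  have cD g : hsb (c g) (N0 g * (2 * n%:R + 2)).
    by have := cP g 0%N; rewrite D0 subr0 /q expr0 mulr1.
  exists c; split=> [g h|g|s sS].
  - apply: subr0_eq.
    pose B := 2 * n%:R + 2 : R; have B0 : 0 <= B by rewrite addr_ge0// mulr_ge0.
    pose M := N0 g * B + N0 h * B + N0 (g * h)%g * B + w g h.
    have M0 : 0 <= M by rewrite !addr_ge0// mulr_ge0.
    apply: (@hsb_eq0 _ 1) => e e0; have [k kP] := small M e M0 e0.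
    rewrite mul1r; apply: hsb_le kP _.
    have -> : delta c g h - E g h = delta (c - D k) g h - (E g h - delta (D k) g h).
      by rewrite deltaB; bop_abel dot_norm.
    rewrite [M]/(_ + w g h) !mulrDl; apply: hsbB => //; last first.
      by have [[_ /(_ g h) ?] _] := DP k; rewrite mulrC.
    rewrite /delta; apply: hsbB; last exact: cP.
    by apply: hsbD; [exact/hsb_rhor/cP|exact/hsb_rhol/cP].
  - by exists (N0 g * (2 * n%:R + 2)).
  - apply: hsb_le (cD s); rewrite /K (big_fsetD1 s)//= lerDl sumr_ge0// => t _.
    by rewrite mulr_ge0// addr_ge0// mulr_ge0.
have K0 : 0 <= K by rewrite sumr_ge0// => t _; rewrite mulr_ge0// addr_ge0// mulr_ge0.
exists K => //.
move=> E r r_ge0 Er.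
(* At [r = 0] rescaling by [r^-1] is impossible, but then [E] vanishes. *)
have [r0|r0] := leP r 0.
  exists 0; split=> [g h|g|s sS]; [|by exists 0; exact: hsb0|].
    rewrite delta0; apply/esym/(@hsb_eq0 _ 1) => e e0.
    have [_ /(_ g h)] := Er; apply: hsb_le; apply: le_trans (_ : 0 <= _).
      exact: mulr_le0_ge0.
    by rewrite mulr_ge0// ltW.
  by apply: hsb0; rewrite mulr_ge0.
have Er' : wball 1 (r^-1%:C%C *: E).
  have := wballZ r^-1%:C%C Er.
  by rewrite nrmR ger0_norm ?invr_ge0 ?(ltW r0)// mulVf ?gt_eqF.
have [c [cE cG cS]] := unit_ball _ Er'.
exists (r%:C%C *: c); split=> [g h|g|s sS].
- rewrite deltaZ cE -[(_ *: E) g h]/(r^-1%:C%C *: E g h) scalerA -rmorphM divff ?gt_eqF//=.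
  by rewrite rmorph1 scale1r.
- by have [u hu] := cG g; eexists; exact: hsbZ hu.
- have := hsbZ r%:C%C (cS s sS); apply: hsb_le.
  by rewrite nrmR ger0_norm ?(ltW r0)// mulrC.
Qed.

End OpenMapping.

(** * The formal deformation *)

Section Deformation.
Variables (R : realType) (H : completeNormedModType R[i]).
Variable (dot : {dot H for Num.conj}).
Hypothesis dot_norm : forall x : H, dot x x = `|x| ^+ 2.
Variables (G : groupType) (S : {fset G}).
Hypothesis S_gen : generates S.
Variable rho : G -> bop H.
Hypotheses (rho1 : rho 1%g = 1) (rhoM : forall g h, rho (g * h)%g = rho g * rho h).
Hypothesis rho_opb : forall g, opb (rho g) 1.
Local Notation star := (star dot).
Hypothesis rho_star : forall g, star (rho g) * rho g = 1.
Variables (n : nat) (a : 'I_n -> R).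
Hypothesis a_ge0 : forall i, 0 <= a i.

Local Notation hsb := (hsb dot).
Local Notation series := (mindex n -> bop H).
Implicit Types (A B : series) (U V : G -> series) (al be : mindex n).
Local Notation Phi eta := (majorant (R := R) eta a).

Lemma rho_starr g : rho g * star (rho g) = 1.
Proof. by rewrite -[star _]mulr1 -(rhoV rho1 rhoM g) [star _ * _]mulrA rho_star mul1r. Qed.

Definition sstar A : series := fun be => star (A be).

Lemma star_conv A B al : star (conv A B al) = conv (sstar B) (sstar A) al.
Proof.
rewrite !(convE _ _ (leqnn _)) (star_sum dot_norm).
under eq_bigr => b _ do rewrite (star_sum dot_norm) big_mkcond.
rewrite exchange_big/=; apply: eq_bigr => b _; rewrite [RHS]big_mkcond.
by apply: eq_bigr => g _; rewrite addrC (starM dot_norm).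
Qed.

Lemma low_sstar A : low (sstar A) = sstar (low A).
Proof.
by apply/funext => be; rewrite /low /sstar; case: eqP; rewrite ?(star0 dot_norm).
Qed.

Lemma conv_low1 A B al : (mdeg al <= 1)%N -> conv (low A) (low B) al = 0.
Proof.
move=> al1; rewrite (@eq_conv_low _ _ A B (fun=> 0) (fun=> 0)).
- rewrite (convE _ _ (leqnn _)) big1// => b _; rewrite big1// => g _.
  by rewrite /low if_same mul0r.
- by move=> be; rewrite -mdeg_eq0; lia.
- by move=> be; rewrite -mdeg_eq0; lia.
Qed.

Lemma hsb_conv eta A B M N al : 1 <= eta -> 0 <= M -> 0 <= N ->
  (forall be, be != 0 -> (mdeg be < mdeg al)%N -> hsb (A be) (M * Phi eta be)) ->
  (forall be, be != 0 -> (mdeg be < mdeg al)%N -> hsb (B be) (N * Phi eta be)) ->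
  hsb (conv (low A) (low B) al) (M * N * conv (Phi eta) (Phi eta) al).
Proof.
move=> eta1 M0 N0 hA hB; have eta0 : 0 <= eta by exact: le_trans eta1.
have P0 be : 0 <= Phi eta be by exact: majorant_ge0.
rewrite !(convE _ _ (leqnn _)) mulr_sumr; apply: hsb_sum => b _.
rewrite mulr_sumr; apply: hsb_sum => g /eqP bg; rewrite /low.
have ge0 : 0 <= M * N * (Phi eta (mval b) * Phi eta (mval g)) by apply: mulr_ge0; apply: mulr_ge0.
case: eqP => [_|/eqP b0]; first by rewrite mul0r; exact: hsb0.
case: eqP => [_|/eqP g0]; first by rewrite mulr0; exact: hsb0.
rewrite mulrACA; apply: hsbM => //; [apply: hA|apply: hB] => //.
  by rewrite -[X in (_ < mdeg X)%N]bg mdegD -[X in (X < _)%N]addn0 ltn_add2l lt0n mdeg_eq0.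
by rewrite -[X in (_ < mdeg X)%N]bg mdegD -[X in (X < _)%N]add0n ltn_add2r lt0n mdeg_eq0.
Qed.

(** Giving up the factor [eta >= 1] leaves a constant free of [eta], as required where constants are
    fixed before [eta]. *)
Lemma conv_Phi_le eta al : 1 <= eta -> conv (Phi eta) (Phi eta) al <= 2 * Phi eta al.
Proof.
move=> eta1; have eta0 : 0 <= eta by exact: le_trans eta1.
apply: le_trans (conv_majorant eta0 a_ge0 al).
rewrite -[leLHS]mul1r ler_wpM2r// (convE _ _ (leqnn _)) sumr_ge0// => b _.
by rewrite sumr_ge0// => g _; rewrite mulr_ge0// majorant_ge0.
Qed.

(* [U g] stands for the series [(1 + \sum_al c_al g t^al) * rho g], of which only the
   coefficients of degree at most [m] are constrained. *)
Record level (eta : R) (m : nat) U : Prop := Level {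
  level_lead : forall g, U g 0 = rho g;
  level_hom : forall g h al, (mdeg al <= m)%N -> U (g * h)%g al = conv (U g) (U h) al;
  level_unit : forall g al, (mdeg al <= m)%N -> conv (sstar (U g)) (U g) al = mono 1 al;
  level_bound : forall s al, s \in S -> al != 0 -> (mdeg al <= m)%N ->
    hsb (U s al) (Phi eta al) }.

(** [U 1%g] is idempotent and isometric up to degree [m]: multiply [U 1%g * U 1%g = U 1%g] on the
    left by the adjoint series. *)
Lemma level_one eta m U al : level eta m U -> (mdeg al <= m)%N -> U 1%g al = mono 1 al.
Proof.
move=> lU alm; have lt be : (mdeg be <= mdeg al)%N -> (mdeg be <= m)%N.
  by move=> h; exact: leq_trans alm.
rewrite -[LHS]mul1r -conv_monol.
rewrite (@eq_conv_deg _ _ _ _ (conv (sstar (U 1%g)) (U 1%g)) (U 1%g))// => [|be /lt bem].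
  rewrite convA (@eq_conv_deg _ _ _ _ (sstar (U 1%g)) (U 1%g))// => [|be /lt bem].
    exact: level_unit lU _ _ _.
  by rewrite -(level_hom lU)// mulg1.
by rewrite (level_unit lU).
Qed.

(** Multiply [U g * U g^-1%g = 1] on the left by the adjoint series. Bounds thus pass to inverses
    unchanged, by [hsb_star]. *)
Lemma level_inv eta m U g al : level eta m U -> (mdeg al <= m)%N ->
  U g^-1%g al = star (U g al).
Proof.
move=> lU alm; have lt be : (mdeg be <= mdeg al)%N -> (mdeg be <= m)%N.
  by move=> h; exact: leq_trans alm.
rewrite -[LHS]mul1r -conv_monol.
rewrite (@eq_conv_deg _ _ _ _ (conv (sstar (U g)) (U g)) (U g^-1%g))// => [|be /lt bem].
  rewrite convA (@eq_conv_deg _ _ _ _ (sstar (U g)) (mono 1))// => [|be /lt bem].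
    by rewrite conv_monor mulr1.
  by rewrite -(level_hom lU)// mulgV (level_one lU).
by rewrite (level_unit lU).
Qed.

(* The constant depends neither on [m] nor on [eta], so that it can be fixed before [eta]. *)
Lemma level_growth g : exists M, 0 <= M /\ forall eta m U al, 1 <= eta -> level eta m U ->
  al != 0 -> (mdeg al <= m)%N -> hsb (U g al) (M * Phi eta al).
Proof.
pose K := [set g | exists M, 0 <= M /\ forall eta m U al, 1 <= eta -> level eta m U ->
  al != 0 -> (mdeg al <= m)%N -> hsb (U g al) (M * Phi eta al)].
suff KT : K = setT by have : K g by rewrite KT.
apply: S_gen.
- exists 0; split=> // eta m U al _ lU al0 alm.
  by rewrite (level_one lU)// /mono (negbTE al0) mul0r; exact: hsb0.
(* After [conv_split], [N] and [M] come from the two terms with a factor [rho], and [M * N * 2] from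
   [conv_Phi_le]. *)
- move=> x y [M [M0 xM]] [N [N0 yN]]; exists (N + M + M * N * 2); split.
    by rewrite !addr_ge0// !mulr_ge0.
  move=> eta m U al eta1 lU al0 alm.
  rewrite (level_hom lU)// conv_split// !(level_lead lU) 2!mulrDl.
  apply: hsbD; first by apply: hsbD; [apply/(hsb_rhol rho_opb)/yN|apply/(hsb_rhor dot_norm rho_opb)/xM]; eauto.
  apply: (@hsb_le _ _ _ _ (M * N * conv (Phi eta) (Phi eta) al)).
    by rewrite -[leRHS]mulrA ler_wpM2l ?mulr_ge0// conv_Phi_le.
  apply: hsb_conv => // be be0 bem; [apply: xM|apply: yN]; eauto.
    by rewrite (leq_trans (ltnW bem)).
  by rewrite (leq_trans (ltnW bem)).
- move=> x [M [M0 xM]]; exists M; split=> // eta m U al eta1 lU al0 alm.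
  by rewrite (level_inv _ lU)//; apply: hsb_star => //; exact: xM lU _ _.
- move=> s sS; exists 1; split=> // eta m U al eta1 lU al0 alm.
  by rewrite mul1r; exact: (level_bound lU).
Qed.

Section Step.
Hypothesis solvable : forall E, cocycle2 rho E -> (forall g h, hsop dot (E g h)) ->
  exists2 c, forall g, hsop dot (c g) & forall g h, delta rho c g h = E g h.

Lemma half_half (T : bop H) : (2^-1)%:C%C *: T + (2^-1)%:C%C *: T = T.
Proof. by rewrite -scalerDl -rmorphD/= -[2^-1]mul1r -splitr rmorph1 scale1r. Qed.

(* A primitive [c] of the obstruction [E] extends the morphism property by one degree. The
   unitarity defect [D] then satisfies [D (g h) = D h + rho h^* D g rho h], hence adding half
   of [rho D] to [c] restores unitarity without affecting the morphism property. *)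
Lemma level_step : exists2 eta, 1 <= eta & forall m U, (0 < m)%N -> level eta m U ->
  exists V, level eta m.+1 V /\ forall g al, (mdeg al <= m)%N -> V g al = U g al.
Proof.
have [M MP] := choice level_growth.
have M0 g : 0 <= M g by have [] := MP g.
have w0 g h : 0 <= M g * M h by exact: mulr_ge0.
have [K K0 KP] := bounded_solution dot_norm S_gen rho1 rhoM rho_opb w0 solvable.
(* In the end the new coefficients on [S] are bounded by [(K + 2^-1) * r al], where [r] is the
   convolution square of the majorant, and [eta * r al <= 2 * Phi eta al]. *)
exists (2 * (K + 1)); first lra.
set eta := 2 * (K + 1) => m U m0 lU; have eta1 : 1 <= eta by rewrite /eta; lra.
have eta0 : 0 <= eta by exact: le_trans eta1.
have Phi0 be : 0 <= Phi eta be by exact: majorant_ge0.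
(* Truncating above degree [m] makes the obstruction in degree [m.+1] minus a convolution of lower
   coefficients, which are already bounded. *)
pose V g be : bop H := if (mdeg be <= m)%N then U g be else 0.
have VU g be : (mdeg be <= m)%N -> V g be = U g be by rewrite /V => ->.
have V0 g : V g 0 = rho g by rewrite VU ?mdeg0// (level_lead lU).
have Vb g be : be != 0 -> hsb (V g be) (M g * Phi eta be).
  move=> be0; rewrite /V; case: leqP => bem; last by apply: hsb0; rewrite mulr_ge0.
  by have [_ h] := MP g; exact: h lU _ _.
pose E g h be := V (g * h)%g be - conv (V g) (V h) be.
have E0 g h be : (mdeg be <= m)%N -> E g h be = 0.
  move=> bem; rewrite /E VU// (level_hom lU)//; apply/subr0_eq.
  rewrite subr0; apply/eqP; rewrite subr_eq0; apply/eqP/eq_conv_deg => ga gab;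
    by rewrite VU// (leq_trans gab).
(* Expand [V] at the product of [g], [h], [k] along both bracketings. The obstruction starts in
   degree [m.+1], so there a product with [V] reduces to a product with [rho], and [convA] cancels
   the rest. *)
have E_cocycle al : mdeg al = m.+1 -> cocycle2 rho (fun g h => E g h al).
  move=> alm g h k.
  have VE x y : V (x * y)%g = (fun be => conv (V x) (V y) be + E x y be).
    by apply/funext => be; rewrite /E addrC subrK.
  have lE x y be : (mdeg be < mdeg al)%N -> E x y be = 0 by rewrite alm ltnS; exact: E0.
  have e1 : V (g * h * k)%g al =
      conv (conv (V g) (V h)) (V k) al + E g h al * rho k + E (g * h)%g k al.
    rewrite {1}VE/= (VE g h) convDl (@conv_leadl _ _ (E g h))// ?V0//; exact: lE.
  have e2 : V (g * (h * k))%g al =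
      conv (V g) (conv (V h) (V k)) al + rho g * E h k al + E g (h * k)%g al.
    rewrite {1}VE/= (VE h k) convDr (@conv_leadr _ _ _ (E h k))// ?V0//; exact: lE.
  move: e1; rewrite -mulgA e2 convA -!addrA => /addrI e3.
  by rewrite e3.
pose r al := conv (Phi eta) (Phi eta) al.
have r0 al : 0 <= r al.
  rewrite /r (convE _ _ (leqnn _)) sumr_ge0// => b _.
  by rewrite sumr_ge0// => g _; rewrite mulr_ge0.
have E_split g h al : mdeg al = m.+1 -> E g h al = - conv (low (V g)) (low (V h)) al.
  move=> alm; have al0 : al != 0 by rewrite -mdeg_eq0 alm.
  rewrite /E conv_split// !V0.
  have V_al x : V x al = 0 by rewrite /V alm ltnn.
  by rewrite !V_al mulr0 mul0r !add0r.
have [c cP] : exists c : mindex n -> G -> bop H, forall al, mdeg al = m.+1 ->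
    [/\ forall g h, delta rho (c al) g h = E g h al, forall g, hsop dot (c al g)
      & forall s, s \in S -> hsb (c al s) (K * r al)].
  have /choice[c cP] al : exists c : G -> bop H, mdeg al = m.+1 ->
      [/\ forall g h, delta rho c g h = E g h al, forall g, hsop dot (c g)
        & forall s, s \in S -> hsb (c s) (K * r al)].
    have [alm|alm] := pselect (mdeg al = m.+1); last by exists 0.
    have [|c cP] := KP (fun g h => E g h al) (r al) (r0 al); last by exists c.
    split; first exact: E_cocycle.
    move=> g h; rewrite E_split//; apply: hsbN.
    by rewrite mulrC; apply: hsb_conv => // be be0 _; exact: Vb.
  by exists c.
pose W g be : bop H := if mdeg be == m.+1 then c be g else V g be.
have WV g be : (mdeg be <= m)%N -> W g be = V g be.
  by rewrite /W; case: eqP => // ->; rewrite ltnn.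
have WU g be : (mdeg be <= m)%N -> W g be = U g be by move=> h; rewrite WV ?VU.
have W0 g : W g 0 = rho g by rewrite WV ?mdeg0.
have low_eq (X Y : series) (X' Y' : series) al : mdeg al = m.+1 ->
    (forall be, (mdeg be <= m)%N -> X be = X' be) -> (forall be, (mdeg be <= m)%N -> Y be = Y' be) ->
    conv (low X) (low Y) al = conv (low X') (low Y') al.
  by move=> alm XX YY; apply: eq_conv_low => be _; rewrite alm ltnS; [exact: XX|exact: YY].
have Whom g h al : (mdeg al <= m.+1)%N -> W (g * h)%g al = conv (W g) (W h) al.
  rewrite leq_eqVlt => /orP[/eqP alm|]; last first.
    rewrite ltnS => alm; rewrite WU// (level_hom lU)//.
    by apply: eq_conv_deg => be bea; rewrite WU// (leq_trans bea).
  have al0 : al != 0 by rewrite -mdeg_eq0 alm.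
  rewrite conv_split// !W0 (low_eq _ _ (V g) (V h))//; try by move=> be; exact: WV.
  rewrite /W alm eqxx; have [cE _ _] := cP al alm.
  have := cE g h; rewrite E_split// /delta => /(congr1 (fun z => - z)); rewrite opprK => <-.
  by bop_abel dot_norm.
pose D g be := mono 1 be - conv (sstar (W g)) (W g) be.
have D0 g be : (mdeg be <= m)%N -> D g be = 0.
  move=> bem; rewrite /D -(level_unit lU g bem); apply/eqP; rewrite subr_eq0; apply/eqP.
  by apply: eq_conv_deg => ga gab; rewrite /sstar WU// (leq_trans gab).
have Dstar g be : star (D g be) = D g be.
  rewrite /D (starD dot_norm) (starN dot_norm) star_conv; congr (_ - _).
    by rewrite /mono; case: ifP; rewrite ?(star1 dot_norm)// (star0 dot_norm).
  by congr conv; apply/funext => ga; rewrite /sstar (starK dot_norm).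
(* In the product of the adjoints of [W h] and [W g] with [W g] and [W h], the two middle factors
   give [1 - D g]. As [D g] starts in degree [m.+1], it only meets the constant terms of the outer
   factors. *)
have DM g h al : mdeg al = m.+1 -> D (g * h)%g al = D h al + star (rho h) * D g al * rho h.
  move=> alm.
  have DE x : conv (sstar (W x)) (W x) = fun be => mono 1 be + - D x be.
    by apply/funext => be; rewrite /D opprB addrC subrK.
  have mD x be : (mdeg be < mdeg al)%N -> - D x be = 0.
    by rewrite alm ltnS => /D0 ->; rewrite oppr0.
  rewrite /D (@eq_conv_deg _ _ _ _ (conv (sstar (W h)) (sstar (W g))) (conv (W g) (W h)))//; first last.
  - by move=> be; rewrite alm => /Whom.
  - by move=> be; rewrite alm => /Whom; rewrite /sstar => ->; rewrite star_conv.
  have -> : conv (conv (sstar (W h)) (sstar (W g))) (conv (W g) (W h)) al =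
      conv (sstar (W h)) (W h) al - star (rho h) * D g al * rho h.
    rewrite convA (_ : conv (sstar (W g)) (conv (W g) (W h)) =
        (fun be => W h be + conv (fun ga => - D g ga) (W h) be)); last first.
      by apply/funext => be; rewrite -convA DE convDl conv_monol mul1r.
    rewrite convDr (@conv_leadr _ _ _ (conv _ _)); last first.
      move=> be bea; rewrite conv_leadl ?mD ?mul0r// => ga gab; rewrite mD//.
      exact: ltn_trans bea.
    rewrite (@conv_leadl _ _ (fun ga => - D g ga)); last by move=> be; exact: mD.
    by rewrite {2}/sstar !W0 mulNr mulrN mulrA.
  by rewrite -[in RHS]/(D g al) opprB addrA addrAC.
pose c' g be : bop H := (2^-1)%:C%C *: (rho g * D g be).
pose Z g be := if mdeg be == m.+1 then W g be + c' g be else W g be.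
have ZW g be : (mdeg be <= m)%N -> Z g be = W g be.
  by rewrite /Z; case: eqP => // ->; rewrite ltnn.
have ZU g be : (mdeg be <= m)%N -> Z g be = U g be by move=> h; rewrite ZW ?WU.
have Z0 g : Z g 0 = rho g by rewrite ZW ?mdeg0.
exists Z; split; last exact: ZU.
split=> //.
- move=> g h al; rewrite leq_eqVlt => /orP[/eqP alm|]; last first.
    rewrite ltnS => alm; rewrite ZU// (level_hom lU)//.
    by apply: eq_conv_deg => be bea; rewrite ZU// (leq_trans bea).
  have al0 : al != 0 by rewrite -mdeg_eq0 alm.
  rewrite conv_split// !Z0 (low_eq _ _ (W g) (W h))//; try by move=> be; exact: ZW.
  rewrite /Z alm eqxx Whom ?alm// conv_split// !W0.
  have -> : c' (g * h)%g al = rho g * c' h al + c' g al * rho h.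
    rewrite /c' DM// mulrDr rhoM -bop_scalerAr -bop_scalerAl -scalerDr !mulrA.
    by rewrite -(mulrA (rho g) (rho h) (star (rho h))) rho_starr mulr1.
  rewrite mulrDr mulrDl; bop_abel dot_norm.
- move=> g al; rewrite leq_eqVlt => /orP[/eqP alm|]; last first.
    rewrite ltnS => alm; rewrite -(level_unit lU g alm).
    by apply: eq_conv_deg => be bea; rewrite /sstar ZU// (leq_trans bea).
  have al0 : al != 0 by rewrite -mdeg_eq0 alm.
  rewrite conv_split// (low_eq _ _ (sstar (W g)) (W g))//; first last.
  - by move=> be; exact: ZW.
  - by move=> be bem; rewrite /sstar ZW.
  rewrite /sstar -/(sstar _) Z0 /Z alm eqxx (starD dot_norm).
  have -> : mono 1 al = D g al + conv (sstar (W g)) (W g) al by rewrite /D subrK.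
  rewrite (@conv_split _ _ (sstar (W g)) (W g))//.
  rewrite -[sstar (W g) al]/(star (W g al)) -[sstar (W g) 0]/(star (W g 0)) !W0.
  have -> : star (c' g al) = (2^-1)%:C%C *: (D g al * star (rho g)).
    by rewrite /c' (starZ dot_norm) (starM dot_norm) Dstar.
  rewrite /c' mulrDr mulrDl -bop_scalerAr -bop_scalerAl mulrA rho_star mul1r.
  rewrite -(mulrA (D g al)) rho_star mulr1 -[in RHS](half_half (D g al)).
  bop_abel dot_norm.
- move=> s al sS al0; rewrite leq_eqVlt => /orP[/eqP alm|]; last first.
    by rewrite ltnS => alm; rewrite ZU//; exact: (level_bound lU).
  rewrite /Z alm eqxx /c' /D conv_split// W0 /mono (negbTE al0) sub0r.
  rewrite -[sstar (W s) al]/(star (W s al)) -[sstar (W s) 0]/(star (W s 0)) !W0.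
  have -> : W s al = c al s by rewrite /W alm eqxx.
  rewrite low_sstar.
  have Vs be : be != 0 -> (mdeg be < mdeg al)%N -> hsb (W s be) (1 * Phi eta be).
    move=> be0; rewrite alm ltnS mul1r => bem.
    by rewrite WU//; exact: (level_bound lU).
  set L := conv _ _ al.
  have hL : hsb L (r al).
    rewrite -[r al]mul1r -[1 * r al]mul1r mulrA /L -low_sstar /r.
    apply: hsb_conv => // be be0 bea.
    by apply: hsb_star => //; exact: Vs.
  have [_ _ /(_ s sS) hc] := cP al alm.
  (* The correction trades half of [c al s] for half of [rho s * star (c al s) * rho s], which obeys
     the same bound; only [L] adds to the estimate, by [r al / 2]. *)
  have -> : c al s + (2^-1)%:C%C *: (rho s * - (star (rho s) * c al s + star (c al s) * rho s + L))
     = (2^-1)%:C%C *: (c al s) - (2^-1)%:C%C *: (rho s * star (c al s) * rho s + rho s * L).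
    rewrite -{1}(half_half (c al s)) mulrN !mulrDr !mulrA rho_starr mul1r.
    bop_abel dot_norm.
  have hz (T : bop H) x : hsb T x -> hsb ((2^-1)%:C%C *: T) (2^-1 * x).
    by move=> /(hsbZ (2^-1)%:C%C); rewrite nrmR ger0_norm.
  apply: (@hsb_le _ _ _ _ (2^-1 * (K * r al) + 2^-1 * (K * r al + r al))).
    have := conv_majorant eta0 a_ge0 al; rewrite -/(r al) /eta.
    have := r0 al; nra.
  apply: hsbB; apply: hz => //; apply: hsbD; last exact: (hsb_rhol rho_opb).
  apply: (hsb_rhor dot_norm rho_opb); apply: (hsb_rhol rho_opb).
  exact: hsb_star.
Qed.

Variable b : 'I_n -> G -> bop H.
Hypothesis b_cocycle : forall i g h, delta rho (b i) g h = 0.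
Hypothesis b_skew : forall i g, star (rho g) * b i g + star (b i g) * rho g = 0.
Hypothesis b_bound : forall i s, s \in S -> hsb (b i s) (a i).

Lemma mdelta_inj : injective (@mdelta n).
Proof.
move=> i j /ffunP/(_ i); rewrite !ffunE eqxx.
by case: eqP.
Qed.

Lemma mdelta_neq0 (i : 'I_n) : mdelta i != 0.
Proof. by rewrite -mdeg_eq0 mdeg_delta. Qed.

Definition linear_part g be : bop H :=
  if be == 0 then rho g else \sum_i (if be == mdelta i then b i g else 0).

Lemma linear_part_delta g i : linear_part g (mdelta i) = b i g.
Proof.
rewrite /linear_part (negbTE (mdelta_neq0 i)) (bigD1 i)//= eqxx big1 ?addr0// => j ji.
by rewrite (inj_eq mdelta_inj) eq_sym (negbTE ji).
Qed.

(** Degree one involves no product of two nonconstant coefficients: multiplicativity is the cocycle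
    identity and unitarity is skew-adjointness. *)
Lemma level1 eta : level eta 1 linear_part.
Proof.
have lead g : linear_part g 0 = rho g by rewrite /linear_part eqxx.
have cases al : (mdeg al <= 1)%N -> al = 0 \/ exists i, al = mdelta i.
  by rewrite leq_eqVlt => /orP[/eqP/mdeg_eq1|]; [right|rewrite ltnS leqn0 mdeg_eq0 => /eqP; left].
split=> //.
- move=> g h al al1; have [->|[j ->]] := cases al al1; first by rewrite conv0 !lead.
  rewrite conv_split ?mdelta_neq0// conv_low1 ?mdeg_delta// !linear_part_delta !lead addr0.
  have := b_cocycle j g h; rewrite /delta => /subr0_eq <-; by rewrite addrC.
- move=> g al al1; have [->|[j ->]] := cases al al1.
    by rewrite conv0 /sstar lead rho_star /mono eqxx.
  rewrite conv_split ?mdelta_neq0// conv_low1 ?mdeg_delta//.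
  by rewrite /sstar !linear_part_delta !lead addr0 b_skew /mono (negbTE (mdelta_neq0 j)).
- move=> s al sS al0 al1; have [al00|[j ->]] := cases al al1; first by rewrite al00 eqxx in al0.
  by rewrite linear_part_delta majorant_delta; exact: b_bound.
Qed.

Lemma formal_deformation : exists eta U, [/\ 1 <= eta, forall m, level eta m U,
  forall g i, U g (mdelta i) = b i g
  & forall g, exists2 M, 0 <= M & forall al, al != 0 -> hsb (U g al) (M * Phi eta al)].
Proof.
have [eta eta1 step] := level_step.
(* The shift to [k.+1] is due to the condition [0 < m] in [level_step]: the construction starts from
   a series correct up to degree one. *)
have [||f [f0 fP]] := @stepwise_choice (G -> series) (fun k U => level eta k.+1 U)
    (fun k U V => forall g al, (mdeg al <= k.+1)%N -> V g al = U g al) linear_part.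
- exact: level1.
- by move=> k U lU; have [V [? ?]] := step k.+1 U isT lU; exists V.
have agree k j g al : (k <= j)%N -> (mdeg al <= k.+1)%N -> f j g al = f k g al.
  move=> /subnKC <- alk; elim: (j - k)%N => [|d IH]; first by rewrite addn0.
  rewrite addnS; have [_ ->] := fP (k + d)%N => //.
  by rewrite (leq_trans alk)// ltnS leq_addr.
(* Later stages leave settled coefficients unchanged, so each one may be read off at the stage given
   by its degree. *)
pose U g al := f (mdeg al) g al.
have UE k g al : (mdeg al <= k)%N -> U g al = f k g al.
  by move=> alk; rewrite /U (agree (mdeg al) k).
have lU m : level eta m U.
  split=> [g|g h al _|g al _|s al sS al0 _].
  - by rewrite /U mdeg0 f0 /linear_part eqxx.
  - have [lf _] := fP (mdeg al); rewrite {1}/U (level_hom lf)//.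
    by apply: eq_conv_deg => be bea; rewrite (UE _ _ _ bea).
  - have [lf _] := fP (mdeg al); rewrite -(level_unit lf g (leqnSn _)).
    by apply: eq_conv_deg => be bea; rewrite /sstar (UE _ _ _ bea).
  - by have [lf _] := fP (mdeg al); exact: (level_bound lf).
exists eta, U; split=> // [g i|g].
  by rewrite /U mdeg_delta (agree 0%N)// ?mdeg_delta// f0 linear_part_delta.
have [M [M0 h]] := level_growth g.
by exists M => // al al0; exact: h (lU (mdeg al)) _ _.
Qed.

End Step.

End Deformation.

(** * Convergence *)

Section OperatorLimits.
Variables (R : realType) (H : completeNormedModType R[i]).
Implicit Types (S T : bop H).

Lemma opb_le S M N : M <= N -> opb S M -> opb S N.
Proof.
move=> MN [M0 SM]; split=> [|x]; first exact: le_trans MN.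
by rewrite (le_trans (SM x))// ler_wpM2r// nrm_ge0.
Qed.

Lemma opb0 M : 0 <= M -> opb (0 : bop H) M.
Proof. by move=> M0; split=> // x; rewrite bop0 nrm0 mulr_ge0// nrm_ge0. Qed.

Lemma opbD S T M N : opb S M -> opb T N -> opb (S + T) (M + N).
Proof.
move=> [M0 SM] [N0 TN]; split=> [|x]; first exact: addr_ge0.
by rewrite bopD mulrDl (le_trans (ler_nrmD _ _))// lerD.
Qed.

Lemma opbN S M : opb S M -> opb (- S) M.
Proof. by move=> [M0 SM]; split=> // x; rewrite bopN nrmN. Qed.

Lemma opbB S T M N : opb S M -> opb T N -> opb (S - T) (M + N).
Proof. by move=> SM TN; apply: opbD => //; exact: opbN. Qed.

Lemma opbM S T M N : opb S M -> opb T N -> opb (S * T) (M * N).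
Proof.
move=> [M0 SM] [N0 TN]; split=> [|x]; first exact: mulr_ge0.
by rewrite bopM (le_trans (SM _))// -mulrA ler_wpM2l.
Qed.

Lemma opb_sum (I : Type) (r : seq I) (P : pred I) (F : I -> bop H) (f : I -> R) :
  (forall i, P i -> opb (F i) (f i)) ->
  opb (\sum_(i <- r | P i) F i) (\sum_(i <- r | P i) f i).
Proof.
move=> h; elim/big_rec2: _ => [|i x y Pi xy]; first exact: opb0.
by apply: opbD => //; exact: h.
Qed.

Lemma opb_eq0 T : (forall e, 0 < e -> opb T e) -> T = 0.
Proof.
move=> h; apply: bop_ext => x; rewrite bop0; apply: (@nrm_le_eps _ _ _ (nrm x)) => e e0.
by have [_ /(_ x)] := h e e0; rewrite mulrC.
Qed.

(** Operator bounds rather than Hilbert-Schmidt ones, because the constant terms [1] and [rho g] are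
    not Hilbert-Schmidt in infinite dimension. *)
Definition op_cvg (T : nat -> bop H) (L : bop H) :=
  forall e, 0 < e -> exists N, forall k, (N <= k)%N -> opb (L - T k) e.

Lemma op_cvg_unique (S T : nat -> bop H) (L L' : bop H) (d : nat -> R) :
  op_cvg S L -> op_cvg T L' -> (forall k, opb (S k - T k) (d k)) ->
  (forall e, 0 < e -> exists N, forall k, (N <= k)%N -> d k <= e) -> L = L'.
Proof.
move=> SL TL' ST d0; apply: subr0_eq; apply: opb_eq0 => e e0.
have e3 : 0 < e / 3 by rewrite divr_gt0.
have [[[N1 h1] [N2 h2]] [N3 h3]] := (SL _ e3, TL' _ e3, d0 _ e3).
pose k := maxn N1 (maxn N2 N3).
have k1 : (N1 <= k)%N by rewrite leq_maxl.
have k2 : (N2 <= k)%N by rewrite /k (leq_trans (leq_maxl _ _) (leq_maxr _ _)).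
have k3 : (N3 <= k)%N by rewrite /k (leq_trans (leq_maxr _ _) (leq_maxr _ _)).
have -> : L - L' = (L - S k) + (S k - T k) - (L' - T k).
  by rewrite addrA subrK opprB addrA subrK.
apply: opb_le (opbB (opbD (h1 k k1) (opb_le (h3 k k3) (ST k))) (h2 k k2)).
by lra.
Qed.

Lemma op_cvgM (S T : nat -> bop H) (L L' : bop H) :
  op_cvg S L -> op_cvg T L' -> op_cvg (fun k => S k * T k) (L * L').
Proof.
move=> SL TL' e e0; have [[M LM] [M' LM']] := (bop_opb L, bop_opb L').
have [M0 M'0] : 0 <= M /\ 0 <= M' by split; [case: LM|case: LM'].
have K0 : 0 < M + M' + 1 by rewrite ltr_wpDl// addr_ge0.
(* The bound [d <= 1] absorbs the quadratic error into [d * (M + M' + 1)]. *)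
pose d := Num.min 1 (e / (M + M' + 1)).
have d0 : 0 < d by rewrite lt_min ltr01 divr_gt0.
have [[N1 h1] [N2 h2]] := (SL _ d0, TL' _ d0).
exists (maxn N1 N2) => k; rewrite geq_max => /andP[k1 k2].
have -> : L * L' - S k * T k = (L - S k) * (L' - (L' - T k)) + L * (L' - T k).
  rewrite (_ : L' - (L' - T k) = T k); last by rewrite opprB addrC subrK.
  by rewrite mulrBl mulrBr [RHS]addrC [RHS]addrA subrK.
apply: opb_le (opbD (opbM (h1 k k1) (opbB LM' (h2 k k2))) (opbM LM (h2 k k2))).
have d1 : d <= 1 by rewrite ge_min lexx.
have d2 : d * (M + M' + 1) <= e by rewrite -ler_pdivlMr// ge_min lexx orbT.
apply: le_trans d2; nra.
Qed.

End OperatorLimits.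

Lemma op_cvg_star (R : realType) (H : completeNormedModType R[i])
    (dot : {dot H for Num.conj}) (dot_norm : forall x : H, dot x x = `|x| ^+ 2)
    (T : nat -> bop H) (L : bop H) :
  op_cvg T L -> op_cvg (fun k => star dot (T k)) (star dot L).
Proof.
move=> TL e /TL[N h]; exists N => k /h.
by rewrite -(starN dot_norm) -(starD dot_norm); exact: opb_star.
Qed.

Section UnconditionalSums.
Variables (R : realType) (H : completeNormedModType R[i]).
Variable (dot : {dot H for Num.conj}).
Hypothesis dot_norm : forall x : H, dot x x = `|x| ^+ 2.
Variables (T : choiceType) (I : set T) (f : T -> bop H) (s : T -> R) (B : R).
Hypothesis s_ge0 : forall i, 0 <= s i.
Hypothesis f_bound : forall i, I i -> hsb dot (f i) (s i).
Hypothesis s_bound : forall F : {fset T}, [set` F] `<=` I -> \sum_(i <- F) s i <= B.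

Lemma hs_absolutely_summable_bound : hs_absolutely_summable dot I f.
Proof.
split=> [i /f_bound/(hsbE dot_norm)[]//|].
apply: (@le_lt_trans _ _ B%:E); last exact: ltry.
apply/esum_leP => [i|F FI]; first exact: sqrtr_ge0.
apply: le_trans (s_bound FI); rewrite !big_seq; apply: ler_sum => i iF.
by have /(hsbE dot_norm)[] := f_bound (FI i iF).
Qed.

(** The sums over the sets of [exhaustion] converge by [hsb_complete], and any larger finite set
    differs from them by a tail. The limit is stated twice: [hs_sum] speaks of bare functions, while
    later arguments use bounds on [bop]. *)
Lemma unconditional_sum : exists L : bop H, hs_sum dot I f L /\
  forall e, 0 < e -> exists2 F : {fset T}, [set` F] `<=` I &
    forall F' : {fset T}, [set` F] `<=` [set` F'] -> [set` F'] `<=` I ->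
      hsb dot (L - \sum_(i <- F') f i) e.
Proof.
pose d (k : nat) : R := 2^-1 ^+ k.
have dp k : 0 < d k by rewrite exprn_gt0// invr_gt0.
have [F [FI Fmono far]] := exhaustion s_ge0 dp s_bound.
have diff k (F' : {fset T}) : (F k `<=` F')%fset -> [set` F'] `<=` I ->
    hsb dot (\sum_(i <- F') f i - \sum_(i <- F k) f i) (d k).
  move=> FF' F'I; rewrite (big_fset_subD _ FF') addrAC subrr add0r.
  have DI : [set` (F' `\` F k)%fset] `<=` I by move=> i /=; rewrite inE => /andP[_ /F'I].
  apply: hsb_le (_ : hsb dot (\sum_(i <- (F' `\` F k)%fset) f i) (\sum_(i <- (F' `\` F k)%fset) s i)).
    by apply: far => //; apply/fdisjointP => i; rewrite inE => /andP[].
  by rewrite !big_seq; apply: hsb_sum => i /DI; exact: f_bound.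
have [k j kj||L hL] := hsb_complete dot_norm (T := fun k => \sum_(i <- F k) f i) (b := d).
- by apply: diff => //; exact: Fmono.
- exact: half_expr_small.
have lim e : 0 < e -> exists2 F : {fset T}, [set` F] `<=` I &
    forall F' : {fset T}, [set` F] `<=` [set` F'] -> [set` F'] `<=` I ->
      hsb dot (L - \sum_(i <- F') f i) e.
  move=> e0; have [k hk] := half_expr_small (divr_gt0 e0 (ltr0Sn _ 1)).
  exists (F k) => // F' FF' F'I.
  have -> : L - \sum_(i <- F') f i =
     (L - \sum_(i <- F k) f i) - (\sum_(i <- F') f i - \sum_(i <- F k) f i).
    by rewrite opprB addrA subrK.
  apply: hsb_le (hsbB (hL k) (diff k F' _ F'I)); first by rewrite (splitr e) lerD.
  by apply/fsubsetP => i; exact: FF'.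
exists L; split=> //.
have e2 (e : R) : 0 < e -> e / 2 < e by move=> e0; lra.
split.
  have [F0 F0I h] := lim 1 ltr01.
  have /(hsbE dot_norm)[] // : hsb dot L (1 + \sum_(i <- F0) s i).
  rewrite -[L](subrK (\sum_(i <- F0) f i)); apply: hsbD; first exact: h.
  by rewrite !big_seq; apply: hsb_sum => i /F0I; exact: f_bound.
move=> e e0; have [F0 F0I h] := lim (e / 2) (divr_gt0 e0 (ltr0Sn _ _)).
exists F0 => // F' FF' F'I; have /(hsbE dot_norm)[_ _] := h F' FF' F'I.
move=> le; apply: le_lt_trans (e2 _ e0); apply: le_trans le.
rewrite le_eqVlt; apply/orP; left; apply/eqP; congr hs_norm.
apply/funext => x; rewrite bopB bop_sum.
by rewrite -[LHS]/(L x - (\sum_(i <- F') (f i : H -> H)) x) fct_sumE.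
Qed.

End UnconditionalSums.

Section Windows.
Variable n : nat.

Definition upto N : {fset mindex n} :=
  [fset mval b | b in [pred b : box n N | mdeg (mval b) <= N]%N]%fset.

Lemma mem_upto N al : (al \in upto N) = (mdeg al <= N)%N.
Proof.
apply/imfsetP/idP => /= [[b ? ->]//|alN].
by have [b bE] := mval_deg alN; rewrite -bE in alN *; exists b.
Qed.

Lemma sum_upto (V : nmodType) N (F : mindex n -> V) :
  \sum_(al <- upto N) F al = \sum_(b : box n N | (mdeg (mval b) <= N)%N) F (mval b).
Proof.
rewrite big_imfset/=; last by move=> b c _ _; exact: mval_inj.
by rewrite big_enum.
Qed.

End Windows.

Lemma geometric_sum_le (R : realType) (x : R) m : 0 <= x -> x < 1 ->
  \sum_(k < m) x ^+ k <= (1 - x)^-1.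
Proof.
move=> x0 x1; rewrite -[leRHS]mul1r ler_pdivlMr ?subr_gt0//.
by rewrite -opprB mulrN mulrC -subrX1 opprB lerBlDr lerDl exprn_ge0.
Qed.

(* With [x = u ^ 4], the factor [N.+1 * u ^ N.+1] is bounded. *)
Lemma sqr_expr_small (R : realType) (c x e : R) : 0 <= c -> 0 <= x -> x < 1 -> 0 < e ->
  exists N0, forall N, (N0 <= N)%N -> c * N.+1%:R ^+ 2 * x ^+ N.+1 <= e.
Proof.
move=> c0 x0 x1 e0; pose u := Num.sqrt (Num.sqrt x).
have u0 : 0 <= u by exact: sqrtr_ge0.
have xE : x = u ^+ 4 by rewrite (exprM u 2 2) !sqr_sqrtr// sqrtr_ge0.
have u1 : u < 1.
  by rewrite ltNge; apply/negP => u1; move: x1; rewrite xE ltNge exprn_ege1.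
pose C := (1 - u)^-1; have C0 : 0 < C by rewrite invr_gt0 subr_gt0.
have bound N : N.+1%:R * u ^+ N.+1 <= C.
  apply: le_trans (geometric_sum_le N.+1 u0 u1).
  rewrite mulr_natl -[X in _ *+ X]card_ord -sumr_const; apply: ler_sum => k _.
  by apply: ler_wiXn2l => //; [exact: ltW|exact: ltnW].
have d0 : 0 < e / (c * C ^+ 2 + 1) by rewrite divr_gt0// ltr_wpDl// mulr_ge0// exprn_ge0// ltW.
have uu1 : u ^+ 2 < 1 by rewrite expr_lt1.
have [N0 N0P] := expr_small (exprn_ge0 2 u0) uu1 d0.
exists N0 => N N0N.
have -> : c * N.+1%:R ^+ 2 * x ^+ N.+1 = c * (N.+1%:R * u ^+ N.+1) ^+ 2 * (u ^+ 2) ^+ N.+1.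
  by rewrite xE -!exprM ![(_ * N.+1)%N]mulnC ![u ^+ (N.+1 * _)]exprM; ring.
apply: (@le_trans _ _ ((c * C ^+ 2 + 1) * (u ^+ 2) ^+ N.+1)); last first.
  by rewrite mulrC -ler_pdivlMr ?N0P ?ltr_wpDl// ?mulr_ge0 ?exprn_ge0 ?(ltW C0)// leqW.
rewrite ler_wpM2r ?exprn_ge0//; apply: (@le_trans _ _ (c * C ^+ 2)); last by rewrite lerDl.
by rewrite ler_wpM2l// ler_sqr ?nnegrE ?mulr_ge0 ?exprn_ge0// ltW.
Qed.

Lemma sum_box_degree (n : nat) (V : nmodType) N (F : box n N -> V) :
  \sum_(b : box n N | (mdeg (mval b) <= N)%N) F b =
  \sum_(k < N.+1) \sum_(b : box n N | mdeg (mval b) == k) F b.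
Proof.
rewrite (partition_big (fun b : box n N => inord (mdeg (mval b)) : 'I_N.+1) predT)//=.
apply: eq_bigr => k _; apply: eq_bigl => b.
apply/andP/eqP => [[bN /eqP <-]|bk]; first by rewrite inordK.
by rewrite bk -ltnS ltn_ord; split=> //; apply/eqP/val_inj; rewrite /= inordK.
Qed.

Section Convergence.
Variables (R : realType) (H : completeNormedModType R[i]).
Variable (dot : {dot H for Num.conj}).
Hypothesis dot_norm : forall x : H, dot x x = `|x| ^+ 2.
Variables (G : groupType) (n : nat) (eta : R) (a t : 'I_n -> R).
Hypotheses (eta_ge1 : 1 <= eta) (a_ge0 : forall i, 0 <= a i).
Hypothesis t_small : \sum_i a i * `|t i| < (4 * eta)^-1.
Variable rho : G -> bop H.
Hypothesis rho_opb : forall g, opb (rho g) 1.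
Variable U : G -> mindex n -> bop H.
Hypothesis U0 : forall g, U g 0 = rho g.
Variable M : G -> R.
Hypothesis M_ge0 : forall g, 0 <= M g.
Hypothesis U_bound : forall g al, al != 0 -> hsb dot (U g al) (M g * majorant eta a al).

Let y i := a i * `|t i|.
Let Y := \sum_i y i.
Let q := 4 * eta * Y.
(** Equals [majorant eta a al] times the absolute value of [mpow t al]: the parameters are absorbed
    into [y]. *)
Let weight (al : mindex n) := majorant eta y al.

Let eta_ge0 : 0 <= eta. Proof. exact: le_trans eta_ge1. Qed.
Let y_ge0 i : 0 <= y i. Proof. by rewrite mulr_ge0. Qed.
Let Y_ge0 : 0 <= Y. Proof. exact: sumr_ge0. Qed.
Let q_ge0 : 0 <= q. Proof. by rewrite !mulr_ge0. Qed.
Let q_lt1 : q < 1.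
Proof.
have eta0 : 0 < 4 * eta by rewrite mulr_gt0// (lt_le_trans ltr01).
by rewrite /q mulrC -ltr_pdivlMr// mul1r.
Qed.
Let weight_ge0 al : 0 <= weight al. Proof. exact: majorant_ge0. Qed.

(** [sum_multinomial_le] leaves [radial eta k * Y ^+ k], and [radial eta k <= (4 * eta) ^+ k] by
    [catalan_le] and [eta >= 1]. *)
Lemma weight_degree N k : (k <= N)%N ->
  \sum_(b : box n N | mdeg (mval b) == k) weight (mval b) <= q ^+ k.
Proof.
move=> kN.
apply: (@le_trans _ _ (radial eta k * Y ^+ k)).
  apply: (@le_trans _ _ (radial eta k * \sum_(b : box n N | mdeg (mval b) == k)
     multinomial R (mval b) * mpow y (mval b))).
    rewrite mulr_sumr; apply: ler_sum => b /eqP bk.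
    by rewrite /weight majorantE bk.
  by rewrite ler_wpM2l ?radial_ge0// sum_multinomial_le.
case: k {kN} => [|k]; first by rewrite /radial invr0 mulr0 !mul0r expr0.
rewrite /q exprMn ler_wpM2r ?exprn_ge0// /radial/= exprMn mulrC.
apply: ler_pM; rewrite ?mulr_ge0 ?exprn_ge0 ?catalan_ge0 ?invr_ge0//.
  rewrite (le_trans (catalan_le R k))// exprS ler_peMl ?exprn_ge0// ler1n//.
rewrite exprS mulrC ler_pM ?invr_ge0 ?exprn_ge0//.
by rewrite (le_trans _ eta_ge1)// invf_le1// ler1n.
Qed.

Lemma weight_sum (F : {fset mindex n}) : \sum_(al <- F) weight al <= (1 - q)^-1.
Proof.
pose N := (\max_(al <- F) mdeg al)%N.
have FN : (F `<=` upto n N)%fset.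
  by apply/fsubsetP => al alF; rewrite mem_upto; exact: leq_bigmax_seq.
apply: le_trans (ler_sum_fset weight_ge0 FN) _.
rewrite sum_upto.
apply: (@le_trans _ _ (\sum_(k < N.+1) q ^+ k)).
  rewrite sum_box_degree.
  by apply: ler_sum => k _; exact: (weight_degree (ltn_ord k : k <= N)%N).
exact: geometric_sum_le.
Qed.

Definition wterm (A : mindex n -> bop H) al : bop H := (mpow t al)%:C%C *: A al.

Definition partial_sum N (A : mindex n -> bop H) : bop H :=
  \sum_(b : box n N | (mdeg (mval b) <= N)%N) wterm A (mval b).

(** [weight] vanishes at [0], whereas the constant term [rho g] has operator bound [1]; the extra
    summand accounts for it. *)
Let weight1 (al : mindex n) : R := (al == 0)%:R + weight al.

Let weight1_ge0 al : 0 <= weight1 al. Proof. by rewrite addr_ge0. Qed.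

Lemma weight1_degree N k : (k <= N)%N ->
  \sum_(b : box n N | mdeg (mval b) == k) weight1 (mval b) <= q ^+ k.
Proof.
move=> kN; case: k kN => [_|k kN].
  under eq_bigl do rewrite mdeg_eq0.
  apply: le_trans (sum_mindex_le N (F := weight1) 0 weight1_ge0) _.
  by rewrite /weight1 eqxx /weight majorant0 addr0 expr0.
apply: le_trans (weight_degree kN); apply: ler_sum => b /eqP bk.
by rewrite /weight1 -mdeg_eq0 bk add0r.
Qed.

Definition tame (x : R) (A : mindex n -> bop H) :=
  0 <= x /\ forall al, opb (wterm A al) (x * weight1 al).

(* Only the pairs of indices whose degrees add up to more than [N] contribute. *)
Lemma tame_conv N x z A B : tame x A -> tame z B ->
  opb (partial_sum N (conv A B) - partial_sum N A * partial_sum N B)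
      (x * z * N.+1%:R ^+ 2 * q ^+ N.+1).
Proof.
move=> [x0 Ax] [z0 Bz]; pose m := @mval n N.
have convP : partial_sum N (conv A B) = \sum_(b : box n N) \sum_(g : box n N)
    if (mdeg (m b) + mdeg (m g) <= N)%N then wterm A (m b) * wterm B (m g) else 0.
  transitivity (\sum_(al : box n N) \sum_(b : box n N) \sum_(g : box n N)
    if (m al == m b + m g) && (mdeg (m al) <= N)%N then wterm A (m b) * wterm B (m g) else 0).
    rewrite /partial_sum big_mkcond; apply: eq_bigr => al _.
    case: leqP => alN; last by rewrite big1// => b _; rewrite big1// => g _; rewrite andbF.
    rewrite /wterm (convE _ _ alN) scaler_sumr; apply: eq_bigr => b _.
    rewrite scaler_sumr big_mkcond; apply: eq_bigr => g _; rewrite andbT eq_sym.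
    case: eqP => // ->; rewrite mpowD rmorphM -scalerA.
    by rewrite [in LHS]bop_scalerAr [in LHS]bop_scalerAl.
  rewrite exchange_big/=; apply: eq_bigr => b _; rewrite exchange_big/=.
  apply: eq_bigr => g _; rewrite -big_mkcond/= -mdegD.
  case: leqP => bgN; last first.
    by rewrite big1// => al /andP[/eqP -> ]; rewrite leqNgt bgN.
  rewrite (eq_bigl (fun al : box n N => m al == m b + m g)); last first.
    by move=> al; case: eqP => //= ->.
  rewrite (sum_mval1 (fun=> wterm A (m b) * wterm B (m g)))// => i.
  by rewrite (leq_trans _ bgN)// leq_mdeg.
have prodP : partial_sum N A * partial_sum N B = \sum_(b : box n N | (mdeg (m b) <= N)%N)
    \sum_(g : box n N | (mdeg (m g) <= N)%N) wterm A (m b) * wterm B (m g).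
  by rewrite /partial_sum big_distrl; apply: eq_bigr => b _; rewrite big_distrr.
have -> : partial_sum N (conv A B) - partial_sum N A * partial_sum N B =
    - \sum_(b : box n N | (mdeg (m b) <= N)%N) \sum_(g : box n N | (mdeg (m g) <= N)%N)
      if (N < mdeg (m b) + mdeg (m g))%N then wterm A (m b) * wterm B (m g) else 0.
  rewrite prodP; apply/eqP; rewrite subr_eq addrC -subr_eq opprK; apply/eqP.
  rewrite convP [X in _ = X]big_mkcond [X in _ + X]big_mkcond -big_split/=; apply: eq_bigr => b _.
  case: (leqP (mdeg (m b)) N) => bN; last first.
    rewrite addr0 big1// => g _; rewrite ifF//; apply/negbTE; rewrite -ltnNge.
    exact: leq_trans (leq_addr _ _).
  rewrite [X in _ = X]big_mkcond [X in _ + X]big_mkcond -big_split/=; apply: eq_bigr => g _.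
  case: (leqP (mdeg (m g)) N) => gN; last first.
    rewrite addr0 ifF//; apply/negbTE; rewrite -ltnNge.
    exact: leq_trans (leq_addl _ _).
  by case: leqP; rewrite ?addr0 ?add0r.
apply: opbN.
apply: (@opb_le _ _ _ (\sum_(b : box n N | (mdeg (m b) <= N)%N) \sum_(g : box n N | (mdeg (m g) <= N)%N)
      if (N < mdeg (m b) + mdeg (m g))%N then (x * weight1 (m b)) * (z * weight1 (m g)) else 0)); last first.
  apply: opb_sum => b _; apply: opb_sum => g _.
  by case: ifP => _; [exact: opbM|exact: opb0].
rewrite sum_box_degree.
(* Each of the at most [N.+1 ^ 2] pairs of degrees [k], [l] with [k + l > N] contributes at most
   [x * z * q ^+ (k + l)], and [q < 1]. *)
apply: (@le_trans _ _ (\sum_(k < N.+1) \sum_(l < N.+1) x * z * q ^+ N.+1)); last first.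
  by rewrite !sumr_const !card_ord -!mulrnA -[leLHS]mulr_natr natrM le_eqVlt; apply/orP; left; apply/eqP; ring.
apply: ler_sum => k _; under eq_bigr do rewrite sum_box_degree.
rewrite exchange_big/=; apply: ler_sum => l _.
case: (ltnP N (k + l)) => kl; last first.
  rewrite big1 ?mulr_ge0 ?exprn_ge0// => b /eqP bk; rewrite big1// => g /eqP gl.
  by rewrite bk gl ltnNge kl.
apply: (@le_trans _ _ ((x * z) * ((\sum_(b : box n N | mdeg (m b) == k) weight1 (m b)) *
    (\sum_(g : box n N | mdeg (m g) == l) weight1 (m g))))).
  rewrite big_distrl mulr_sumr; apply: ler_sum => b /eqP bk.
  rewrite big_distrr mulr_sumr; apply: ler_sum => g /eqP gl.
  by rewrite bk gl kl mulrACA.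
rewrite ler_wpM2l ?mulr_ge0//.
apply: (@le_trans _ _ (q ^+ k * q ^+ l)).
  by apply: ler_pM; rewrite ?sumr_ge0// weight1_degree// -ltnS.
by rewrite -exprD ler_wiXn2l// ltW.
Qed.

(** The Cauchy product of the two series: [sqr_expr_small] makes the error of [tame_conv] tend to
    zero. *)
Lemma op_cvg_conv A B x z L L' K : tame x A -> tame z B ->
  op_cvg (partial_sum^~ A) L -> op_cvg (partial_sum^~ B) L' ->
  op_cvg (partial_sum^~ (conv A B)) K -> K = L * L'.
Proof.
move=> Ax Bz AL BL ABK.
apply: op_cvg_unique ABK (op_cvgM AL BL) (fun N => tame_conv N Ax Bz) _ => e e0.
by apply: sqr_expr_small => //; rewrite mulr_ge0//; [case: Ax|case: Bz].
Qed.

Lemma partial_sum_star N A :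
  partial_sum N (sstar dot A) = star dot (partial_sum N A).
Proof.
rewrite (star_sum dot_norm); apply: eq_bigr => b _.
by rewrite /wterm (starZ dot_norm).
Qed.

Lemma tame_star x A : tame x A -> tame x (sstar dot A).
Proof.
move=> [x0 Ax]; split=> // al; have := opb_star dot_norm (Ax al).
by rewrite /wterm (starZ dot_norm).
Qed.

Lemma op_cvg_mono1 : op_cvg (partial_sum^~ (mono 1)) 1.
Proof.
move=> e e0; exists 0%N => N _.
have -> : partial_sum N (mono 1) = 1; last by rewrite subrr; exact: opb0 (ltW e0).
have d0 : (mdeg (0%R : mindex n) <= N)%N by rewrite mdeg0.
have [b0 b0E] := mval_deg d0.
rewrite /partial_sum (bigD1 b0) ?b0E//= big1 ?addr0 => [|b /andP[_ bb0]].
  by rewrite /wterm mpow0 /mono eqxx rmorph1 scale1r.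
by rewrite /wterm /mono -b0E (inj_eq (@mval_inj _ _)) (negbTE bb0) scaler0.
Qed.

Lemma wterm_bound g al : al != 0 -> hsb dot (wterm (U g) al) (M g * weight al).
Proof.
move=> al0; have := hsbZ (mpow t al)%:C%C (U_bound g al0).
rewrite nrmR; apply: hsb_le; rewrite mulrCA ler_wpM2l//.
rewrite /weight !majorantE mulrCA ler_wpM2l ?radial_ge0// mulrCA.
rewrite ler_wpM2l ?multinomial_ge0// /mpow normr_prod -big_split.
rewrite le_eqVlt; apply/orP; left; apply/eqP; apply: eq_bigr => i _ /=.
by rewrite /y exprMn normrX mulrC.
Qed.

Lemma U_tame g : tame (M g + 1) (U g).
Proof.
split=> [|al]; first exact: addr_ge0.
rewrite /weight1; have [->|al0] := eqVneq al 0.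
  rewrite /wterm mpow0 rmorph1 scale1r U0; apply: opb_le (rho_opb g).
  by rewrite /weight majorant0 addr0 mulr1 lerDr.
rewrite add0r; apply: opb_le (hsb_opb dot_norm (wterm_bound g al0)).
by rewrite ler_wpM2r// lerDl.
Qed.

Hypotheses (rho1 : rho 1%g = 1) (rhoM : forall g h, rho (g * h)%g = rho g * rho h).

Definition coef g al : bop H := U g al * rho g^-1%g.

Let nonzero := [set al : mindex n | al != 0].

Lemma coef_bound g al : nonzero al -> hsb dot (wterm (coef g) al) (M g * weight al).
Proof.
move=> al0; rewrite /wterm /coef bop_scalerAl.
by apply: (hsb_rhor dot_norm rho_opb); exact: wterm_bound.
Qed.

Lemma Mweight_ge0 g al : 0 <= M g * weight al. Proof. exact: mulr_ge0. Qed.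

Lemma Mweight_sum g (F : {fset mindex n}) :
  \sum_(al <- F) M g * weight al <= M g * (1 - q)^-1.
Proof. by rewrite -mulr_sumr ler_wpM2l// weight_sum. Qed.

Lemma coef_summable g : hs_absolutely_summable dot nonzero (wterm (coef g)).
Proof.
apply: (hs_absolutely_summable_bound dot_norm (coef_bound g) (B := M g * (1 - q)^-1)).
by move=> F _; exact: Mweight_sum.
Qed.

Lemma coef_sum g : exists v : bop H, hs_sum dot nonzero (wterm (coef g)) v /\
  op_cvg (partial_sum^~ (U g)) ((1 + v) * rho g).
Proof.
have [v [v_sum v_lim]] := unconditional_sum dot_norm (Mweight_ge0 g) (coef_bound g)
  (fun F _ => Mweight_sum g F).
exists v; split=> // e e0; have [F F0 FP] := v_lim e e0.
(* Beyond the degrees occurring in [F], the degree window without [0] contains [F], so unconditional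
   convergence applies to it. *)
exists (\max_(al <- F) mdeg al)%N => N FN.
pose F' := (upto n N `\ 0)%fset.
have hF' : hsb dot (v - \sum_(al <- F') wterm (coef g) al) e.
  apply: FP => al /=; last by rewrite /F' !inE => /andP[].
  move=> alF; rewrite /F' !inE mem_upto; have := F0 al alF; rewrite /nonzero/= => ->/=.
  exact: leq_trans (leq_bigmax_seq _ _ _) FN.
have -> : (1 + v) * rho g - partial_sum N (U g) = (v - \sum_(al <- F') wterm (coef g) al) * rho g.
  rewrite /partial_sum -(sum_upto N (wterm (U g))) (big_fsetD1 0)/=; last first.
    by rewrite mem_upto mdeg0.
  rewrite /wterm mpow0 rmorph1 scale1r U0 mulrDl mul1r opprD addrACA subrr add0r.
  rewrite mulrBl; congr (_ - _); rewrite big_distrl; apply: eq_bigr => al _ /=.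
  by rewrite -bop_scalerAl /coef -mulrA -rhoM mulVg rho1 mulr1.
by apply: hsb_opb => //; exact: (hsb_rhor dot_norm rho_opb).
Qed.

Hypothesis U_hom : forall g h al, U (g * h)%g al = conv (U g) (U h) al.
Hypothesis U_unit : forall g al, conv (sstar dot (U g)) (U g) al = mono 1 al.

Lemma deformation_at : exists v : G -> bop H,
  [/\ forall g, hs_sum dot nonzero (wterm (coef g)) (v g),
      forall g h, (1 + v (g * h)%g) * rho (g * h)%g = ((1 + v g) * rho g) * ((1 + v h) * rho h)
    & forall g, star dot ((1 + v g) * rho g) * ((1 + v g) * rho g) = 1].
Proof.
have [v vP] := choice coef_sum; exists v; split=> [g|g h|g].
- by have [] := vP g.
- have [[[_ hg] [_ hh]] [_ hgh]] := (vP g, vP h, vP (g * h)%g).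
  apply: (op_cvg_conv (U_tame g) (U_tame h) hg hh).
  suff -> : conv (U g) (U h) = U (g * h)%g by [].
  by apply/funext => al; rewrite U_hom.
- have [_ hg] := vP g.
  apply/esym/(op_cvg_conv (tame_star (U_tame g)) (U_tame g)); [|exact: hg|].
    move=> e e0; have [N NP] := op_cvg_star dot_norm hg e0; exists N => k /NP.
    by rewrite partial_sum_star.
  suff -> : conv (sstar dot (U g)) (U g) = mono 1 by exact: op_cvg_mono1.
  by apply/funext => al; rewrite U_unit.
Qed.

End Convergence.

(** * Unitary representations *)

Section UnitaryRepresentation.
Variables (R : realType) (H : completeNormedModType R[i]).
Variable (dot : {dot H for Num.conj}).
Hypothesis dot_norm : forall x : H, dot x x = `|x| ^+ 2.

Definition to_bop (T : H -> H) : bop H := insubd 0 T.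

Lemma to_bopK (T : H -> H) : bounded_operator T -> to_bop T = T :> (H -> H).
Proof. by move=> /bounded_opP/bop_predP Tb; rewrite /to_bop insubdK. Qed.

Lemma HS_to_bopK (T : H -> H) : HS dot T -> to_bop T = T :> (H -> H).
Proof. by move=> [/to_bopK]. Qed.

Lemma hsop_HS (T : bop H) : hsop dot T -> HS dot T.
Proof. by move=> [r /(hsbE dot_norm)[]]. Qed.

Lemma HS_hsop (T : bop H) : HS dot T -> hsop dot T.
Proof. by move=> hT; exists (hs_norm dot T); exact: hsb_hs_norm. Qed.

Lemma unitary_opb (T : H -> H) : unitary_operator dot T -> opb T 1.
Proof.
move=> [_ Tdot _]; split=> // x; rewrite mul1r -(ler_sqr (nrm_ge0 _) (nrm_ge0 _)).
by rewrite -lecR -!(dot_nrm dot_norm) Tdot.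
Qed.

(** An isometry of an infinite-dimensional space need not be onto, whence the right inverse [S]. *)
Lemma unitary_of_star (T S : bop H) : star dot T * T = 1 -> T * S = 1 ->
  unitary_operator dot T.
Proof.
move=> TT TS; split=> [a x y|x y|y]; first exact: bop_linear.
  by rewrite (starP dot_norm) -bopM TT.
by exists (S y); rewrite -bopM TS.
Qed.

Variables (G : groupType) (pi : G -> H -> H).
Hypothesis pi_rep : unitary_rep dot pi.

Definition rho g : bop H := to_bop (pi g).

Lemma rhoE g : rho g = pi g :> (H -> H).
Proof.
have [pU _] := pi_rep; apply/to_bopK/bounded_opP.
by split; [have [] := pU g|exists 1; exact: unitary_opb].
Qed.

Lemma rho_opb g : opb (rho g) 1.
Proof. by rewrite rhoE; apply: unitary_opb; case: pi_rep. Qed.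

Lemma rhoM g h : rho (g * h)%g = rho g * rho h.
Proof. by apply: bop_ext => x; rewrite bopM !rhoE; have [_ ->] := pi_rep. Qed.

(** [pi 1%g] is idempotent and onto, hence the identity. *)
Lemma rho1 : rho 1%g = 1.
Proof.
have [pU _] := pi_rep; have [_ _ surj] := pU 1%g.
apply: bop_ext => x; have [y <-] := surj x.
by rewrite bop1 -{1}rhoE -bopM -rhoM mulg1 rhoE.
Qed.

Lemma rho_star g : star dot (rho g) * rho g = 1.
Proof.
have [pU _] := pi_rep; have [_ pdot _] := pU g.
apply: (bop_sep dot_norm) => x y.
by rewrite bopM -(starPr dot_norm) !rhoE pdot.
Qed.

Lemma AdE g (T : bop H) : Ad pi g T = rho g * T * rho g^-1%g :> (H -> H).
Proof. by apply/funext => x; rewrite !bopM !rhoE. Qed.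

(** Right multiplication by [rho] translates the conjugation action into the two-sided form of
    [delta]: a 2-cochain at [g], [h] is multiplied by [rho (g * h)%g] and a 1-cochain at [g] by
    [rho g]. *)
Lemma solvable_of_cohomology : cohomology_vanishes (Ad pi) (HS dot) 2 ->
  forall E, cocycle2 rho E -> (forall g h, hsop dot (E g h)) ->
  exists2 c, forall g, hsop dot (c g) & forall g h, delta rho c g h = E g h.
Proof.
move=> H2 E Ecocycle E_hs.
pose E' (g h : G) : bop H := E g h * rho (g * h)^-1%g.
have E'_hs g h : hsop dot (E' g h).
  by have [r hr] := E_hs g h; exists r; exact: (hsb_rhor dot_norm rho_opb).
pose e (x : 'I_2 -> G) : H -> H := E' (x ord0) (x ord_max).
have /H2[c c_hs ce] : cocycle (Ad pi) (HS dot) e.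
  split=> [x|]; first exact: hsop_HS.
  apply/funext => x.
  have -> : x = (fun i : 'I_3 => nth 1%g [:: x ord0; x (inord 1); x ord_max] i).
    apply/funext => -[[|[|[|//]]] i3]; congr x; apply: val_inj => //=.
    by rewrite inordK.
  move: (x ord0) (x (inord 1)) (x ord_max) => g h k.
  rewrite (differential2E (Ad pi) (fun g h => E' g h : H -> H)) AdE.
  suff : rho g * E' h k * rho g^-1%g - E' (g * h)%g k + E' g (h * k)%g - E' g h = 0.
    by move=> /(congr1 (@bop_fun _ _)).
  have -> : E' g h = E g h * rho k * rho (g * h * k)^-1%g.
    by rewrite /E' -mulrA -rhoM [in RHS]invgM mulVKg.
  rewrite /E' -!mulrA -rhoM -invgM !mulgA.
  rewrite !mulrA -!mulrBl -mulrDl -mulrBl.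
  suff -> : rho g * E h k - E (g * h)%g k + E g (h * k)%g - E g h * rho k = 0 by rewrite mul0r.
  have := Ecocycle g h k => /eqP; rewrite -subr_eq0 => /eqP/(congr1 -%R); rewrite oppr0 => <-.
  bop_abel dot_norm.
pose c' g : bop H := to_bop (c (fun=> g)).
have c'E g : c' g = c (fun=> g) :> (H -> H) by apply: HS_to_bopK; exact: c_hs.
exists (fun g => c' g * rho g) => [g|g h].
  have [r hr] : hsop dot (c' g) by apply: HS_hsop; rewrite c'E; exact: c_hs.
  by exists r; exact: (hsb_rhor dot_norm rho_opb).
have cc : c = cochain1_of (fun g => c' g : H -> H).
  apply/funext => x; rewrite /cochain1_of c'E; congr c.
  by apply/funext => i; rewrite ord1.
have := congr1 (fun F => F (fun i : 'I_2 => if i == ord0 then g else h)) ce.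
rewrite {1}cc differential1E AdE /e/= => eq.
have {}eq : rho g * c' h * rho g^-1%g - c' (g * h)%g + c' g = E' g h.
  exact/val_inj.
have := congr1 (fun T => T * rho (g * h)%g) eq.
rewrite /E' -[X in _ = X]mulrA -rhoM mulVg rho1 mulr1 => <-.
rewrite /delta mulrDl mulrBl -!mulrA -!rhoM mulKg.
bop_abel dot_norm.
Qed.

Section FirstOrder.
Variable c1 : G -> H -> H.
Hypothesis c1_cocycle : cocycle (Ad pi) (HS dot) (cochain1_of c1).

Lemma cocycle_HS g : HS dot (c1 g).
Proof. by have [+ _] := c1_cocycle; move=> /(_ (fun=> g)). Qed.

Lemma cocycle_delta g h : delta rho (fun g => to_bop (c1 g) * rho g) g h = 0.
Proof.
have [_ eq] := c1_cocycle.
have cc : cochain1_of c1 = cochain1_of (fun g => to_bop (c1 g) : H -> H).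
  by apply/funext => x; rewrite /cochain1_of HS_to_bopK//; exact: cocycle_HS.
have := congr1 (fun F => F (fun i : 'I_2 => if i == ord0 then g else h)) eq.
rewrite cc differential1E AdE => {}eq.
have {}eq : rho g * to_bop (c1 h) * rho g^-1%g - to_bop (c1 (g * h)%g) + to_bop (c1 g) = 0.
  exact/val_inj.
have := congr1 (fun T => T * rho (g * h)%g) eq; rewrite mul0r => <-.
rewrite /delta mulrDl mulrBl -!mulrA -!rhoM mulKg.
bop_abel dot_norm.
Qed.

(** With [star (rho g)] and [rho g] pulled out on the two sides, what remains is [c1 g] plus its
    adjoint. *)
Lemma skew_star g : skew_adjoint dot (c1 g) ->
  star dot (rho g) * (to_bop (c1 g) * rho g) + star dot (to_bop (c1 g) * rho g) * rho g = 0.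
Proof.
move=> skew; rewrite (starM dot_norm).
have -> : star dot (to_bop (c1 g)) = - to_bop (c1 g).
  apply: val_inj; rewrite /= (starE dot_norm) HS_to_bopK ?skew//; last exact: cocycle_HS.
by rewrite mulrN mulNr -mulrA subrr.
Qed.

End FirstOrder.
End UnitaryRepresentation.

(** * Passage to the statement with unbundled operators *)

Lemma fmul_conv (R : realType) (H : completeNormedModType R[i]) (n : nat)
    (A B : mindex n -> bop H) :
  fmul (fun a => A a : H -> H) (fun a => B a : H -> H) = fun a => conv A B a : H -> H.
Proof.
apply/funext => al; rewrite /fmul (fsum_mindex _ (leqnn _)) (convE _ _ (leqnn _)).
apply/funext => x; rewrite bop_sum fct_sumE; apply: eq_bigr => b _.
by rewrite bop_sum fct_sumE; apply: eq_bigr.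
Qed.

Lemma open_weighted_ball (R : realType) (n : nat) (a : 'I_n -> R) (r : R) :
  open [set t : 'rV[R]_n | \sum_i a i * `|t 0 i| < r].
Proof.
apply: (@open_comp _ _ (fun t : 'rV[R]_n => \sum_i a i * `|t 0 i|) [set x | x < r]); last exact: open_lt.
move=> t _; apply: (continuous_big (op := +%R)); first exact: add_continuous.
move=> i _ u; apply: (@continuous_comp _ _ _ (fun t : 'rV[R]_n => `|t 0 i|) ( *%R (a i))).
  apply: (@continuous_comp _ _ _ (fun t : 'rV[R]_n => t 0 i) (fun x : R => `|x|)).
    exact: coord_continuous.
  exact: norm_continuous.
exact: mulrl_continuous.
Qed.

Theorem theorem5p5 (R : realType)
    (G : groupType) (S : {fset G})
    (S_sym : forall s, s \in S -> s^-1%g \in S)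
    (S_gen : generates S)
    (H : completeNormedModType R[i]) (dot : {dot H for Num.conj})
    (dot_norm : forall x : H, dot x x = `|x| ^+ 2)
    (H_sep : separable H)
    (pi : G -> H -> H) (pi_rep : unitary_rep dot pi)
    (n : nat) (n_gt0 : (0 < n)%N)
    (c1 : 'I_n -> G -> H -> H)
    (c1_cocycle : forall i,
       cocycle (Ad pi) (HS dot) (cochain1_of (c1 i)))
    (c1_skew : forall i g, skew_adjoint dot (c1 i g))
    (a : 'I_n -> R)
    (aE : forall i, a i = \big[Num.max/0]_(s <- S) hs_norm dot (c1 i s))
    (H2_eq0 : cohomology_vanishes (Ad pi) (HS dot) 2) :
  exists (eta : R) (c : mindex n -> G -> H -> H),
    [/\ 1 <= eta,
        formal_unitary_deformation dot pi c,
        forall i g, c (mdelta i) g = c1 i g,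
        forall al : mindex n, al != 0 ->
          \big[Num.max/0]_(s <- S) hs_norm dot (c al s)
          <= eta ^+ (mdeg al).-1 * (mdeg al)%:R^-1 * multinomial R al
             * catalan R (mdeg al).-1 * mpow a al
      & let D := [set t : 'rV[R]_n | \sum_i a i * `|t 0 i| < (4 * eta)^-1] in
        let nonzero := [set al : mindex n | al != 0] in
        let term (t : 'rV[R]_n) g al := (mpow (t 0) al)%:C%C *: c al g in
        [/\ open D,
            forall t g, D t ->
              hs_absolutely_summable dot nonzero (term t g)
          & exists v : 'rV[R]_n -> G -> H -> H,
              forall t, D t ->
                (forall g, hs_sum dot nonzero (term t g) (v t g)) /\
                unitary_rep dot (fun g => (id + v t g) \o pi g)]].
Proof.
have a_ge0 i : 0 <= a i by rewrite aE; exact: bigmax_ge_id.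
pose r := rho pi.
have r1 : r 1%g = 1 := rho1 dot_norm pi_rep.
have rM g h : r (g * h)%g = r g * r h := rhoM dot_norm pi_rep g h.
have r_opb g : opb (r g) 1 := rho_opb dot_norm pi_rep g.
have r_star g : star dot (r g) * r g = 1 := rho_star dot_norm pi_rep g.
have rE g : r g = pi g :> (H -> H) := rhoE dot_norm pi_rep g.
pose b i g := to_bop (c1 i g) * r g.
have b_cocycle i g h : delta r (b i) g h = 0 := cocycle_delta dot_norm pi_rep (c1_cocycle i) g h.
have b_skew i g : star dot (r g) * b i g + star dot (b i g) * r g = 0.
  exact: (skew_star dot_norm (c1_cocycle i) (c1_skew i g)).
have b_bound i s : s \in S -> hsb dot (b i s) (a i).
  move=> sS; apply: (hsb_rhor dot_norm r_opb); rewrite aE.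
  have cHS : HS dot (c1 i s) := cocycle_HS (c1_cocycle i) s.
  have := hsb_hs_norm dot_norm (T := to_bop (c1 i s)); rewrite (HS_to_bopK cHS) => /(_ cHS).
  by apply: hsb_le; exact: (le_bigmax_seq _ _ xpredT (fun s => hs_norm dot (c1 i s))).
have solv := solvable_of_cohomology dot_norm pi_rep H2_eq0.
have [eta [U [eta1 lU Udelta Ugrowth]]] :=
  formal_deformation dot_norm S_gen r1 rM r_opb r_star a_ge0 solv b_cocycle b_skew b_bound.
have eta_ge0 : 0 <= eta by exact: le_trans eta1.
have U0 g : U g 0 = r g := level_lead (lU 0%N) g.
have Uhom g h al : U (g * h)%g al = conv (U g) (U h) al := level_hom (lU (mdeg al)) g h (leqnn _).
have Uunit g al : conv (sstar dot (U g)) (U g) al = mono 1 al :=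
  level_unit (lU (mdeg al)) g (leqnn _).
have [M MP] : exists M : G -> R, forall g, 0 <= M g /\
    forall al, al != 0 -> hsb dot (U g al) (M g * majorant eta a al).
  suff /choice[M MP] : forall g, exists m : R, 0 <= m /\
      forall al, al != 0 -> hsb dot (U g al) (m * majorant eta a al) by exists M.
  by move=> g; have [m m0 h] := Ugrowth g; exists m.
have M0 g : 0 <= M g by have [] := MP g.
have Ub g al : al != 0 -> hsb dot (U g al) (M g * majorant eta a al).
  by move=> al0; have [_] := MP g; apply.
pose c al g : H -> H := coef r U g al.
have cE g : fdeform pi c g = fun al => U g al : H -> H.
  apply/funext => al; apply/funext => x; rewrite /fdeform /= -rE.
  case: eqP => [->|_]; first by rewrite U0.
  by rewrite /c -bopM /coef -mulrA -rM mulVg r1 mulr1.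
exists eta, c; split=> //.
- split=> [al g al0|g h|g].
  + by have /(hsbE dot_norm)[] := hsb_rhor dot_norm r_opb g^-1%g (Ub g al al0).
  + rewrite !cE fmul_conv; apply/funext => al; by rewrite Uhom.
  + rewrite cE (_ : fadj dot _ = fun al => sstar dot (U g) al : H -> H); last first.
      by apply/funext => al; rewrite /fadj /sstar (starE dot_norm).
    rewrite fmul_conv; apply/funext => al; rewrite Uunit /fone /mono.
    by case: eqP.
- move=> i g; rewrite /c /coef Udelta /b -mulrA -rM mulgV r1 mulr1.
  by apply: HS_to_bopK; exact: (cocycle_HS (c1_cocycle i)).
- move=> al al0; rewrite -[leRHS]/(majorant eta a al).
  rewrite big_seq; apply: bigmax_le => [|s sS]; first exact: majorant_ge0.
  have h := level_bound (lU (mdeg al)) sS al0 (leqnn _).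
  by have /(hsbE dot_norm)[] := hsb_rhor dot_norm r_opb s^-1%g h.
- move=> D nonzero term; split.
  + exact: open_weighted_ball.
  + move=> t g Dt; exact: (coef_summable dot_norm eta1 a_ge0 Dt r_opb M0 Ub g).
  + have at_t (t : 'rV[R]_n) : exists w : G -> bop H, D t ->
      [/\ forall g, hs_sum dot nonzero (term t g) (w g),
      forall g h, (1 + w (g * h)%g) * r (g * h)%g = ((1 + w g) * r g) * ((1 + w h) * r h)
      & forall g, star dot ((1 + w g) * r g) * ((1 + w g) * r g) = 1].
      (* Outside [D] an arbitrary value makes [w] total in [t]. *)
      have [Dt|nDt] := pselect (D t); last by exists (fun=> 0).
      have [w wP] := deformation_at dot_norm eta1 a_ge0 Dt r_opb U0 M0 Ub r1 rM Uhom Uunit.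
      by exists w.
    have [w wP] := choice at_t.
    exists (fun t g => w t g : H -> H) => t Dt; have [wsum wM wstar] := wP t Dt.
    split=> //.
    have VE g : (id + (w t g : H -> H)) \o pi g = (1 + w t g) * r g :> (H -> H).
      by apply/funext => x; rewrite bopM -rE.
    (* The summed operator at the unit is an idempotent isometry, hence [1]. The operator at
       [g^-1%g] is then a right inverse of the one at [g], which gives surjectivity. *)
    pose V := (1 + w t 1%g) * r 1%g.
    have VV : V = V * V by rewrite /V -wM mulg1.
    have V1 : V = 1.
      by rewrite -[LHS]mul1r -{1}(wstar 1%g) -/V -mulrA -VV wstar.
    split=> [g|g h]; rewrite !VE.
      apply: (unitary_of_star dot_norm (wstar g) (S := (1 + w t g^-1%g) * r g^-1%g)).
      by rewrite -wM mulgV; exact: V1.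
    by rewrite wM.
Qed.
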